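(* Let $h:\mathbb{C}\to\mathbb{C}$ be an affine mapping, let $c\in\mathbb{C}$, and write $H(z)=h(z)^2$, so that $(H+c)(z)=h(z)^2+c$. Let $\psi$ be the quasiconformal Böttcher-type coordinate of $H+c$ near infinity described in the context. (i) If $0\notin I(H+c)$, then $\psi$ can be continued injectively to a locally quasiconformal map $I(H+c)\to I(H)$. (ii) If $0\in I(H+c)$, then $\psi$ cannot be extended to the whole of $I(H+c)$, but may be extended injectively to a domain containing $c$.
   Context: Affine mappings are taken in the normal form $h=h_{K,\theta}$, the stretch by a factor $K>0$ in the direction $e^{i\theta}$: $h_{K,\theta}(z)=\frac{K+1}{2}z+e^{2i\theta}\frac{K-1}{2}\bar z$. For a map $F:\mathbb{C}\to\mathbb{C}$ the escaping set is $I(F)=\{z\in\mathbb{C}: F^n(z)\to\infty\}$, where $F^n$ is the $n$-th iterate. The map $\psi$: write $f=H+c$ and $g(z)=z^2+c$, so $f=g\circ h$. In a neighbourhood $U$ of infinity put $\psi_0(z)=z$ and, for $k\ge1$, $\psi_k=h^{-1}\circ q_k\circ h$, where $q_k$ is the continuous branch near infinity of the square root of $\psi_{k-1}\circ g$ with $q_k(z)/z\to1$ as $z\to\infty$ (so $\psi_k$ is a branch of $H^{-k}\circ f^k$). The maps $\psi_k$ converge uniformly on $U$ to a quasiconformal map $\psi$, which satisfies $H(\psi(z))=\psi(f(z))$ for $z\in U$, $\psi(z)=z+o(1)$ as $z\to\infty$, and is asymptotically conformal as $|z|\to\infty$ (its complex dilatation tends to $0$ at infinity). A map is locally quasiconformal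 if every point of its domain has a neighbourhood on which it is quasiconformal; no global bound on the dilatation is required. *)

(* Defs.v *)
From HB Require Import structures.
From mathcomp Require Import all_boot all_order all_algebra.
From mathcomp Require Import all_classical all_reals all_analysis.
From mathcomp Require Import complex.
From mathcomp Require Import ring.

Set Implicit Arguments.
Unset Strict Implicit.
Unset Printing Implicit Defensive.

Import Order.TTheory GRing.Theory Num.Theory.
Import numFieldNormedType.Exports.

Local Open Scope classical_set_scope.
Local Open Scope ring_scope.
Local Open Scope complex_scope.

(* The metric topology of the norm `|z| : R[i], which the library only puts on
   the alias R[i]^o. *)
#[warnings="-redundant-canonical-projection"]
HB.instance Definition _ (R : realType) :=
  PseudoMetricNormedZmod.copy R[i] R[i]^o.

(* On R[i] the norm and the order are R[i]-valued, hence the casts _%:C in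
   inequalities below. *)
Definition at_infty (R : realType) : set_system R[i] :=
  [set A | exists r : R, forall z, r%:C < `|z| -> A z].
Arguments at_infty R : clear implicits.

Global Instance at_infty_filter (R : realType) : ProperFilter (at_infty R).
Proof.
split.
- case=> r /(_ (`|r| + 1)%:C); apply.
  rewrite ger0_norm ?ltcR ?lecR ?addr_ge0//.
  by rewrite (le_lt_trans (ler_norm r)) // ltrDl.
- split; first by exists 0.
  + move=> A B [r rA] [s sB]; exists (Num.max r s) => z rsz; split.
    * by apply/rA/(le_lt_trans _ rsz); rewrite lecR le_max lexx.
    * by apply/sB/(le_lt_trans _ rsz); rewrite lecR le_max lexx orbT.
  + by move=> A B AB [r rA]; exists r => z /rA /AB.
Qed.

Section QuasiconformalMaps.
Variable R : realType.

Let mu := (@lebesgue_measure R \x @lebesgue_measure R)%E.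

Definition cplx (p : R * R) : R[i] := p.1 +i* p.2.

(* C^1 rather than C^oo test functions: both give the same weak derivatives on
   L2_loc. *)
Definition test_function (D : set (R * R)) (phi : R * R -> R) : Prop :=
  [/\ forall p, differentiable phi p,
      forall e, continuous ('D_e phi : R * R -> R) &
      exists2 A : set (R * R), compact A /\ A `<=` D &
        forall p, ~ A p -> phi p = 0].

Definition L2_loc (D : set (R * R)) (u : R * R -> R) : Prop :=
  measurable_fun D u /\
  forall A : set (R * R), compact A -> A `<=` D ->
    (\int[mu]_(p in A) (u p ^+ 2)%:E < +oo)%E.

Definition weak_derivative (e : R * R) (D : set (R * R)) (u v : R * R -> R)
    : Prop :=
  forall phi, test_function D phi ->
    \int[mu]_(p in D) (u p * 'D_e phi p) = - \int[mu]_(p in D) (v p * phi p).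

Definition W12_loc (D : set (R * R)) (u ux uy : R * R -> R) : Prop :=
  [/\ L2_loc D u, L2_loc D ux, L2_loc D uy,
      weak_derivative (1, 0) D u ux & weak_derivative (0, 1) D u uy].

(* f belongs to W^{1,2}_loc(D), with weak partial derivatives fx and fy. *)
Definition weak_gradient (D : set R[i]) (f fx fy : R[i] -> R[i]) : Prop :=
  let on_plane part g := fun p => part (g (cplx p)) : R in
  let D' := cplx @^-1` D in
  W12_loc D' (on_plane (@complex.Re R) f) (on_plane (@complex.Re R) fx)
             (on_plane (@complex.Re R) fy) /\
  W12_loc D' (on_plane (@complex.Im R) f) (on_plane (@complex.Im R) fx)
             (on_plane (@complex.Im R) fy).

Definition d_z (fx fy : R[i] -> R[i]) (z : R[i]) : R[i] :=
  (fx z - 'i * fy z) / 2%:R.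

Definition d_zbar (fx fy : R[i] -> R[i]) (z : R[i]) : R[i] :=
  (fx z + 'i * fy z) / 2%:R.

(* The complex dilatation f_zbar / f_z is at most k in modulus a.e. in D. *)
Definition dilatation_le (D : set R[i]) (k : R) (fx fy : R[i] -> R[i]) : Prop :=
  {ae mu, forall p, D (cplx p) ->
    `|d_zbar fx fy (cplx p)| <= k%:C * `|d_z fx fy (cplx p)|}.

Definition homeo_onto_image (D : set R[i]) (f : R[i] -> R[i]) : Prop :=
  [/\ {in D &, injective f}, {within D, continuous f} &
      forall W, open W -> W `<=` D -> open (f @` W)].

Definition quasiconformal (D : set R[i]) (f : R[i] -> R[i]) : Prop :=
  [/\ open D, homeo_onto_image D f &
      exists fx fy, weak_gradient D f fx fy /\
        exists2 k : R, 0 <= k < 1 & dilatation_le D k fx fy].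

Definition locally_quasiconformal (D : set R[i]) (f : R[i] -> R[i]) : Prop :=
  forall z, D z -> exists W, [/\ W z, W `<=` D & quasiconformal W f].

Definition asymptotically_conformal (D : set R[i]) (f : R[i] -> R[i]) : Prop :=
  exists fx fy, weak_gradient D f fx fy /\
    forall eps : R, 0 < eps -> exists r : R,
      dilatation_le (D `&` [set z | r%:C < `|z|]) eps fx fy.

End QuasiconformalMaps.

Section Dynamics.
Variable R : realType.

Definition stretch (K theta : R) (z : R[i]) : R[i] :=
  ((K + 1) / 2%:R)%:C * z +
  (cos (2%:R * theta) +i* sin (2%:R * theta)) * ((K - 1) / 2%:R)%:C * conjc z.

Lemma stretchK (K theta : R) : K != 0 ->
  cancel (stretch K theta) (stretch K^-1 theta).
Proof.
move=> K0 [x y]; rewrite /stretch.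
have := cos2Dsin2 (2%:R * theta).
move: (cos _) (sin _) => a b ab.
have b2 : b ^+ 2 = 1 - a ^+ 2 by rewrite -ab addrC addKr.
apply/eqP; rewrite eq_complex /=; apply/andP; split; apply/eqP;
  field: b2; done.
Qed.

Definition escaping_set (F : R[i] -> R[i]) : set R[i] :=
  [set z | iter n F z @[n --> \oo] --> at_infty R].

Definition sqr_stretch (K theta : R) (z : R[i]) : R[i] := stretch K theta z ^+ 2.

Definition sqr_stretch_add (K theta : R) (c z : R[i]) : R[i] :=
  sqr_stretch K theta z + c.

(* psi 0, psi 1, ... are the branches of H^{-k} o f^k on U; note that
   h^{-1} = stretch K^-1 theta by stretchK. *)
Definition bottcher_iterates (K theta : R) (c : R[i]) (U : set R[i])
    (psi : nat -> R[i] -> R[i]) : Prop :=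
  let h := stretch K theta in
  let g w := w ^+ 2 + c in
  (forall z, U z -> psi 0%N z = z) /\
  forall k, exists q : R[i] -> R[i],
    [/\ {within h @` U, continuous q},
        forall w, (h @` U) w -> q w ^+ 2 = psi k (g w),
        q w / w @[w --> at_infty R] --> (1 : R[i]) &
        forall z, U z -> psi k.+1 z = stretch K^-1 theta (q (h z))].

Definition bottcher_coordinate (K theta : R) (c : R[i]) (U : set R[i])
    (psi : R[i] -> R[i]) : Prop :=
  let H := sqr_stretch K theta in
  let f := sqr_stretch_add K theta c in
  [/\ [/\ open U, connected U, at_infty R U & f @` U `<=` U],
      exists2 psik, bottcher_iterates K theta c U psik &
        {uniform U, psik @ \oo --> psi},
      quasiconformal U psi /\ asymptotically_conformal U psi,
      forall z, U z -> H (psi z) = psi (f z) &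
      psi z - z @[z --> at_infty R] --> (0 : R[i])].

(* Extensions of the coordinate psi from U to V are required to keep the
   conjugacy: without it they are not determined by psi, as quasiconformal
   maps have no identity theorem. *)
Definition extends_coordinate (K theta : R) (c : R[i]) (U : set R[i])
    (psi : R[i] -> R[i]) (V : set R[i]) (Psi : R[i] -> R[i]) : Prop :=
  let H := sqr_stretch K theta in
  let f := sqr_stretch_add K theta c in
  [/\ U `<=` V, {in U, psi =1 Psi}, {within V, continuous Psi} &
      forall z, V z -> V (f z) /\ H (Psi z) = Psi (f z)].

End Dynamics.

(* Main.v *)
(* The map H = h^2 satisfies H(tw) = t^2 H(w) for real t, so with Q the exterior
   of a large square the domains {w : H^n(w) in Q} are closed under w |-> tw,
   t >= 1, and nonvanishing continuous functions that tend to 1 at infinity have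
   square roots on them, obtained by lifting along rays.  The extension of psi is
   therefore constructed through its inverse: starting from Phi = psi^-1 on Q, the
   equation f(Phi(w)) = Phi(H(w)), i.e. h(Phi(w)) = h(w) s(H(w)) with
   s(u)^2 = (Phi(u) - c) / u, enlarges the domain of Phi from level n to level
   n + 1 as long as the critical value c is not in the image of level n.  Phi stays
   odd, which gives injectivity and surjectivity.  If 0 does not escape this never
   stops; otherwise it stops at the level containing c.

   Quasiconformality is obtained from smoothness: f is so strongly expanding near
   infinity that the branches psi_k of H^-k o f^k have uniformly bounded second
   difference quotients there, hence psi is C^1 near infinity, with positive
   Jacobian; pulling back by local branches makes the extension a C^1 local
   diffeomorphism, whose weak derivatives are the classical ones.

   If 0 escapes and Psi extended psi to the whole escaping set, then
   Psi(-z) = Psi(z) or Psi(-z) = -Psi(z) everywhere; the first alternative holds at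
   0 and defines a bounded, relatively clopen subset of the escaping set, which
   contradicts the maximum principle for the open maps f^n. *)
Require Import Defs.
From mathcomp Require Import all_boot all_order all_algebra.
From mathcomp Require Import all_classical all_reals all_analysis.
From mathcomp Require Import complex.
From mathcomp Require Import ring lra.

Import Order.TTheory GRing.Theory Num.Theory.
Import numFieldNormedType.Exports.

Local Open Scope classical_set_scope.
Local Open Scope ring_scope.
Local Open Scope complex_scope.
Set Implicit Arguments.
Unset Strict Implicit.
Unset Printing Implicit Defensive.

(** * Modulus and topology of the complex plane *)

Local Notation nm := Normc.normc.

Section Modulus.
Variable R : realType.
Implicit Types z w : R[i].

(** The pulled-back domains of [f] have no visible shape, so continuing the coordinate directly
    would require their topology; on the side of [H] rays suffice, which is why the inverse is
    continued. A square is used rather than a disc because its exterior is a union of four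
    half-planes, and convexity then reduces connectedness to a few segments. Uniform convergence
    alone carries no derivative to the limit, whereas bounds on second differences do pass to
    pointwise limits; this is the reason for controlling differences of second order. For local
    quasiconformality it is then enough that continuous derivatives with positive Jacobian keep the
    dilatation away from 1 on a small disc. The threshold [r0] has two tasks. It puts U inside the
    escaping set, and it makes U so remote that orbits starting in U stay at least three times as
    large as the orbit of c. Hence, when the construction stops at the level containing c, that
    level already contains all of U. *)

Lemma normE z : `|z| = (nm z)%:C. Proof. by []. Qed.
Lemma nm_ge0 z : 0 <= nm z.
Proof. by case: z => x y; exact: sqrtr_ge0. Qed.
Lemma nmD z w : nm (z + w) <= nm z + nm w. Proof. exact: le_normcD. Qed.
Lemma nmN z : nm (- z) = nm z. Proof. exact: normcN. Qed.
Lemma nmB z w : nm (z - w) = nm (w - z). Proof. by rewrite -nmN opprB. Qed.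
Lemma nmM z w : nm (z * w) = nm z * nm w. Proof. exact: Normc.normcM. Qed.
Lemma nmV z : nm z^-1 = (nm z)^-1. Proof. exact: Normc.normcV. Qed.
Lemma nm0 : nm (0 : R[i]) = 0. Proof. exact: Normc.normc0. Qed.
Lemma nm1 : nm (1 : R[i]) = 1. Proof. exact: Normc.normc1. Qed.
Lemma nmX z n : nm (z ^+ n) = nm z ^+ n.
Proof. by elim: n => [|n IH]; rewrite ?expr0 ?nm1 // !exprS nmM IH. Qed.
Lemma nm_eq0 z : (nm z == 0) = (z == 0).
Proof. by apply/eqP/eqP => [/Normc.eq0_normc //|->]; rewrite nm0. Qed.
Lemma nm_gt0 z : (0 < nm z) = (z != 0).
Proof. by rewrite lt_neqAle nm_ge0 andbT eq_sym nm_eq0. Qed.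
Lemma nm_real (x : R) : nm x%:C = `|x|.
Proof. by rewrite /= expr0n /= addr0 sqrtr_sqr. Qed.
Lemma nm_conj z : nm z^*%C = nm z.
Proof. by case: z => x y /=; rewrite sqrrN. Qed.
Lemma conjM z w : (z * w)^*%C = z^*%C * w^*%C. Proof. exact: rmorphM. Qed.
Lemma conjD z w : (z + w)^*%C = z^*%C + w^*%C. Proof. exact: rmorphD. Qed.
Lemma conjB z w : (z - w)^*%C = z^*%C - w^*%C. Proof. exact: rmorphB. Qed.
Lemma Re_le_nm z : `|complex.Re z| <= nm z.
Proof.
case: z => x y /=; rewrite -sqrtr_sqr ler_sqrt ?addr_ge0 ?sqr_ge0 //.
by rewrite lerDl sqr_ge0.
Qed.
Lemma Im_le_nm z : `|complex.Im z| <= nm z.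
Proof.
case: z => x y /=; rewrite -sqrtr_sqr ler_sqrt ?addr_ge0 ?sqr_ge0 //.
by rewrite lerDr sqr_ge0.
Qed.
Lemma nm_le_ReIm z : nm z <= `|complex.Re z| + `|complex.Im z|.
Proof.
rewrite [in leLHS](complexE z); apply: (le_trans (nmD _ _)).
by rewrite nmM !nm_real [nm 'i]/= expr0n expr1n add0r sqrtr1 mul1r.
Qed.
Lemma nmBD z w : nm z - nm w <= nm (z + w).
Proof. by rewrite lerBlDr -[z in leLHS](addrK w) -(nmN w) nmD. Qed.
Lemma nmBB z w : nm z - nm w <= nm (z - w).
Proof. by rewrite -(nmN w) nmBD. Qed.
Lemma nm_sqr z : nm z ^+ 2 = complex.Re z ^+ 2 + complex.Im z ^+ 2.
Proof. by case: z => x y /=; rewrite sqr_sqrtr // addr_ge0 ?sqr_ge0. Qed.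

(** Balls are rewritten with the real-valued modulus, so that estimates become real inequalities
    within reach of [lra] and [nra]. *)
Lemma nbhs_nmP z (A : set R[i]) :
  nbhs z A <-> exists2 d : R, 0 < d & forall w, nm (w - z) < d -> A w.
Proof.
split=> [/nbhs_ballP[e /= e0 eA]|[d d0 dA]].
  move: e0; rewrite ltcE /= => /andP[/eqP e0i e0].
  exists (complex.Re e) => // w wz; apply: eA.
  rewrite -ball_normE /= normE nmB ltcE /= e0i eqxx; exact: wz.
apply/nbhs_ballP; exists d%:C => /=; first by rewrite ltcR.
by move=> w; rewrite -ball_normE /= normE nmB ltcR => /dA.
Qed.

Lemma open_nmP (A : set R[i]) :
  open A <-> forall z, A z -> exists2 d : R, 0 < d & forall w, nm (w - z) < d -> A w.
Proof.
rewrite openE; split=> [oA z /oA|oA z /oA] /=; last first.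
  by move=> h; exact/nbhs_nmP.
by move/nbhs_nmP.
Qed.

Definition cts_at (F : R[i] -> R[i]) z := forall e : R, 0 < e ->
  exists2 d : R, 0 < d & forall w, nm (w - z) < d -> nm (F w - F z) < e.

Lemma cts_atP F z : {for z, continuous F} <-> cts_at F z.
Proof.
split=> [cF e e0|cF A /=].
  have /cF : nbhs (F z) [set w | nm (w - F z) < e] by apply/nbhs_nmP; exists e.
  by rewrite nbhs_simpl => /nbhs_nmP.
move=> /nbhs_nmP[e e0 eA]; have [d d0 dF] := cF e e0.
by apply/nbhs_nmP; exists d => // w /dF /eA.
Qed.

Lemma within_ctsP (V : set R[i]) F : open V ->
  {within V, continuous F} <-> forall z, V z -> cts_at F z.
Proof.
move=> oV; rewrite continuous_open_subspace //; split.
  by move=> cF z Vz; apply/cts_atP; apply: cF; rewrite inE.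
by move=> cF z /[!inE] Vz; apply/cts_atP; apply: cF.
Qed.

Lemma at_inftyP (A : set R[i]) :
  at_infty R A <-> exists r : R, forall z, r < nm z -> A z.
Proof.
by split=> -[r rA]; exists r => z; move: (rA z); rewrite normE ltcR.
Qed.

Lemma cvg_inftyP (u : nat -> R[i]) :
  u @ \oo --> at_infty R <-> forall r : R, exists N, forall n, (N <= n)%N -> r < nm (u n).
Proof.
split=> [cu r|cu A /at_inftyP[r rA]].
  have : at_infty R [set z | r < nm z] by apply/at_inftyP; exists r.
  move=> /cu; rewrite /nbhs /= => -[N _ NA]; exists N => n Nn; exact: NA.
have [N hN] := cu r; exists N => // n /= Nn; apply: rA; exact: hN.
Qed.

Lemma cvg_at_inftyP (F : R[i] -> R[i]) l :
  F z @[z --> at_infty R] --> l <->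
  forall e : R, 0 < e -> exists r : R, forall z, r < nm z -> nm (F z - l) < e.
Proof.
split=> [cF e e0|cF A /nbhs_nmP[e e0 eA]].
  have /cF : nbhs l [set w | nm (w - l) < e] by apply/nbhs_nmP; exists e.
  by rewrite nbhs_simpl => /at_inftyP.
have [r rF] := cF e e0; apply/at_inftyP; exists r => z /rF /eA; done.
Qed.

(** Factor w - w0 as (z - z0)(z + z0). If z is the root on the side of z0, then |z + z0| is at least
    |z0|, because 2 z0 = (z + z0) - (z - z0). *)
Lemma root_close z w z0 w0 : z ^+ 2 = w -> z0 ^+ 2 = w0 -> z0 != 0 ->
  nm (z - z0) <= nm (z + z0) -> nm (z - z0) <= nm (w - w0) / nm z0.
Proof.
move=> <- <- z00 le; rewrite subr_sqr nmM ler_pdivlMr ?nm_gt0 //.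
apply: ler_wpM2l; first exact: nm_ge0.
have : nm (z0 + z0) <= nm (z + z0) + nm (z - z0).
  by rewrite (_ : z0 + z0 = (z + z0) - (z - z0)) ?(le_trans (nmD _ _)) ?nmN //; ring.
rewrite (_ : z0 + z0 = 2%:C * z0) ?nmM ?nm_real ?ger0_norm //; first lra.
by rewrite rmorph_nat; ring.
Qed.

Lemma exists_root_close w z0 : exists z, z ^+ 2 = w /\ nm (z - z0) <= nm (z + z0).
Proof.
have [le|/ltW le] := leP (nm (sqrtc w - z0)) (nm (sqrtc w + z0)).
  by exists (sqrtc w); rewrite sqr_sqrtc.
exists (- sqrtc w); rewrite sqrrN sqr_sqrtc; split=> //.
by rewrite -opprD nmN [X in _ <= nm X]addrC [X in _ <= X]nmB.
Qed.
End Modulus.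

(** * Integration over the plane *)

Section PlaneIntegration.
Variable R : realType.
Local Notation mu := (@lebesgue_measure R \x @lebesgue_measure R)%E.

Lemma nbhs_boxP (p : R * R) (A : set (R * R)) :
  nbhs p A <-> exists2 d : R, 0 < d &
    forall q : R * R, `|p.1 - q.1| < d -> `|p.2 - q.2| < d -> A q.
Proof.
split=> [/nbhs_ballP[d /= d0 dA]|[d d0 dA]].
  by exists d => // q h1 h2; apply: dA; split; rewrite -ball_normE.
apply/nbhs_ballP; exists d => //= q [].
by rewrite -!ball_normE /=; exact: dA.
Qed.

(** The measure lives on the product sigma-algebra, so an open set has to be exhibited as a
    countable union of rational boxes. *)
Lemma measurable_open_plane (A : set (R * R)) : open A -> measurable A.
Proof.
move=> oA.
pose box (a : (rat * rat) * (rat * rat)) : set (R * R) :=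
  `]ratr a.1.1, ratr a.1.2[%classic `*` `]ratr a.2.1, ratr a.2.2[%classic.
pose F a := if `[< box a `<=` A >] then box a else set0.
suff -> : A = \bigcup_a F a.
  apply: countable_bigcupT_measurable => [|a]; first exact: countableP.
  by rewrite /F; case: ifP => // _; apply: measurableX; exact: measurable_itv.
apply/seteqP; split=> [[x y] Axy|p [a _]]; last first.
  by rewrite /F; case: asboolP => // h /h.
have /nbhs_boxP[d d0 dA] : nbhs (x, y) A by apply: open_nbhs_nbhs.
have [a1 ha1] : exists q : rat, (ratr q : R) \in `]x - d, x[.
  by apply: rat_in_itvoo; lra.
have [a2 ha2] : exists q : rat, (ratr q : R) \in `]x, x + d[.
  by apply: rat_in_itvoo; lra.
have [b1 hb1] : exists q : rat, (ratr q : R) \in `]y - d, y[.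
  by apply: rat_in_itvoo; lra.
have [b2 hb2] : exists q : rat, (ratr q : R) \in `]y, y + d[.
  by apply: rat_in_itvoo; lra.
move: ha1 ha2 hb1 hb2; rewrite !in_itv /= => /andP[? ?] /andP[? ?] /andP[? ?] /andP[? ?].
have bA : box ((a1, a2), (b1, b2)) `<=` A.
  move=> [s t]; rewrite /box /= !in_itv /= => -[/andP[? ?] /andP[? ?]].
  by apply: dA => /=; rewrite ltr_norml; apply/andP; split; lra.
exists ((a1, a2), (b1, b2)) => //; rewrite /F asboolT //.
by rewrite /box /= !in_itv /=; split; apply/andP; split.
Qed.

Lemma open_continuous_measurable_plane (D : set (R * R)) (u : R * R -> R) :
  open D -> (forall p, D p -> {for p, continuous u}) -> measurable_fun D u.
Proof.
move=> oD cu mD; apply: (measurability _ (measurable_realfun.RGenOInfty.measurableE R)).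
move=> /= _ [_ [a ->] <-]; apply: measurable_open_plane.
rewrite openE => p [Dp /= up]; rewrite /interior; apply: filterI.
  exact: open_nbhs_nbhs.
by apply: (cu p Dp); apply: open_nbhs_nbhs; split => //; exact: interval_open.
exact: mD.
Qed.

Lemma compact_closed_plane (A : set (R * R)) : compact A -> closed A.
Proof. by apply: compact_closed; exact: norm_hausdorff. Qed.

Lemma measurable_compact_plane (A : set (R * R)) : compact A -> measurable A.
Proof.
move=> /compact_closed_plane cA; rewrite -[A]setCK; apply: measurableC.
by apply: measurable_open_plane; rewrite openC.
Qed.

Lemma compact_box (A : set (R * R)) : compact A ->
  exists2 M : R, 0 < M & forall p, A p -> `|p.1| < M /\ `|p.2| < M.
Proof.
move=> /compact_bounded[M0 [_ hM]]; exists (Num.max 1 (M0 + 1) + 1).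
  by rewrite ltr_wpDl // le_max ler01.
move=> p Ap; have := hM (Num.max 1 (M0 + 1)).
rewrite lt_max ltrDl ltr01 orbT => /(_ isT p Ap).
rewrite /= prod_normE ge_max => /andP[h1 h2]; split;
  rewrite (le_lt_trans (y := Num.max 1 (M0 + 1))) // ltrDl //.
Qed.

Lemma compact_measure_lty (A : set (R * R)) : compact A -> (mu A < +oo)%E.
Proof.
move=> cA; have [M M0 hM] := compact_box cA.
pose B : set R := `[- M, M]%classic.
have mB : measurable B by exact: measurable_itv.
have L : (lebesgue_measure B < +oo)%E.
  by rewrite /B lebesgue_measure_itv /=; case: ifP => _; rewrite -?EFinB ltry.
apply: (@le_lt_trans _ _ (mu (B `*` B))).
  apply: le_measure; rewrite ?inE; [exact: measurable_compact_plane|exact: measurableX|].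
  move=> p /hM [h1 h2]; split; rewrite /B /= in_itv /=.
    by move: h1; rewrite ltr_norml => /andP[? ?]; rewrite !ltW.
  by move: h2; rewrite ltr_norml => /andP[? ?]; rewrite !ltW.
rewrite product_measure1E //; apply: lte_mul_pinfty => //.
by rewrite ge0_fin_numE.
Qed.

Lemma compact_integrable_plane (A : set (R * R)) (u : R * R -> R) : compact A ->
  measurable_fun A u -> {within A, continuous u} -> mu.-integrable A (EFin \o u).
Proof.
move=> cA mu_ cu; apply: measurable_bounded_integrable => //.
- exact: measurable_compact_plane.
- exact: compact_measure_lty.
- have /compact_bounded[M [Mr hM]] := continuous_compact cu cA.
  by exists M; split=> // x Mx p Ap; apply: hM => //; exists p.
Qed.

Lemma L2_loc_continuous (D : set (R * R)) (u : R * R -> R) : open D ->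
  (forall p, D p -> {for p, continuous u}) -> L2_loc D u.
Proof.
move=> oD cu; split; first exact: open_continuous_measurable_plane.
move=> A cA AD; apply: integrable_lty; first exact: measurable_compact_plane.
have cu2 : forall p, D p -> {for p, continuous (fun p => u p ^+ 2)}.
  move=> p Dp; rewrite /continuous_at /=.
  by apply: (@cvg_comp _ _ _ u (fun x : R => x ^+ 2)); [exact: cu|exact: exprn_continuous].
apply: (@compact_integrable_plane A (fun p => u p ^+ 2)) => //.
  apply: (measurable_funS _ AD); first exact: measurable_open_plane.
  exact: open_continuous_measurable_plane.
apply: continuous_in_subspaceT => p /[!inE] /AD; exact: cu2.
Qed.

Lemma continuous_support_integrable (A : set (R * R)) (u : R * R -> R) : compact A ->
  continuous u -> (forall p, ~ A p -> u p = 0) -> mu.-integrable setT (EFin \o u).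
Proof.
move=> cA cu u0.
have mA := measurable_compact_plane cA.
have iA : mu.-integrable A (EFin \o u).
  apply: compact_integrable_plane => //.
    apply: (@measurable_funS _ _ _ _ setT) => //.
    exact: (open_continuous_measurable_plane (@openT (R * R)%type) (fun p _ => cu p)).
  exact: continuous_subspaceT.
have E : EFin \o u = (EFin \o u) \_ A.
  apply/funext => p; rewrite patchE; case: ifPn => //.
  by rewrite notin_setE => /u0 /= ->.
rewrite E; exact: ((@integrable_mkcond _ _ R mu A (EFin \o u) mA).1 iA).
Qed.
End PlaneIntegration.

(** * Classical derivatives are weak derivatives *)

Section WeakDerivative.
Variable R : realType.
Local Notation mu := (@lebesgue_measure R \x @lebesgue_measure R)%E.

(** The fundamental theorem on [-M, M], whose boundary terms vanish because [w] is zero already at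
    |x| = M. *)
Lemma integral_derive_support (w w' : R -> R) (M : R) : 0 < M ->
  (forall x : R, is_derive x (1 : R) w (w' x)) -> continuous w' ->
  (forall x, M <= `|x| -> w x = 0 /\ w' x = 0) ->
  (\int[@lebesgue_measure R]_x (w' x)%:E = 0)%E.
Proof.
move=> M0 dw cw' w0.
have cw : continuous w.
  by move=> x; apply: differentiable_continuous; apply/derivable1_diffP; case: (dw x).
have := @continuous_FTC2 R w' w (- M) M.
have -> : w M = 0 by apply: (w0 M _).1; rewrite ger0_norm // ltW.
have -> : w (- M) = 0 by apply: (w0 (- M) _).1; rewrite normrN ger0_norm // ltW.
rewrite sube0 => H; apply: etrans (H _ _ _ _).
- rewrite [RHS]integral_mkcond; apply: eq_integral => x _.
  rewrite patchE; case: ifPn => //; rewrite notin_setE /= in_itv /= => h.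
  rewrite (w0 x _).2 // leNgt; apply/negP => h'; apply: h.
  by move: h'; rewrite ltr_norml => /andP[? ?]; rewrite !ltW.
- lra.
- exact: continuous_subspaceT.
- split; first by move=> x _; case: (dw x).
    by apply: cvg_at_right_filter; exact: cw.
  by apply: cvg_at_left_filter; exact: cw.
- by move=> x _; rewrite derive1E; case: (dw x).
Qed.

Lemma is_derive_slice1 (F : R * R -> R) (x y l : R) :
  is_derive (x, y) (1, 0) F l -> is_derive x (1 : R) (fun t => F (t, y)) l.
Proof.
have E : (fun h : R => h^-1 *: (F (h *: (1, 0) + (x, y)) - F (x, y))) =
         (fun h : R => h^-1 *: (F (h *: (1 : R) + x, y) - F (x, y))).
  apply/funext => h; congr (_ *: (F _ - _)).
  by congr pair => /=; rewrite /= scaler0 add0r.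
case=> dF <-; constructor; first by move: dF; rewrite /derivable E.
by rewrite /derive E.
Qed.

Lemma is_derive_slice2 (F : R * R -> R) (x y l : R) :
  is_derive (x, y) (0, 1) F l -> is_derive y (1 : R) (fun t => F (x, t)) l.
Proof.
have E : (fun h : R => h^-1 *: (F (h *: (0, 1) + (x, y)) - F (x, y))) =
         (fun h : R => h^-1 *: (F (x, h *: (1 : R) + y) - F (x, y))).
  apply/funext => h; congr (_ *: (F _ - _)).
  by congr pair => /=; rewrite /= scaler0 add0r.
case=> dF <-; constructor; first by move: dF; rewrite /derivable E.
by rewrite /derive E.
Qed.

Lemma continuous_slice1 (G : R * R -> R) (y : R) :
  continuous G -> continuous (fun t : R => G (t, y)).
Proof.
move=> cG x B /(cG (x, y)) /nbhs_boxP[d d0 dB].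
apply/nbhs_ballP; exists d => // t; rewrite -ball_normE /= => xt.
by apply: dB => //=; rewrite subrr normr0.
Qed.

Lemma continuous_slice2 (G : R * R -> R) (x : R) :
  continuous G -> continuous (fun t : R => G (x, t)).
Proof.
move=> cG y B /(cG (x, y)) /nbhs_boxP[d d0 dB].
apply/nbhs_ballP; exists d => // t; rewrite -ball_normE /= => yt.
by apply: dB => //=; rewrite subrr normr0.
Qed.

(** * Integration by parts against a compactly supported test function *)

Section Test.
Variables (D A : set (R * R)) (u v phi : R * R -> R) (e : R * R).
Hypotheses (cA : compact A) (AD : A `<=` D).
Hypotheses (cu : forall p, D p -> {for p, continuous u})
  (cv : forall p, D p -> {for p, continuous v})
  (du : forall p, D p -> is_derive p e u (v p)).
Hypotheses (dphi : forall p, differentiable phi p)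
  (cphi : continuous ('D_e phi : R * R -> R)) (phi0 : forall p, ~ A p -> phi p = 0).

Lemma near_phi0 p : ~ A p -> \near p, phi p = 0.
Proof.
move=> nAp; have oA : open (~` A) by rewrite openC; exact: compact_closed_plane.
by have : nbhs p (~` A) by [apply: open_nbhs_nbhs]; apply: filterS => q /phi0.
Qed.

Lemma derive_phi0 p : ~ A p -> 'D_e phi p = 0.
Proof.
move=> /near_phi0 nphi; rewrite (near_eq_derive (g := cst 0)) //.
exact: derive_cst.
Qed.

(** On [A] this is the product rule. Off [A], where [u] may fail to be differentiable, closedness of
    [A] makes [phi] vanish on a neighbourhood, so the product is locally zero. *)
Lemma is_derive_test p : is_derive p e (u * phi) (u p * 'D_e phi p + v p * phi p).
Proof.
have [Ap|nAp] := pselect (A p).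
  have := du (AD Ap) => dup.
  have dphip : is_derive p e phi ('D_e phi p).
    by apply: DeriveDef => //; exact: diff_derivable.
  have := is_deriveM (f := u) (g := phi) dup dphip.
  by rewrite [v p * _]mulrC.
rewrite derive_phi0 // phi0 // !mulr0 addr0.
apply: (@near_eq_is_derive _ _ _ (cst 0)).
by apply: filterS (near_phi0 nAp) => q /= h; rewrite /GRing.mul /= h mulr0.
Qed.

Lemma continuous_mul_support (a b : R * R -> R) :
  (forall p, D p -> {for p, continuous a}) -> continuous b ->
  (forall p, ~ A p -> \near p, b p = 0) -> continuous (fun p => a p * b p).
Proof.
move=> ca cb b0 p; have [Ap|nAp] := pselect (A p).
  by apply: (@continuousM _ _ a b); [exact: ca (AD Ap)|exact: cb].
have n0 := b0 p nAp; rewrite /continuous_at (nbhs_singleton n0) mulr0.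
apply: (cvg_trans (near_eq_cvg (f := cst (0 : R)) _)); last exact: cvg_cst.
by apply: filterS n0 => q /= ->; rewrite mulr0.
Qed.

(** By the product rule the identity says that the derivative of [u * phi] has integral zero. That
    fact is left as a hypothesis, since each coordinate direction obtains it from Fubini in its own
    order of integration. *)
Lemma weak_derivative_of_slices :
  (forall G : R * R -> R, continuous G -> (forall p, ~ A p -> G p = 0) ->
     (forall p, is_derive p e (u * phi) (G p)) -> (\int[mu]_p (G p)%:E = 0)%E) ->
  \int[mu]_(p in D) (u p * 'D_e phi p) = - \int[mu]_(p in D) (v p * phi p).
Proof.
move=> int0.
have c1 : continuous (fun p => u p * 'D_e phi p).
  apply: continuous_mul_support => // p nAp.
  have oA : open (~` A) by rewrite openC; exact: compact_closed_plane.
  by have : nbhs p (~` A) by [apply: open_nbhs_nbhs]; apply: filterS => q /derive_phi0.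
have c2 : continuous (fun p => v p * phi p).
  apply: continuous_mul_support => //; last exact: near_phi0.
  by move=> p; exact: differentiable_continuous.
have z1 p : ~ A p -> u p * 'D_e phi p = 0 by move=> /derive_phi0 ->; rewrite mulr0.
have z2 p : ~ A p -> v p * phi p = 0 by move=> /phi0 ->; rewrite mulr0.
have i1 := continuous_support_integrable cA c1 z1.
have i2 := continuous_support_integrable cA c2 z2.
have full (g : R * R -> R) : (forall p, ~ A p -> g p = 0) ->
    \int[mu]_(p in D) g p = \int[mu]_p g p.
  move=> g0; rewrite Rintegral_mkcond; congr Rintegral; apply/funext => p.
  by rewrite patchE; case: ifPn => //; rewrite notin_setE => nD; rewrite g0 // => /AD.
rewrite !full //; apply/eqP; rewrite -subr_eq0 opprK; apply/eqP.
rewrite -(@RintegralD _ _ R mu setT) //.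
rewrite /Rintegral.
have -> : (\int[mu]_p (u p * 'D_e phi p + v p * phi p)%:E = 0)%E; last by [].
apply: (int0 _ _ _ is_derive_test).
- by move=> p; apply: (@continuousD _ _ _ _ _ p (c1 p) (c2 p)).
- by move=> p nAp; rewrite z1 // z2 // addr0.
Qed.
End Test.

Lemma weak_derivative_classical1 (D : set (R * R)) (u v : R * R -> R) :
  (forall p, D p -> {for p, continuous u}) -> (forall p, D p -> {for p, continuous v}) ->
  (forall p, D p -> is_derive p (1, 0) u (v p)) -> weak_derivative (1, 0) D u v.
Proof.
move=> cu cv du phi [dphi cphi [A [cA AD] phi0]].
apply: (weak_derivative_of_slices cA AD cu cv du) => // G cG G0 dG.
have iG := continuous_support_integrable cA cG G0.
have := @integral21_prod_meas1 _ _ _ _ R _ _ _ iG.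
move=> <-; apply: integral0_eq => y _; rewrite /fubini_G /=.
have [M M0 hM] := compact_box cA.
apply: (@integral_derive_support (fun t : R => (u * phi) (t, (y : R))) (fun t : R => G (t, (y : R))) M) => //.
- by move=> x; exact: is_derive_slice1.
- exact: continuous_slice1.
- move=> x Mx; have nA : ~ A (x, y) by move=> /hM[/= h _]; move: h; rewrite ltNge Mx.
  by rewrite G0 // {1}/GRing.mul /= phi0 // mulr0.
Qed.

Lemma weak_derivative_classical2 (D : set (R * R)) (u v : R * R -> R) :
  (forall p, D p -> {for p, continuous u}) -> (forall p, D p -> {for p, continuous v}) ->
  (forall p, D p -> is_derive p (0, 1) u (v p)) -> weak_derivative (0, 1) D u v.
Proof.
move=> cu cv du phi [dphi cphi [A [cA AD] phi0]].
apply: (weak_derivative_of_slices cA AD cu cv du) => // G cG G0 dG.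
have iG := continuous_support_integrable cA cG G0.
have := @integral12_prod_meas1 _ _ _ _ R _ _ _ iG.
move=> <-; apply: integral0_eq => x _; rewrite /fubini_F /=.
have [M M0 hM] := compact_box cA.
apply: (@integral_derive_support (fun t : R => (u * phi) ((x : R), t)) (fun t : R => G ((x : R), t)) M) => //.
- by move=> y; exact: is_derive_slice2.
- exact: continuous_slice2.
- move=> y My; have nA : ~ A (x, y) by move=> /hM[/= _ h]; move: h; rewrite ltNge My.
  by rewrite G0 // {1}/GRing.mul /= phi0 // mulr0.
Qed.
End WeakDerivative.

(** * Strict real differentiability *)

Section StrictDerivative.
Variable R : realType.
Implicit Types (F : R[i] -> R[i]) (z w a b : R[i]).

(* Strict differentiability, with a = F_z and b = F_zbar: at every point of an open
   set it amounts to C^1 there, but it is a condition at a single point, stable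
   under composition and under extraction of continuous roots. *)
Definition strictD F z0 a b := forall e : R, 0 < e -> exists2 d : R, 0 < d &
  forall z w, nm (z - z0) < d -> nm (w - z0) < d ->
    nm (F z - F w - (a * (z - w) + b * (z - w)^*%C)) <= e * nm (z - w).

(** The inequality says that the Jacobian |F_z|^2 - |F_zbar|^2 is positive. *)
Definition orient_diff F z := exists a b, nm b < nm a /\ strictD F z a b.

Lemma strictD_cts F z a b : strictD F z a b -> cts_at F z.
Proof.
move=> /(_ 1 ltr01) [d d0 dF] e e0.
pose N := 1 + nm a + nm b.
have N0 : 0 < N by rewrite /N -addrA ltr_pwDl // addr_ge0 ?nm_ge0.
exists (Num.min d (e / N)); first by rewrite lt_min d0 divr_gt0.
move=> w; rewrite lt_min => /andP[wd we].
have := dF w z wd; rewrite subrr nm0 => /(_ d0); rewrite mul1r => h.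
rewrite ltr_pdivlMr // in we.
have := nmD (F w - F z - (a * (w - z) + b * (w - z)^*%C)) (a * (w - z) + b * (w - z)^*%C).
rewrite subrK; have := nmD (a * (w - z)) (b * (w - z)^*%C).
by rewrite !nmM nm_conj /N in we *; nra.
Qed.

(** Both expansions hold for small increments at z. Subtracting them on a vector of length t and
    dividing by t bounds the difference of the two differentials on unit vectors; the vectors 1 and
    i then control a - a0 and b - b0 separately. This makes coefficients chosen point by point
    continuous. *)
Lemma strictD_near F z0 a0 b0 : strictD F z0 a0 b0 -> forall e : R, 0 < e ->
  exists2 d : R, 0 < d & forall z a b, nm (z - z0) < d -> strictD F z a b ->
    nm (a - a0) < e /\ nm (b - b0) < e.
Proof.
move=> dF e e0; have e40 : 0 < e / 4 by lra.
have [d d0 {}dF] := dF _ e40; exists (d / 2); first lra.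
move=> z a b zd /(_ _ e40) [d' d'0 dF'].
pose t := Num.min (d' / 2) (d / 2).
have t0 : 0 < t by rewrite lt_min; apply/andP; split; lra.
have td : t <= d / 2 by rewrite ge_min lexx orbT.
have td' : t <= d' / 2 by rewrite ge_min lexx.
have L u : nm u = 1 -> nm ((a - a0) * u + (b - b0) * u^*%C) <= e / 2.
  move=> u1; pose v := t%:C * u.
  have nv : nm v = t by rewrite nmM nm_real u1 mulr1 ger0_norm // ltW.
  have := dF (z + v) z; have := dF' (z + v) z.
  rewrite subrr nm0 (_ : z + v - z = v) ?nv; last by ring.
  move=> /(_ _ d'0) h1 /(_ _ _) h2.
  have {}h1 := h1 ltac:(lra).
  have {}h2 : nm (F (z + v) - F z - (a0 * v + b0 * v^*%C)) <= e / 4 * t.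
    apply: h2; last lra.
    rewrite (_ : z + v - z0 = (z - z0) + v); last by ring.
    by apply: (le_lt_trans (nmD _ _)); rewrite nv; lra.
  have : nm (t%:C * ((a - a0) * u + (b - b0) * u^*%C)) <= e / 2 * t.
    rewrite (_ : t%:C * _ = (F (z + v) - F z - (a0 * v + b0 * v^*%C)) -
        (F (z + v) - F z - (a * v + b * v^*%C))); last first.
      by rewrite /v conjM conjc_real; ring.
    by apply: (le_trans (nmD _ _)); rewrite nmN; lra.
  by rewrite nmM nm_real ger0_norm ?(ltW t0) // mulrC ler_pM2r.
have L1 := L 1 (nm1 _); have ni : nm ('i : R[i]) = 1.
  by rewrite /= expr0n expr1n add0r sqrtr1.
have Li := L 'i ni.
rewrite conjc1 !mulr1 in L1.
have {}Li : nm ((a - a0) - (b - b0)) <= e / 2.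
  rewrite (_ : (a - a0) * 'i + (b - b0) * ('i)^*%C = 'i * ((a - a0) - (b - b0))) in Li.
    by rewrite nmM ni mul1r in Li.
  have -> : ('i)^*%C = - 'i :> R[i] by rewrite /= ; apply/eqP; rewrite eq_complex /= oppr0 !eqxx.
  by ring.
have n2 : nm (2 : R[i]) = 2 by rewrite -(rmorph_nat (real_complex R)) nm_real ger0_norm.
have l1 : nm (2 * (a - a0)) <= e.
  rewrite (_ : 2 * (a - a0) = (a - a0 + (b - b0)) + (a - a0 - (b - b0))); last by ring.
  by apply: (le_trans (nmD _ _)); lra.
have l2 : nm (2 * (b - b0)) <= e.
  rewrite (_ : 2 * (b - b0) = (a - a0 + (b - b0)) - (a - a0 - (b - b0))); last by ring.
  by apply: (le_trans (nmD _ _)); rewrite nmN; lra.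
by rewrite nmM n2 in l1; rewrite nmM n2 in l2; split; lra.
Qed.

(** [part] stands for the real or the imaginary part, so that both are treated at once. *)
Lemma is_derive_strictD F z0 a b (part : R[i] -> R) (e : R * R) :
  {morph part : x y / x - y} -> (forall h z, part (h%:C * z) = h * part z) ->
  (forall z, `|part z| <= nm z) -> nm (cplx e) = 1 -> strictD F z0 a b ->
  forall p, cplx p = z0 ->
  is_derive p e (fun p => part (F (cplx p))) (part (a * cplx e + b * (cplx e)^*%C)).
Proof.
move=> partB partZ part_le e1 dF p pz0.
set l := part _.
suff H : (fun h : R => h^-1 *: (part (F (cplx (h *: e + p))) - part (F (cplx p))))
    @ (0 : R)^' --> l.
  by constructor; [apply/cvg_ex; exists l|apply/cvg_lim].
apply/cvgrPdist_le => /= eps eps0; have [d d0 dFd] := dF _ eps0.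
near=> h.
have h0 : h != 0 by near: h; exact: nbhs_dnbhs_neq.
have cE : cplx (h *: e + p) = z0 + h%:C * cplx e.
  rewrite -pz0 /cplx; apply/eqP; rewrite eq_complex /=; apply/andP; split;
    apply/eqP => /=; rewrite -?[_ *: _]/(_ * _) mul0r ?subr0 ?addr0; exact: addrC.
have nhe : nm (h%:C * cplx e) = `|h| by rewrite nmM nm_real e1 mulr1.
have hd : nm (z0 + h%:C * cplx e - z0) < d.
  rewrite (_ : _ - z0 = h%:C * cplx e) ?nhe; last by ring.
  near: h; apply: dnbhs0_lt; exact: d0.
have := dFd _ z0 hd; rewrite subrr nm0 => /(_ d0).
rewrite (_ : z0 + _ - z0 = h%:C * cplx e) ?nhe; last by ring.
move=> H; rewrite cE pz0.
have -> : l - h^-1 *: (part (F (z0 + h%:C * cplx e)) - part (F z0)) =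
   - (h^-1 * part (F (z0 + h%:C * cplx e) - F z0 - (a * (h%:C * cplx e) + b * (h%:C * cplx e)^*%C))).
  rewrite !partB (_ : a * _ + b * _ = h%:C * (a * cplx e + b * (cplx e)^*%C)); last first.
    by rewrite conjM conjc_real; ring.
  by rewrite partZ -/l -[_ *: _]/(_ * _); field.
rewrite normrN normrM normfV ler_pdivrMl ?normr_gt0 // [X in _ <= X]mulrC.
exact: le_trans (part_le _) H.
Unshelve. all: by end_near. Qed.

Lemma continuous_part (part : R[i] -> R) F p : {morph part : x y / x - y} ->
  (forall z, `|part z| <= nm z) -> cts_at F (cplx p) ->
  {for p, continuous (fun p => part (F (cplx p)))}.
Proof.
move=> partB part_le cF; apply/cvgrPdist_lt => e e0; have [d d0 dF] := cF e e0.
apply/nbhs_boxP; exists (d / 2) => [|q h1 h2]; first lra.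
rewrite -partB; apply: (le_lt_trans (part_le _)); rewrite nmB; apply: dF.
apply: (le_lt_trans (nm_le_ReIm _)); rewrite /cplx /= distrC.
by rewrite [X in _ + X]distrC; lra.
Qed.
End StrictDerivative.

(** * Smooth homeomorphisms with positive Jacobian are locally quasiconformal *)

Section LocallyQuasiconformal.
Variable R : realType.
Implicit Types (F : R[i] -> R[i]) (z w : R[i]).

Lemma cts_at_cst (k : R[i]) z : cts_at (fun=> k) z.
Proof. by move=> e e0; exists 1 => // w _; rewrite subrr nm0. Qed.

Lemma cts_atD F G z : cts_at F z -> cts_at G z -> cts_at (fun w => F w + G w) z.
Proof.
move=> cF cG e e0; have e2 : 0 < e / 2 by lra.
have [d d0 dF] := cF _ e2; have [d' d'0 dG] := cG _ e2.
exists (Num.min d d'); first by rewrite lt_min d0.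
move=> w; rewrite lt_min => /andP[/dF h1 /dG h2].
rewrite (_ : _ - _ = (F w - F z) + (G w - G z)); last by ring.
by apply: (le_lt_trans (nmD _ _)); lra.
Qed.

Lemma cts_atM F G z : cts_at F z -> cts_at G z -> cts_at (fun w => F w * G w) z.
Proof.
move=> cF cG e e0.
pose N := 1 + nm (F z) + nm (G z).
have NF := nm_ge0 (F z); have NG := nm_ge0 (G z).
have N1 : 1 <= N by rewrite /N; lra.
have eN : 0 < Num.min 1 (e / (2 * N)) by rewrite lt_min ltr01 divr_gt0 //; lra.
have [d d0 dF] := cF _ eN; have [d' d'0 dG] := cG _ eN.
exists (Num.min d d'); first by rewrite lt_min d0.
move=> w; rewrite lt_min => /andP[/dF h1 /dG h2].
move: h1 h2; rewrite !lt_min !ltr_pdivlMr; [|lra|lra] => /andP[h1 h1'] /andP[h2 h2'].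
rewrite (_ : _ - _ = (F w - F z) * (G w - G z) + F z * (G w - G z) + (F w - F z) * G z); last by ring.
apply: (le_lt_trans (nmD _ _)); apply: (le_lt_trans (lerD (nmD _ _) (lexx _))).
rewrite !nmM; have := nm_ge0 (F w - F z); have := nm_ge0 (G w - G z).
by move: h1 h2 h1' h2' N1; rewrite /N; nra.
Qed.

Lemma cts_at_comp F G z : cts_at F z -> cts_at G (F z) -> cts_at (fun w => G (F w)) z.
Proof.
move=> cF cG e /cG[d d0 dG]; have [d' d'0 dF] := cF d d0.
by exists d' => // w /dF /dG.
Qed.

Lemma cts_at_id z : cts_at id z.
Proof. by move=> e e0; exists e. Qed.

Lemma cts_at_near F G z (d : R) : 0 < d -> (forall w, nm (w - z) < d -> F w = G w) ->
  cts_at F z -> cts_at G z.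
Proof.
move=> d0 FG cF e /cF[d' d'0 dF]; exists (Num.min d d'); first by rewrite lt_min d0.
by move=> w; rewrite lt_min => /andP[h1 /dF]; rewrite !FG // subrr nm0.
Qed.

(** With a = F_z and b = F_zbar, the partial derivatives are F_x = a + b and F_y = i (a - b); being
    continuous, they are locally square integrable. *)
Lemma W12_loc_part (part : R[i] -> R) (V : set R[i]) F a b :
  {morph part : x y / x - y} -> (forall (h : R) z, part (h%:C * z) = h * part z) ->
  (forall z, `|part z| <= nm z) -> open V ->
  (forall z, V z -> strictD F z (a z) (b z)) ->
  (forall z, V z -> cts_at a z) -> (forall z, V z -> cts_at b z) ->
  W12_loc (@cplx R @^-1` V) (fun p => part (F (cplx p)))
    (fun p => part (a (cplx p) + b (cplx p)))
    (fun p => part ('i * (a (cplx p) - b (cplx p)))).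
Proof.
move=> partB partZ part_le oV dF ca cb.
have oD : open (@cplx R @^-1` V).
  rewrite openE => p Vp; have [d d0 dV] := (open_nmP V).1 oV _ Vp.
  apply/nbhs_boxP; exists (d / 2) => [|q h1 h2]; first lra.
  apply: dV; apply: (le_lt_trans (nm_le_ReIm _)); rewrite /cplx /= distrC.
  by rewrite [X in _ + X]distrC; lra.
have cF z : V z -> cts_at F z by move=> /dF; exact: strictD_cts.
have cx z : V z -> cts_at (fun z => a z + b z) z by move=> Vz; apply: cts_atD; [exact: ca|exact: cb].
have cy z : V z -> cts_at (fun z => 'i * (a z - b z)) z.
  move=> Vz; apply: cts_atM; first exact: cts_at_cst.
  apply: (@cts_at_near (fun w => a w + (-1) * b w) _ _ 1) => //; first by move=> w _; ring.
  by apply: cts_atD; [exact: ca|apply: cts_atM; [exact: cts_at_cst|exact: cb]].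
have c1 p : V (cplx p) -> {for p, continuous (fun p => part (F (cplx p)))}.
  by move=> Vp; apply: (@continuous_part _ part F) => //; exact: cF.
have c2 p : V (cplx p) -> {for p, continuous (fun p => part (a (cplx p) + b (cplx p)))}.
  by move=> Vp; apply: (@continuous_part _ part (fun z => a z + b z)) => //; exact: cx.
have c3 p : V (cplx p) -> {for p, continuous (fun p => part ('i * (a (cplx p) - b (cplx p))))}.
  by move=> Vp; apply: (@continuous_part _ part (fun z => 'i * (a z - b z))) => //; exact: cy.
split; [exact: L2_loc_continuous|exact: L2_loc_continuous|exact: L2_loc_continuous| |].
- apply: weak_derivative_classical1 => // p Vp.
  have e1 : nm (cplx ((1, 0) : R * R)) = 1 by rewrite /= expr0n expr1n addr0 sqrtr1.
  have := is_derive_strictD partB partZ part_le e1 (dF _ Vp) (erefl (cplx p)).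
  rewrite (_ : cplx (1, 0) = 1 :> R[i]) // conjc1 !mulr1; exact.
- apply: weak_derivative_classical2 => // p Vp.
  have e1 : nm (cplx ((0, 1) : R * R)) = 1 by rewrite /= expr0n expr1n add0r sqrtr1.
  have := is_derive_strictD partB partZ part_le e1 (dF _ Vp) (erefl (cplx p)).
  rewrite (_ : (cplx (0, 1))^*%C = - 'i :> R[i]); last by rewrite /cplx /= -[RHS]/(- 0 -i* 1) oppr0.
  rewrite -[cplx (0, 1)]/('i : R[i]).
  by rewrite (_ : a _ * 'i + _ = 'i * (a (cplx p) - b (cplx p))) //; ring.
Qed.

Lemma locally_quasiconformal_of_diff (V : set R[i]) F : open V ->
  homeo_onto_image V F -> (forall z, V z -> orient_diff F z) ->
  locally_quasiconformal V F.
Proof.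
move=> oV [injF cF openF] dF z0 Vz0.
have /choice[ab abP] : forall z, exists ab : R[i] * R[i],
    V z -> nm ab.2 < nm ab.1 /\ strictD F z ab.1 ab.2.
  move=> z; have [/dF[a [b abP]]|nV] := pselect (V z); first by exists (a, b).
  by exists (0, 0).
pose a z := (ab z).1; pose b z := (ab z).2.
have dab z : V z -> strictD F z (a z) (b z) by move=> /abP[].
have [dV dV0 dVP] := (open_nmP V).1 oV _ Vz0.
have cab z : V z -> cts_at a z /\ cts_at b z.
  move=> Vz; have [d d0 dVz] := (open_nmP V).1 oV _ Vz.
  split=> e e0; have [d' d'0 H] := strictD_near (dab z Vz) e0;
    exists (Num.min d d'); rewrite ?lt_min ?d0 // => w; rewrite lt_min => /andP[/dVz/dab wd w'];
    by have [] := H w _ _ w' wd.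
have lt0 : nm (b z0) < nm (a z0) by have [] := abP _ Vz0.
have a0 : 0 < nm (a z0) by apply: le_lt_trans lt0; exact: nm_ge0.
(* The midpoint between the dilatation at z0 and 1. *)
pose k := (nm (b z0) / nm (a z0) + 1) / 2.
have k1 : nm (b z0) / nm (a z0) < 1 by rewrite ltr_pdivrMr // mul1r.
have k0 : 0 <= nm (b z0) / nm (a z0) by rewrite divr_ge0 ?nm_ge0.
have bE : nm (b z0) = nm (b z0) / nm (a z0) * nm (a z0) by rewrite divfK // gt_eqF.
(* Changing |a| and |b| by at most a quarter of their gap at z0 keeps |b| <= k |a|. *)
pose eps := (nm (a z0) - nm (b z0)) / 4.
have eps0 : 0 < eps by rewrite /eps; lra.
have [ca cb] := cab _ Vz0; have [d1 d10 H1] := ca _ eps0; have [d2 d20 H2] := cb _ eps0.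
pose d := Num.min dV (Num.min d1 d2).
have d0 : 0 < d by rewrite !lt_min dV0 d10.
pose W : set R[i] := [set z | nm (z - z0) < d].
have WV : W `<=` V by move=> z; rewrite /W /= !lt_min => /and3P[/dVP].
have oW : open W.
  apply/open_nmP => z Wz; exists (d - nm (z - z0)); first by rewrite subr_gt0.
  move=> w wz; rewrite /W /= (_ : w - z0 = (w - z) + (z - z0)); last by ring.
  by apply: (le_lt_trans (nmD _ _)); lra.
exists W; split=> //; first by rewrite /W /= subrr nm0.
split=> //.
  split.
  - by move=> x y /[!inE] /WV Vx /WV Vy; apply: injF; rewrite inE.
  - exact: continuous_subspaceW cF.
  - by move=> W' oW' W'W; apply: openF => // x /W'W /WV.
exists (fun z => a z + b z), (fun z => 'i * (a z - b z)); split.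
  split; apply: W12_loc_part => //; try by move=> z /WV /dab.
  - by move=> x y; rewrite raddfB.
  - by move=> h [x y] /=; rewrite mul0r subr0.
  - exact: Re_le_nm.
  - by move=> z /WV /cab[].
  - by move=> z /WV /cab[].
  - by move=> x y; rewrite raddfB.
  - by move=> h [x y] /=; rewrite mul0r addr0.
  - exact: Im_le_nm.
  - by move=> z /WV /cab[].
  - by move=> z /WV /cab[].
exists k; first by rewrite /k; apply/andP; split; lra.
apply: aeW => p Wp; set z := cplx p in Wp *.
have -> : d_zbar (fun z => a z + b z) (fun z => 'i * (a z - b z)) z = b z.
  by rewrite /d_zbar mulrA -expr2 sqr_i; field.
have -> : d_z (fun z => a z + b z) (fun z => 'i * (a z - b z)) z = a z.
  by rewrite /d_z mulrA -expr2 sqr_i; field.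
rewrite !normE -rmorphM /= lecR.
move: Wp; rewrite /W /= !lt_min => /and3P[_ /H1 h1 /H2 h2].
have l1 : nm (b z) <= nm (b z0) + eps.
  by have := nmD (b z0) (b z - b z0); rewrite addrC subrK; lra.
have l2 : nm (a z0) - eps <= nm (a z).
  by have := nmBD (a z0) (a z - a z0); rewrite [X in _ <= nm X]addrC subrK; lra.
have kk : 0 <= k by rewrite /k; lra.
apply: (le_trans l1); apply: (le_trans _ (ler_wpM2l kk l2)).
rewrite /k /eps; nra.
Qed.
End LocallyQuasiconformal.

(** * Square roots along rays *)

Section Rays.
Variable R : realType.
Implicit Types (A B : set R[i]) (u v w p q : R[i]) (a b s phi : R[i] -> R[i]).

Lemma nmZ (t : R) u : 0 <= t -> nm (t%:C * u) = t * nm u.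
Proof. by move=> t0; rewrite nmM nm_real ger0_norm. Qed.

Lemma cts_at_conj z : cts_at (fun w : R[i] => w^*%C) z.
Proof. by move=> e e0; exists e => // w; rewrite -conjB nm_conj. Qed.

Lemma sqr_eq_sign u v : u ^+ 2 = v ^+ 2 -> u = v \/ u = - v.
Proof. by move=> /eqP; rewrite eqf_sqr => /orP[] /eqP; [left|right]. Qed.

(** The real part of a times the conjugate of b is |b|^2 or -|b|^2 along the segment, hence never
    zero; a change of sign between p and q would contradict the intermediate value theorem. *)
Lemma sign_segment a b p q :
  (forall t : R, 0 <= t <= 1 -> let z := p + t%:C * (q - p) in
     [/\ cts_at a z, cts_at b z, b z != 0 & a z ^+ 2 = b z ^+ 2]) ->
  a p = b p -> a q = b q.
Proof.
move=> H apbp; pose gam (t : R) := p + t%:C * (q - p).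
pose g (t : R) := complex.Re (a (gam t) * (b (gam t))^*%C).
have nneg (z : R[i]) : complex.Re (z * z^*%C) = nm z ^+ 2 by rewrite nm_sqr; case: z => x y /=; ring.
have cg : {within `[0, 1], continuous g}.
  apply: continuous_in_subspaceT => t; rewrite inE /= in_itv /= => t01.
  have [ca cb _ _] := H t t01; apply/cvgrPdist_lt => e e0.
  have cab : cts_at (fun z => a z * (b z)^*%C) (gam t).
    by apply: cts_atM => //; apply: cts_at_comp => //; exact: cts_at_conj.
  have [d d0 dF] := cab e e0.
  have N0 := nm_ge0 (q - p).
  have dN : 0 < d / (1 + nm (q - p)) by rewrite divr_gt0 //; lra.
  apply/nbhs_ballP; exists (d / (1 + nm (q - p))) => //= x xt; rewrite /ball_ /= in xt.
  rewrite /g distrC -raddfB; apply: (le_lt_trans (Re_le_nm _)); apply: dF.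
  rewrite (_ : gam x - gam t = (x - t)%:C * (q - p)); last by rewrite /gam rmorphB /=; ring.
  rewrite nmM nm_real distrC.
  by move: xt; rewrite ltr_pdivlMr; [have := normr_ge0 (t - x); nra|lra].
have g0 : gam 0 = p by rewrite /gam mul0r addr0.
have g1 : gam 1 = q by rewrite /gam mul1r addrC subrK.
have I0 : 0 <= (0 : R) <= 1 by rewrite lexx ler01.
have I1 : 0 <= (1 : R) <= 1 by rewrite lexx ler01.
have [_ _ bp _] := H 0 I0; have [_ _ bq sq] := H 1 I1.
rewrite -/(gam 0) g0 in bp; rewrite -/(gam 1) g1 in bq sq.
have [//|aq] := sqr_eq_sign sq; exfalso.
have [||t tI gt0] := @IVT _ g 0 1 0 _ cg; first exact: ler01.
  rewrite /g g0 g1 apbp aq mulNr raddfN /= !nneg.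
  have := nm_ge0 (b p); have := nm_ge0 (b q).
  by move=> _ _; apply/andP; split; rewrite ?ge_min ?le_max; apply/orP;
    [right|left]; rewrite ?oppr_le0 sqr_ge0.
have [_ _ bt st] := H t tI; rewrite -/(gam t) in bt st.
have : nm (b (gam t)) ^+ 2 = 0.
  move: gt0; rewrite /g; have [->|->] := sqr_eq_sign st; rewrite ?mulNr ?raddfN /= nneg //.
  by move=> /eqP; rewrite oppr_eq0 => /eqP.
by move=> /eqP; rewrite expf_eq0 /= nm_eq0 (negbTE bt).
Qed.

Definition ray_closed A := forall u (t : R), A u -> 1 <= t -> A (t%:C * u).

Lemma ray_eq A a b : ray_closed A ->
  (forall u, A u -> [/\ cts_at a u, cts_at b u, b u != 0 & a u ^+ 2 = b u ^+ 2]) ->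
  (forall u, A u -> exists2 t : R, 1 <= t & a (t%:C * u) = b (t%:C * u)) ->
  forall u, A u -> a u = b u.
Proof.
move=> rA H far u Au; have [t t1 E] := far u Au.
apply: (sign_segment _ E) => s /andP[s0 s1] /=.
rewrite (_ : _ + _ = (t + s * (1 - t))%:C * u); last first.
  by rewrite !rmorphD rmorphM rmorphB /=; ring.
by apply: H; apply: rA => //; nra.
Qed.

Lemma Re_root_eq u v : u ^+ 2 = v ^+ 2 -> 0 < complex.Re u -> 0 < complex.Re v -> u = v.
Proof. by move=> /sqr_eq_sign[//|->]; rewrite raddfN oppr_gt0 => h1 /(lt_trans h1); rewrite ltxx. Qed.

(** A purely imaginary u has u^2 real and at most 0, so at distance at least 1 from 1. *)
Lemma Re_root_gt0 u : nm (u ^+ 2 - 1) < 1 -> complex.Re u != 0.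
Proof.
case: u => x y; apply: contraL => /eqP x0; rewrite -leNgt (x0 : x = 0).
rewrite (_ : _ - _ = (- (1 + y ^+ 2))%:C); last first.
  by apply/eqP; rewrite eq_complex /=; apply/andP; split; apply/eqP; ring.
by rewrite nm_real normrN ger0_norm ?lerDl ?sqr_ge0 // addr_ge0 ?sqr_ge0.
Qed.

(** Choosing at every point the root on the side of one fixed root r0 gives a continuous branch
    while [phi] varies by less than a quarter of its modulus: the chosen roots stay within |r0| / 4
    of r0, too close to one another for a change of sign. *)
Lemma cts_root_local s phi r0 p (d : R) : r0 != 0 -> phi p = r0 ^+ 2 ->
  (forall v, nm (v - p) < d -> [/\ cts_at phi v, nm (phi v - phi p) < nm (phi p) / 4,
     s v ^+ 2 = phi v & nm (s v - r0) <= nm (s v + r0)]) ->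
  forall v, nm (v - p) < d -> nm (s v - r0) < nm r0 / 4 /\ cts_at s v.
Proof.
move=> r0n phip H.
have nr : 0 < nm r0 by rewrite nm_gt0.
have close v : nm (v - p) < d -> nm (s v - r0) < nm r0 / 4.
  move=> /H[_ h2 h3 h4].
  have := root_close h3 (esym phip) r0n h4; rewrite ler_pdivlMr // => h.
  have E : nm (phi p) = nm r0 ^+ 2 by rewrite phip nmX.
  by rewrite E in h2; nra.
have dbl (z : R[i]) : nm (z + z) = 2 * nm z.
  by rewrite (_ : z + z = 2%:C * z) ?nmZ //; rewrite rmorph_nat; ring.
have big v w : nm (v - p) < d -> nm (w - p) < d ->
    nm (s v - s w) <= nm (s v + s w) /\ nm r0 / 2 <= nm (s v).
  move=> /close hv /close hw.
  have h1 := nmD (s v - r0) (- (s w - r0)); rewrite nmN in h1.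
  have h2 := nmD (- (s v - r0)) (- (s w - r0)); rewrite !nmN in h2.
  have h3 := nmBD (r0 + r0) ((s v - r0) + (s w - r0)).
  have h4 := nmD (s v - r0) (s w - r0).
  have h5 := nmBD r0 (s v - r0).
  rewrite dbl (_ : r0 + r0 + _ = s v + s w) in h3; last by ring.
  rewrite (_ : s v - r0 - (s w - r0) = s v - s w) in h1; last by ring.
  rewrite (_ : r0 + _ = s v) in h5; last by ring.
  by split; lra.
move=> v vd; split; first exact: close.
move=> e e0; have [cphi _ sv _] := H v vd.
have e' : 0 < e * (nm r0 / 2) by rewrite mulr_gt0 // divr_gt0.
have [d' d'0 dphi] := cphi _ e'.
exists (Num.min d' (d - nm (v - p))); first by rewrite lt_min d'0 subr_gt0.
move=> w; rewrite lt_min => /andP[wd' wd].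
have wp : nm (w - p) < d.
  by rewrite (_ : w - p = (w - v) + (v - p)); [apply: (le_lt_trans (nmD _ _)); lra|ring].
have [b1 _] := big w v wp vd; have [_ b2] := big v w vd wp.
have sv0 : s v != 0 by rewrite -nm_gt0; lra.
have [_ _ sw _] := H w wp.
have := root_close sw sv sv0 b1; rewrite ler_pdivlMr ?nm_gt0 // => h.
have := dphi w wd'; have := nm_ge0 (s w - s v); nra.
Qed.
End Rays.

(** * Continuation of a square root inward along rays *)

Section RaySqrt.
Variable R : realType.
Implicit Types (A B : set R[i]) (u v w p q : R[i]) (a b s phi : R[i] -> R[i]).

Section Lift.
Variables (A : set R[i]) (phi : R[i] -> R[i]) (M : R).
Hypotheses (oA : open A) (rA : ray_closed A) (A0 : ~ A 0).
Hypotheses (cphi : forall u, A u -> cts_at phi u) (phi0 : forall u, A u -> phi u != 0)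
  (phi_far : forall u, A u -> M < nm u -> nm (phi u - 1) < 1).

(* The last clause fixes the sign of the square root on each ray. *)
Definition ray_root B s := [/\ open B, ray_closed B, B `<=` A,
  forall u, B u -> cts_at s u /\ s u ^+ 2 = phi u &
  forall u, B u -> exists2 T : R, 1 <= T &
    forall t, T <= t -> 0 < complex.Re (s (t%:C * u))].

Definition liftable u := exists B s, ray_root B s /\ B u.

Lemma ray_root_uniq B s B' s' u : ray_root B s -> ray_root B' s' -> B u -> B' u ->
  s u = s' u.
Proof.
move=> [oB rB BA sB fB] [oB' rB' B'A sB' fB'] Bu B'u.
apply: (@ray_eq _ (B `&` B') s s') => //.
- by move=> v t [Bv B'v] t1; split; [exact: rB|exact: rB'].
- move=> v [Bv B'v]; have [c1 e1] := sB v Bv; have [c2 e2] := sB' v B'v.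
  split=> //; last by rewrite e1 e2.
  by rewrite -sqrf_eq0 e2; apply: phi0; exact: BA.
- move=> v [Bv B'v]; have [T T1 hT] := fB v Bv; have [T' T'1 hT'] := fB' v B'v.
  have m1 : 1 <= Num.max T T' by rewrite le_max T1.
  exists (Num.max T T') => //; apply: Re_root_eq.
  + by rewrite (sB _ (rB _ _ Bv m1)).2 (sB' _ (rB' _ _ B'v m1)).2.
  + by apply: hT; rewrite le_max lexx.
  + by apply: hT'; rewrite le_max lexx orbT.
Qed.

Lemma liftable_far u : A u -> M < nm u -> liftable u.
Proof.
move=> Au Mu.
pose B := A `&` [set v : R[i] | M < nm v].
pose s v := if 0 <= complex.Re (sqrtc (phi v)) then sqrtc (phi v) else - sqrtc (phi v).
have s2 v : s v ^+ 2 = phi v by rewrite /s; case: ifP; rewrite ?sqrrN sqr_sqrtc.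
have sge v : 0 <= complex.Re (s v).
  by rewrite /s; case: ifPn => //; rewrite -ltNge raddfN oppr_ge0 => /ltW.
have sgt v : B v -> 0 < complex.Re (s v).
  by move=> [Av Mv]; rewrite lt_neqAle sge andbT eq_sym Re_root_gt0 // s2 phi_far.
have oB : open B.
  apply/open_nmP => v [Av Mv]; have [d d0 dA] := (open_nmP A).1 oA _ Av.
  exists (Num.min d (nm v - M)); first by rewrite lt_min d0 subr_gt0.
  move=> w; rewrite lt_min => /andP[/dA Aw wv]; split=> //.
  have h := nmBB v (v - w); rewrite (_ : v - (v - w) = w) in h; last by ring.
  by rewrite nmB in wv; rewrite /=; lra.
have rB : ray_closed B.
  move=> v t [Av Mv] t1; split; first exact: rA.
  by rewrite /= in Mv *; rewrite nmZ; [have := nm_ge0 v; nra|lra].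
exists B, s; split=> //; split=> //.
- by move=> v [].
- move=> v Bv; split=> // e e0; have Av := Bv.1.
  have sv0 : s v != 0 by apply/eqP => h; have := sgt v Bv; rewrite h ltxx.
  have nsv : 0 < nm (s v) by rewrite nm_gt0.
  (* The bound Re (s v) rules out the wrong sign: if s w were that close to - s v, then Re (s w + s
     v) would be smaller than Re (s v), although Re (s w) >= 0. *)
  have k0 : 0 < Num.min e (complex.Re (s v)) * nm (s v).
    by rewrite mulr_gt0 // lt_min e0 sgt.
  have [d d0 dphi] := cphi Av k0.
  exists d => // w /dphi h.
  have [le|/ltW le] := leP (nm (s w - s v)) (nm (s w + s v)).
    have := root_close (s2 w) (s2 v) sv0 le; rewrite ler_pdivlMr // => h'.
    have : nm (s w - s v) * nm (s v) < Num.min e (complex.Re (s v)) * nm (s v) by lra.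
    by rewrite ltr_pM2r // lt_min => /andP[].
  have sw2 : (- s w) ^+ 2 = phi w by rewrite sqrrN s2.
  have le' : nm (- s w - s v) <= nm (- s w + s v).
    by rewrite -opprD nmN [X in _ <= nm X]addrC [X in _ <= X]nmB.
  have := root_close sw2 (s2 v) sv0 le'; rewrite ler_pdivlMr // => h'.
  have : nm (- s w - s v) * nm (s v) < Num.min e (complex.Re (s v)) * nm (s v) by lra.
  rewrite ltr_pM2r // lt_min => /andP[_]; rewrite -opprD nmN => h''.
  have := le_lt_trans (Re_le_nm (s w + s v)) h''; rewrite raddfD /= ltr_norml.
  by have := sge w => ? /andP[_]; lra.
- by move=> v Bv; exists 1 => // t t1; apply: sgt; exact: rB.
Qed.

(** A branch s1 at a slightly larger point t1 p selects a root r0 at p, and the roots near r0 form a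
    local branch. On the cone of rays starting in a small disc about p, s1 serves the parameters
    from t1 on and the local branch those below. *)
Lemma liftable_step p : A p -> (forall t : R, 1 < t -> liftable (t%:C * p)) -> liftable p.
Proof.
move=> Ap later.
have np0 : 0 <= nm p := nm_ge0 p.
have phip0 : 0 < nm (phi p) / 4 by rewrite divr_gt0 // nm_gt0 phi0.
have [dA dA0 dAP] := (open_nmP A).1 oA _ Ap.
have [dp dp0 dpP] := cphi Ap phip0.
pose d := Num.min dA dp.
have d0 : 0 < d by rewrite lt_min dA0.
have dD v : nm (v - p) < d -> A v /\ nm (phi v - phi p) < nm (phi p) / 4.
  by rewrite lt_min => /andP[/dAP ? /dpP].
(* Gives t1 <= 2 and puts t1 p within d / 2 of p. *)
pose eta := Num.min 1 (d / (2 * (1 + nm p))).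
have eta0 : 0 < eta by rewrite lt_min ltr01 divr_gt0 // mulr_gt0 //; lra.
have eta1 : eta <= 1 by rewrite ge_min lexx.
have etad : eta * nm p < d / 2.
  have : eta * (2 * (1 + nm p)) <= d.
    by rewrite -ler_pdivlMr ?ge_min ?lexx ?orbT // mulr_gt0 //; lra.
  nra.
pose t1 := 1 + eta.
have t1gt : 1 < t1 by rewrite /t1; lra.
have [B1 [s1 [good1 B1p1]]] := later _ t1gt.
have [oB1 rB1 B1A s1B far1] := good1.
have p1d : nm (t1%:C * p - p) < d / 2.
  rewrite (_ : _ - p = eta%:C * p) ?nmZ //; first exact: ltW.
  by rewrite /t1 rmorphD /=; ring.
have [cs1p1 s1p1] := s1B _ B1p1.
have [r0 [r02 r0s]] : exists r0, r0 ^+ 2 = phi p /\ nm (s1 (t1%:C * p) - r0) <= nm (s1 (t1%:C * p) + r0).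
  have [r0 [h1 h2]] := exists_root_close (phi p) (s1 (t1%:C * p)).
  by exists r0; split=> //; rewrite nmB [X in _ <= nm X]addrC.
have r0n : r0 != 0 by rewrite -sqrf_eq0 r02 phi0.
have nr0 : 0 < nm r0 by rewrite nm_gt0.
have /choice[sg sgP] : forall v, exists z, z ^+ 2 = phi v /\ nm (z - r0) <= nm (z + r0).
  by move=> v; exact: exists_root_close.
have sgD v : nm (v - p) < d -> nm (sg v - r0) < nm r0 / 4 /\ cts_at sg v.
  apply: cts_root_local; [exact: r0n|by rewrite r02|] => w /dD[Aw ?].
  by have [? ?] := sgP w; split=> //; exact: cphi.
have agree1 : sg (t1%:C * p) = s1 (t1%:C * p).
  have p1d' : nm (t1%:C * p - p) < d by lra.
  have [h1 _] := sgD _ p1d'; have [h2 _] := sgP (t1%:C * p).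
  have [//|h] := sqr_eq_sign (etrans h2 (esym s1p1)); exfalso.
  have E : s1 (t1%:C * p) = - sg (t1%:C * p) by rewrite h opprK.
  move: r0s; rewrite E -opprD nmN [X in _ <= nm X]addrC [X in _ <= X]nmB => r0s.
  have := nmBD (r0 + r0) (sg (t1%:C * p) - r0).
  rewrite (_ : r0 + r0 + _ = sg (t1%:C * p) + r0); last by ring.
  rewrite (_ : r0 + r0 = 2%:C * r0) ?nmZ //; first lra.
  by rewrite rmorph_nat; ring.
have [dB dB0 dBP] := (open_nmP B1).1 oB1 _ B1p1.
(* As t1 <= 2, the bound dB / 2 sends t1 v into [B1], and d / 4 keeps t v within d of p for 1 <= t
   <= t1, since 2 (d / 4) + d / 2 = d. *)
pose d2 := Num.min (dB / 2) (d / 4).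
have d20 : 0 < d2 by rewrite lt_min; apply/andP; split; lra.
pose O : set R[i] := [set v | nm (v - p) < d2].
have OB1 v : O v -> B1 (t1%:C * v).
  rewrite /O /= lt_min => /andP[h _]; apply: dBP.
  by rewrite -mulrBr nmZ; have := nm_ge0 (v - p); rewrite /t1; nra.
have OD v t : O v -> 1 <= t -> t <= t1 -> nm (t%:C * v - p) < d.
  rewrite /O /= lt_min => /andP[_ h] h1 h2.
  rewrite (_ : _ - p = t%:C * (v - p) + (t - 1)%:C * p); last by rewrite rmorphB /=; ring.
  apply: (le_lt_trans (nmD _ _)); rewrite !nmZ; [|lra|lra].
  have : (t - 1) * nm p <= eta * nm p by apply: ler_wpM2r => //; rewrite /t1 in h2; lra.
  have := nm_ge0 (v - p); rewrite /t1 in h2; nra.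
pose B2 : set R[i] := [set w | exists v t, [/\ O v, t1 <= t & w = t%:C * v]].
pose B : set R[i] := [set w | exists v t, [/\ O v, 1 <= t & w = t%:C * v]].
have tC0 (t : R) : 1 <= t -> t%:C != 0 :> R[i].
  by move=> t1'; rewrite -nm_gt0 nm_real normr_gt0 gt_eqF //; lra.
have opn (T : R) : 1 <= T -> open [set w | exists v t, [/\ O v, T <= t & w = t%:C * v]].
  move=> T1; apply/open_nmP => w [v [t [Ov tT wE]]].
  have tge1 : 1 <= t by lra.
  exists (t * (d2 - nm (v - p))); first by rewrite mulr_gt0 ?subr_gt0 //; lra.
  move=> w' w'w; exists (w' / t%:C), t; split=> //; last by rewrite mulrC divfK ?tC0.
  rewrite /O /= (_ : _ - p = (w' - w) / t%:C + (v - p)); last by rewrite wE; field; exact: tC0.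
  apply: (le_lt_trans (nmD _ _)); rewrite nmM nmV nm_real ger0_norm; last lra.
  by rewrite -ltrBrDr ltr_pdivrMr; [rewrite mulrC|lra].
have B2B1 w : B2 w -> B1 w.
  move=> [v [t [Ov t1t ->]]].
  rewrite (_ : t%:C * v = (t / t1)%:C * (t1%:C * v)); last first.
    by rewrite mulrA -rmorphM /= divfK // gt_eqF //; lra.
  by apply: rB1; [exact: OB1|rewrite ler_pdivlMr; lra].
(* The sign is transported from t1 p to t1 v, and then along the ray from t1 v to w. *)
have agree w : B2 w -> nm (w - p) < d -> sg w = s1 w.
  move=> [v [t [Ov t1t wE]]] wd.
  have good z : B1 z -> nm (z - p) < d ->
      [/\ cts_at sg z, cts_at s1 z, s1 z != 0 & sg z ^+ 2 = s1 z ^+ 2].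
    move=> B1z zd; have [c1 e1] := s1B z B1z; split=> //.
    - by have [] := sgD z zd.
    - by rewrite -sqrf_eq0 e1 phi0 //; exact: B1A.
    - by rewrite e1; have [] := sgP z.
  have e1 : sg (t1%:C * v) = s1 (t1%:C * v).
    apply: (sign_segment _ agree1) => x /andP[x0 x1] /=.
    rewrite (_ : _ + _ = t1%:C * (p + x%:C * (v - p))); last by ring.
    have Oz : O (p + x%:C * (v - p)).
      rewrite /O /= (_ : _ - p = x%:C * (v - p)) ?nmZ //; last by ring.
      by apply: le_lt_trans Ov; rewrite ler_piMl ?nm_ge0.
    by apply: good; [exact: OB1|apply: OD => //; lra].
  have : sg w = s1 w.
    apply: (sign_segment _ e1) => x /andP[x0 x1] /=.
    have e2 : t1%:C * v + x%:C * (w - t1%:C * v) = (t1 + x * (t - t1))%:C * v.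
      by rewrite wE [in RHS]rmorphD rmorphM rmorphB /=; ring.
    apply: good.
      rewrite e2; apply: B2B1; exists v, (t1 + x * (t - t1)); split=> //.
      by rewrite lerDl mulr_ge0 // subr_ge0.
    have h1 : nm (t1%:C * v - p) < d by apply: OD => //; lra.
    rewrite (_ : _ - p = (1 - x)%:C * (t1%:C * v - p) + x%:C * (w - p)); last first.
      by rewrite rmorphB /=; ring.
    apply: (le_lt_trans (nmD _ _)); rewrite !nmZ; [|lra|lra].
    have [xe|xn] := eqVneq x 0; first by rewrite xe; lra.
    have xgt : 0 < x by rewrite lt_neqAle eq_sym xn.
    nra.
  by [].
pose s w := if `[< B2 w >] then s1 w else sg w.
have s_B2 w : B2 w -> s w = s1 w by move=> B2w; rewrite /s asboolT.
have s_D w : nm (w - p) < d -> s w = sg w.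
  by move=> wd; rewrite /s; case: asboolP => // /agree ->.
have BP w : B w -> B2 w \/ nm (w - p) < d.
  move=> [v [t [Ov tge wE]]]; have [le|/ltW le] := leP t1 t.
    by left; exists v, t.
  by right; rewrite wE; exact: OD.
have BA : B `<=` A by move=> w /BP[/B2B1/B1A//|/dD[]].
exists B, s; split; last first.
  by exists p, 1; split=> //; [rewrite /O /= subrr nm0|rewrite mul1r].
split=> //; first exact: opn.
- move=> w t [v [t' [Ov t'1 ->]]] tge; exists v, (t * t'); split=> //; first by nra.
  by rewrite mulrA -rmorphM.
- move=> w /BP[B2w|wd].
    have [c e] := s1B _ (B2B1 _ B2w); rewrite s_B2 //; split=> //.
    have [dd dd0 ddP] := (open_nmP B2).1 (opn t1 (ltW t1gt)) _ B2w.
    by apply: (cts_at_near dd0 _ c) => x /ddP /s_B2.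
  rewrite s_D //; split; last by have [] := sgP w.
  have wd' : 0 < d - nm (w - p) by lra.
  apply: (cts_at_near wd' _ (sgD w wd).2) => x xw; rewrite s_D //.
  rewrite (_ : x - p = (x - w) + (w - p)); last by ring.
  by apply: (le_lt_trans (nmD _ _)); lra.
- move=> w [v [t [Ov tge wE]]].
  have B2w : B2 (t1%:C * w) by exists v, (t1 * t); split=> //; [nra|rewrite wE mulrA -rmorphM].
  have [T T1 hT] := far1 _ (B2B1 _ B2w).
  exists (T * t1) => [|x xT]; first by nra.
  have xE : x%:C * w = (x / t1)%:C * (t1%:C * w).
    by rewrite mulrA -rmorphM /= divfK // gt_eqF //; lra.
  have xt : T <= x / t1 by rewrite ler_pdivlMr //; lra.
  rewrite xE s_B2; first exact: hT.
  have [v' [t' [Ov' t't ->]]] := B2w.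
  exists v', (x / t1 * t'); split=> //; first by nra.
  by rewrite mulrA -rmorphM.
Qed.

(** Otherwise let T be the supremum of the parameters t >= 1 with t u not liftable. All larger
    parameters are liftable, hence so is T u by [liftable_step]; the branch there lives on an open
    set, which contains t u for t just below T, against the choice of T. *)
Lemma liftable_all u : A u -> liftable u.
Proof.
move=> Au; apply: contrapT => nLu.
have u0 : 0 < nm u by rewrite nm_gt0; apply/eqP => h; apply: A0; rewrite -h.
pose Z : set R := [set t | 1 <= t /\ ~ liftable (t%:C * u)].
have Z1 : Z 1 by split=> //; rewrite mul1r.
have ZM t : Z t -> t <= `|M| / nm u.
  move=> [t1 nL]; rewrite ler_pdivlMr // leNgt; apply/negP => h; apply: nL.
  apply: liftable_far; first exact: rA.
  by rewrite nmZ; [apply: le_lt_trans h; exact: ler_norm|lra].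
have supZ : has_sup Z by split; [exists 1|exists (`|M| / nm u) => t /ZM].
pose T := sup Z.
have T1 : 1 <= T by apply: ub_le_sup => //; exact: supZ.2.
have later t : T < t -> liftable (t%:C * u).
  move=> Tt; apply: contrapT => nL; have : t <= T.
    by apply: ub_le_sup; [exact: supZ.2|split=> //; lra].
  by rewrite leNgt Tt.
have [B [s [good Bp]]] : liftable (T%:C * u).
  apply: liftable_step; first exact: rA.
  move=> t t1; rewrite mulrA -rmorphM; apply: later; nra.
have [oB _ _ _ _] := good; have [d d0 dB] := (open_nmP B).1 oB _ Bp.
have du : 0 < d / nm u by rewrite divr_gt0.
have [t [tge nL] tT] := sup_adherent du supZ.
have tT' : t <= T by apply: ub_le_sup; [exact: supZ.2|].
apply: nL; exists B, s; split=> //; apply: dB.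
rewrite -mulrBl -rmorphB nmM nm_real -ltr_pdivlMr // ler0_norm; rewrite -/T in tT; lra.
Qed.
End Lift.

(** The branches are glued by choosing one at every point; their common sign far out on each ray
    makes the choices agree. *)
Lemma ray_sqrt A phi (M : R) : open A -> ray_closed A -> ~ A 0 ->
  (forall u, A u -> cts_at phi u) -> (forall u, A u -> phi u != 0) ->
  (forall u, A u -> M < nm u -> nm (phi u - 1) < 1) ->
  exists s, (forall u, A u -> cts_at s u /\ s u ^+ 2 = phi u) /\
    forall u, A u -> exists2 T : R, 1 <= T &
      forall t, T <= t -> 0 < complex.Re (s (t%:C * u)).
Proof.
move=> oA rA A0 cphi phi0 far.
have L u : A u -> liftable A phi u by apply: (@liftable_all A phi M).
have /choice[Bs BsP] : forall u, exists Bs : set R[i] * (R[i] -> R[i]),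
    A u -> ray_root A phi Bs.1 Bs.2 /\ Bs.1 u.
  move=> u; have [/L[B [s Bs]]|nA] := pselect (A u); first by exists (B, s).
  by exists (set0, id).
pose s u := (Bs u).2 u.
have sE u B s' : A u -> ray_root A phi B s' -> B u -> s u = s' u.
  by move=> /BsP[g Bu] g' B'u; exact: (ray_root_uniq phi0 g g' Bu B'u).
exists s; split=> u Au; have [g Bu] := BsP u Au; have [oB rB BA sB fB] := g.
  have [c e] := sB u Bu; split; last by rewrite /s.
  have [d d0 dB] := (open_nmP _).1 oB _ Bu.
  by apply: (cts_at_near d0 _ c) => w /dB Bw; rewrite (sE w _ _ (BA _ Bw) g Bw).
have [T T1 hT] := fB u Bu; exists T => // t Tt.
have Bt : (Bs u).1 (t%:C * u) by apply: rB => //; lra.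
by rewrite (sE _ _ _ (BA _ Bt) g Bt); exact: hT.
Qed.
End RaySqrt.

(** * Connectedness and compactness in the plane *)

Section PlaneTopology.
Variable R : realType.
Implicit Types (A U E : set R[i]) (u v w p q z : R[i]).

Lemma cplx_continuous : continuous (@cplx R).
Proof.
move=> p A /nbhs_nmP[d d0 dA]; apply/nbhs_boxP; exists (d / 2) => [|q h1 h2]; first lra.
apply: dA; apply: (le_lt_trans (nm_le_ReIm _)); rewrite /cplx /= distrC.
by rewrite [X in _ + X]distrC; lra.
Qed.

Lemma hausdorff_complex : hausdorff_space R[i].
Proof. exact: norm_hausdorff. Qed.

Lemma closed_nmP A : closed A <->
  forall z, ~ A z -> exists2 d : R, 0 < d & forall w, nm (w - z) < d -> ~ A w.
Proof. by rewrite -openC; exact: open_nmP. Qed.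

Lemma closed_bounded_compact A (M : R) : closed A -> (forall z, A z -> nm z <= M) ->
  compact A.
Proof.
move=> cA bA; pose B : set (R * R) := `[- M, M]%classic `*` `[- M, M]%classic.
have cB : compact (@cplx R @` B).
  apply: continuous_compact; first by apply: continuous_subspaceT; exact: cplx_continuous.
  by apply: compact_setX; exact: segment_compact.
apply: (subclosed_compact cA cB) => z Az; exists (complex.Re z, complex.Im z); last by case: z Az.
have zM := bA z Az; rewrite /B /= !in_itv /= -!ler_norml.
by split; [apply: le_trans zM; exact: Re_le_nm|apply: le_trans zM; exact: Im_le_nm].
Qed.

Lemma nm_cts z (e : R) : 0 < e -> forall w, nm (w - z) < e -> `|nm w - nm z| < e.
Proof.
move=> e0 w wz; have := nmBB w z; have := nmBB z w; rewrite [nm (z - w)]nmB => h1 h2.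
by rewrite ltr_norml; apply/andP; split; lra.
Qed.

Lemma nm_comp_continuous A (F : R[i] -> R[i]) : (forall z, A z -> cts_at F z) ->
  {within A, continuous (fun z => nm (F z) : R)}.
Proof.
move=> cF; apply: continuous_in_subspaceT => z /[!inE] Az B /nbhs_ballP[e /= e0 eB].
have [d d0 dF] := cF z Az e e0; apply/nbhs_nmP; exists d => // w /dF h.
by apply: eB; rewrite -ball_normE /= distrC; exact: nm_cts h.
Qed.

Lemma connected_clopen U E : connected U -> E `<=` U -> E !=set0 -> open E ->
  open (U `\` E) -> U `<=` E.
Proof.
move=> cU EU E0 oE oUE; suff <- : E = U by [].
apply: cU => //; first by exists E => //; apply/seteqP; split=> [z Ez|z []] //; split=> //; exact: EU.
exists (~` (U `\` E)); first by rewrite closedC.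
apply/seteqP; split=> [z Ez|z [Uz nUE]]; first by split; [exact: EU|case].
by apply: contrapT => nE; apply: nUE.
Qed.

Definition segment_in A p q := forall t : R, 0 <= t <= 1 -> A (p + t%:C * (q - p)).

Lemma segment_image_connected p q :
  connected ((fun t : R => p + t%:C * (q - p)) @` `[0, 1]%classic).
Proof.
apply: connected_continuous_connected; first exact: segment_connected.
apply: continuous_subspaceT => t B /nbhs_nmP[d d0 dB].
have N0 := nm_ge0 (q - p).
apply/nbhs_ballP; exists (d / (1 + nm (q - p))) => /=; first by rewrite divr_gt0 //; lra.
move=> x; rewrite -ball_normE /= => xt; apply: dB.
rewrite (_ : _ - _ = (x - t)%:C * (q - p)); last by rewrite rmorphB /=; ring.
rewrite nmM nm_real distrC.
by move: xt; rewrite ltr_pdivlMr; [have := normr_ge0 (t - x); nra|lra].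
Qed.

(** Two segments suffice inside the outer square; the levels of [H] need one more, along a ray, to
    reach it. *)
Lemma connected_of_segments A x0 :
  (forall x, A x -> exists p1 p2, [/\ segment_in A x p1, segment_in A p1 p2 & segment_in A p2 x0]) ->
  connected A.
Proof.
move=> H; pose sg p q := (fun t : R => p + t%:C * (q - p)) @` `[0, 1]%classic.
have sg0 p q : sg p q p by exists 0; [rewrite /= in_itv /= lexx ler01|rewrite mul0r addr0].
have sg1 p q : sg p q q.
  by exists 1; [rewrite /= in_itv /= lexx ler01|rewrite mul1r addrC subrK].
have sgA p q : segment_in A p q -> sg p q `<=` A.
  by move=> h z [t]; rewrite /= in_itv /= => /h ? <-.
have /choice[P PP] : forall x, exists P : R[i] * R[i], A x ->
    [/\ segment_in A x P.1, segment_in A P.1 P.2 & segment_in A P.2 x0].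
  move=> x; have [/H[p1 [p2 h]]|nA] := pselect (A x); first by exists (p1, p2).
  by exists (0, 0).
rewrite (_ : A = \bigcup_(x in A) (sg x (P x).1 `|` sg (P x).1 (P x).2 `|` sg (P x).2 x0)).
  apply: bigcup_connected; first by exists x0 => x Ax; right; exact: sg1.
  move=> x Ax; apply: connectedU; last exact: segment_image_connected.
    by exists (P x).2; split; [right; exact: sg1|exact: sg0].
  apply: connectedU; [|exact: segment_image_connected|exact: segment_image_connected].
  by exists (P x).1; split; [exact: sg1|exact: sg0].
apply/seteqP; split=> [x Ax|z [x Ax]]; first by exists x => //; left; left; exact: sg0.
by have [h1 h2 h3] := PP x Ax; move=> [[]|] h; apply: (sgA _ _ _ z h).
Qed.

Definition outer_square (M : R) : set R[i] :=
  [set z | M < `|complex.Re z| \/ M < `|complex.Im z|].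

Lemma convex_gt (M x y t : R) : M < x -> M < y -> 0 <= t -> t <= 1 -> M < x + t * (y - x).
Proof. by move=> Mx My t0 t1; have [xy|yx] := leP x y; nra. Qed.

(** Convexity keeps a segment inside one of the four half-planes. From the left or the lower one the
    path first runs parallel to the side of the square until it has entered the upper or the right
    one, which contains the target. *)
Lemma outer_square_segment (M : R) z : 0 <= M -> outer_square M z ->
  exists2 p, segment_in (outer_square M) z p &
    segment_in (outer_square M) p ((M + 1) +i* (M + 1)).
Proof.
move=> M0.
have half (part : R[i] -> R) (sg : R) (p q : R[i]) :
    (forall u v (t : R), part (u + t%:C * (v - u)) = part u + t * (part v - part u)) ->
    sg * sg = 1 -> M < sg * part p -> M < sg * part q ->
    forall t : R, 0 <= t <= 1 -> M < `|part (p + t%:C * (q - p))|.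
  move=> aff sg1 Mp Mq t /andP[t0 t1].
  have sgn : `|sg| = 1.
    by apply/eqP; rewrite -sqrp_eq1 // -normrX expr2 sg1 normr1.
  rewrite -[X in _ < X]mul1r -sgn -normrM; apply: lt_le_trans (ler_norm _).
  by rewrite aff mulrDr mulrCA mulrBr; exact: convex_gt.
have affR u v (t : R) : complex.Re (u + t%:C * (v - u)) =
    complex.Re u + t * (complex.Re v - complex.Re u :> R).
  by case: u v => [? ?] [? ?] /=; rewrite mul0r subr0.
have affI u v (t : R) : complex.Im (u + t%:C * (v - u)) =
    complex.Im u + t * (complex.Im v - complex.Im u :> R).
  by case: u v => [? ?] [? ?] /=; rewrite mul0r addr0.
have P1 : (1 : R) * 1 = 1 by rewrite mulr1.
have N1 : (-1 : R) * -1 = 1 by rewrite mulrNN mulr1.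
pose c : R[i] := (M + 1) +i* (M + 1).
have cR : M < 1 * complex.Re c by rewrite /=; lra.
have cI : M < 1 * complex.Im c by rewrite /=; lra.
case=> h; move: (h); rewrite lter_normr => /orP[h'|h'].
- have zR : M < 1 * complex.Re z by lra.
  by exists c => t tI; left; apply: half affR P1 _ _ _ tI.
- have zR : M < -1 * complex.Re z by lra.
  pose p : R[i] := complex.Re z +i* (M + 1).
  have pR : M < -1 * complex.Re p by [].
  have pI : M < 1 * complex.Im p by rewrite /=; lra.
  exists p => t tI; first by left; apply: half affR N1 _ _ _ tI.
  by right; apply: half affI P1 _ _ _ tI.
- have zI : M < 1 * complex.Im z by lra.
  by exists c => t tI; right; apply: half affI P1 _ _ _ tI.
- have zI : M < -1 * complex.Im z by lra.
  pose p : R[i] := (M + 1) +i* complex.Im z.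
  have pI : M < -1 * complex.Im p by [].
  have pR : M < 1 * complex.Re p by rewrite /=; lra.
  exists p => t tI; first by right; apply: half affI N1 _ _ _ tI.
  by left; apply: half affR P1 _ _ _ tI.
Qed.

Lemma outer_square_nm (M : R) z : outer_square M z -> M < nm z.
Proof.
by move=> [] h; apply: (lt_le_trans h); [exact: Re_le_nm|exact: Im_le_nm].
Qed.

Lemma nm_outer_square (M : R) z : 2 * M < nm z -> outer_square M z.
Proof.
move=> h; apply: contrapT => /not_orP[/negP h1 /negP h2].
rewrite -!leNgt in h1 h2; have := nm_le_ReIm z; lra.
Qed.

Lemma outer_square_open (M : R) : open (outer_square M).
Proof.
apply/open_nmP => z [] h.
  exists (`|complex.Re z| - M) => [|w wz]; first by rewrite subr_gt0.
  left; have := Re_le_nm (w - z); rewrite raddfB /= => h'.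
  by have := ler_distD (complex.Re w) (complex.Re z) 0; rewrite !subr0 distrC; lra.
exists (`|complex.Im z| - M) => [|w wz]; first by rewrite subr_gt0.
right; have := Im_le_nm (w - z); rewrite raddfB /= => h'.
by have := ler_distD (complex.Im w) (complex.Im z) 0; rewrite !subr0 distrC; lra.
Qed.

Lemma outer_square_connected (M : R) : 0 <= M -> connected (outer_square M).
Proof.
move=> M0; apply: (@connected_of_segments _ ((M + 1) +i* (M + 1))) => x Qx.
have [p h1 h2] := outer_square_segment M0 Qx; exists p, p; split=> //.
move=> t _; rewrite subrr mulr0 addr0; have := h1 1; rewrite mul1r addrC subrK.
by apply; rewrite lexx ler01.
Qed.

(** The values of psi on |z| > r are relatively open in the outer square because psi is open, and
    relatively closed because preimages are at distance at most 1 and so stay in a compact annulus.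
    The gap r + 2 <= M keeps them off the inner boundary. *)
Lemma near_identity_surjective U (psi : R[i] -> R[i]) (r M : R) :
  0 <= r -> r + 2 <= M -> (forall z, r < nm z -> U z) ->
  (forall z, U z -> cts_at psi z) ->
  (forall W, open W -> W `<=` U -> open (psi @` W)) ->
  (forall z, r < nm z -> nm (psi z - z) <= 1) ->
  forall w, outer_square M w -> exists2 z, r < nm z & psi z = w.
Proof.
move=> r0 rM rU cpsi opsi near1.
pose far : set R[i] := [set z | r < nm z].
pose E := outer_square M `&` psi @` far.
have ofar : open far.
  apply/open_nmP => z fz; exists (nm z - r); first by rewrite subr_gt0.
  by move=> w wz; have := nmBB z w; rewrite [nm (z - w)]nmB /far /= in fz *; lra.
suff H : outer_square M `<=` E by move=> w /H[_ [z ? <-]]; exists z.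
apply: connected_clopen.
- by apply: outer_square_connected; lra.
- by move=> w [].
- pose z : R[i] := (M + 2)%:C; have z2 : nm z = M + 2 by rewrite nm_real ger0_norm //; lra.
  have fz : far z by move: z2; rewrite /far; move: z => z z2 /=; rewrite z2; lra.
  exists (psi z); split; last by exists z.
  left; have := le_trans (Re_le_nm _) (near1 z fz); rewrite raddfB /= lter_normr ler_norml.
  by move=> /andP[? ?]; apply/orP; left; lra.
- apply: openI; first exact: outer_square_open.
  by apply: opsi => // z /rU.
- apply/open_nmP => w [Qw nEw].
  (* Contains every preimage in |z| > r of a point of the outer square within 1 of w. *)
  pose K : set R[i] := [set z | r + 1 <= nm z /\ nm z <= nm w + 2].
  have cK : compact K.
    apply: (@closed_bounded_compact _ (nm w + 2)) => [|z []] //.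
    apply/closed_nmP => z /not_andP[/negP|/negP]; rewrite -ltNge => h.
      exists (r + 1 - nm z); first by rewrite subr_gt0.
      by move=> x xz [h1 _]; have := nmBB x z; lra.
    exists (nm z - (nm w + 2)); first by rewrite subr_gt0.
    by move=> x xz [_ h1]; have := nmBB z x; rewrite [nm (z - x)]nmB; lra.
  have clK : closed (psi @` K).
    apply: compact_closed; first exact: hausdorff_complex.
    apply: continuous_compact cK; apply: continuous_in_subspaceT => z /[!inE] -[h _].
    by apply/cts_atP; apply: cpsi; apply: rU; lra.
  have nKw : ~ (psi @` K) w.
    move=> [z [h1 h2] pz]; apply: nEw; split=> //; exists z => //; rewrite /far /=; lra.
  have [d d0 dK] := (closed_nmP _).1 clK w nKw.
  have [d' d'0 dQ] := (open_nmP _).1 (@outer_square_open M) w Qw.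
  exists (Num.min 1 (Num.min d d')); first by rewrite !lt_min ltr01 d0.
  move=> x; rewrite !lt_min => /and3P[x1 /dK nKx /dQ Qx]; split=> // -[_ [z fz pz]].
  apply: nKx; exists z => //; have := near1 z fz; rewrite pz => h.
  have := outer_square_nm Qx; have := nmBB x z; have := nmBB z x.
  have := nmBB x w; rewrite [nm (z - x)]nmB /K /= => *; split; lra.
Qed.
End PlaneTopology.

(** * The stretch and its square *)

Section Stretch.
Variable R : realType.
Implicit Types (z w u v : R[i]).

Definition stretch_coef1 (K : R) : R[i] := ((K + 1) / 2%:R)%:C.
Definition stretch_coef2 (K theta : R) : R[i] :=
  (cos (2%:R * theta) +i* sin (2%:R * theta)) * ((K - 1) / 2%:R)%:C.

(* One constant, at least 1, for the Lipschitz bounds of the stretch and of its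
   inverse. *)
Definition distortion (K theta : R) : R :=
  1 + (nm (stretch_coef1 K) + nm (stretch_coef2 K theta)) +
      (nm (stretch_coef1 K^-1) + nm (stretch_coef2 K^-1 theta)).

Lemma stretchE (K theta : R) z :
  stretch K theta z = stretch_coef1 K * z + stretch_coef2 K theta * z^*%C.
Proof. by []. Qed.

Lemma stretchD (K theta : R) z w : stretch K theta (z + w) = stretch K theta z + stretch K theta w.
Proof. by rewrite !stretchE conjD; ring. Qed.
Lemma stretchN (K theta : R) z : stretch K theta (- z) = - stretch K theta z.
Proof. by rewrite !stretchE rmorphN /=; ring. Qed.
Lemma stretchB (K theta : R) z w : stretch K theta (z - w) = stretch K theta z - stretch K theta w.
Proof. by rewrite stretchD stretchN. Qed.
Lemma stretchZ (K theta : R) (t : R) z : stretch K theta (t%:C * z) = t%:C * stretch K theta z.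
Proof. by rewrite !stretchE conjM conjc_real; ring. Qed.
Lemma stretch0 (K theta : R) : stretch K theta 0 = 0.
Proof. by rewrite stretchE conjc0; ring. Qed.

Lemma distortion_ge1 (K theta : R) : 1 <= distortion K theta.
Proof.
rewrite /distortion; have := nm_ge0 (stretch_coef1 K); have := nm_ge0 (stretch_coef2 K theta).
have := nm_ge0 (stretch_coef1 K^-1); have := nm_ge0 (stretch_coef2 K^-1 theta).
by move=> *; lra.
Qed.

Lemma distortionV (K theta : R) : distortion K^-1 theta = distortion K theta.
Proof. by rewrite /distortion invrK; ring. Qed.

Lemma stretch_coef_le (K theta : R) :
  nm (stretch_coef1 K) + nm (stretch_coef2 K theta) <= distortion K theta.
Proof.
rewrite /distortion.
have := nm_ge0 (stretch_coef1 K^-1); have := nm_ge0 (stretch_coef2 K^-1 theta).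
by move=> *; lra.
Qed.

Lemma stretch_le (K theta : R) z : nm (stretch K theta z) <= distortion K theta * nm z.
Proof.
rewrite stretchE; apply: (le_trans (nmD _ _)); rewrite (nmM _ z) (nmM _ z^*%C) nm_conj -mulrDl.
by apply: ler_wpM2r; [exact: nm_ge0|exact: stretch_coef_le].
Qed.

Section Fixed.
Variables (K theta : R) (hK : 0 < K) (c : R[i]).
Local Notation h := (stretch K theta).
Local Notation h' := (stretch K^-1 theta).
Local Notation N := (distortion K theta).
Local Notation H := (sqr_stretch K theta).
Local Notation f := (sqr_stretch_add K theta c).

Lemma stretch_factor_neq0 : K != 0. Proof. by rewrite gt_eqF. Qed.

Lemma stretchVK : cancel h' h.
Proof. by have := stretchK theta (invr_neq0 stretch_factor_neq0); rewrite invrK. Qed.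

Lemma stretch_ge z : nm z <= N * nm (h z).
Proof. by rewrite -{1}(stretchK theta stretch_factor_neq0 z) -distortionV; exact: stretch_le. Qed.

Lemma stretchV_le z : nm (h' z) <= N * nm z.
Proof. by rewrite -distortionV; exact: stretch_le. Qed.

Lemma stretch_eq0 z : (h z == 0) = (z == 0).
Proof.
apply/eqP/eqP => [hz|->]; last exact: stretch0.
by rewrite -(stretchK theta stretch_factor_neq0 z) hz stretch0.
Qed.

Lemma distortion_gt0 : 0 < N. Proof. by have := distortion_ge1 K theta; lra. Qed.

Lemma stretch_cts (L : R) z : cts_at (stretch L theta) z.
Proof.
move=> e e0; have D := distortion_ge1 L theta.
exists (e / distortion L theta) => [|w]; first by rewrite divr_gt0 //; lra.
rewrite ltr_pdivlMr; last lra.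
rewrite -stretchB => h1; apply: (le_lt_trans (stretch_le _ _ _)); lra.
Qed.

Lemma sqr_stretch_cts z : cts_at H z.
Proof.
apply: (@cts_at_near _ (fun w => h w * h w) _ _ 1) => //.
by apply: cts_atM; exact: stretch_cts.
Qed.

Lemma sqr_stretch_add_cts z : cts_at f z.
Proof. by apply: cts_atD; [exact: sqr_stretch_cts|exact: cts_at_cst]. Qed.

Lemma sqr_stretchN z : H (- z) = H z.
Proof. by rewrite /sqr_stretch stretchN sqrrN. Qed.
Lemma sqr_stretch_addN z : f (- z) = f z.
Proof. by rewrite /sqr_stretch_add sqr_stretchN. Qed.
Lemma sqr_stretch0 : H 0 = 0.
Proof. by rewrite /sqr_stretch stretch0 expr0n. Qed.
Lemma sqr_stretch_add0 : f 0 = c.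
Proof. by rewrite /sqr_stretch_add sqr_stretch0 add0r. Qed.
Lemma sqr_stretchZ (t : R) z : H (t%:C * z) = (t ^+ 2)%:C * H z.
Proof. by rewrite /sqr_stretch stretchZ exprMn rmorphXn. Qed.

Lemma sqr_stretch_inj z w : H z = H w -> z = w \/ z = - w.
Proof.
move=> /sqr_eq_sign[E|E]; [left|right].
  by rewrite -(stretchK theta stretch_factor_neq0 z) E (stretchK theta stretch_factor_neq0).
by rewrite -(stretchK theta stretch_factor_neq0 z) E stretchN (stretchK theta stretch_factor_neq0).
Qed.

Lemma sqr_stretch_add_inj z w : f z = f w -> z = w \/ z = - w.
Proof. by move=> /addIr; exact: sqr_stretch_inj. Qed.

(** The root r nearer to h z0 satisfies |r - h z0|^2 <= |r - h z0| |r + h z0| = |v - H z0|. The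
    bound is of square-root type because it has to hold at the critical point as well. *)
Lemma sqr_stretch_lift z0 v : exists z, H z = v /\ nm (z - z0) ^+ 2 <= N ^+ 2 * nm (v - H z0).
Proof.
have [r [r2 rs]] := exists_root_close v (h z0).
exists (h' r); split; first by rewrite /sqr_stretch stretchVK.
have E : nm (h' r - z0) <= N * nm (r - h z0).
  by rewrite -{1}(stretchK theta stretch_factor_neq0 z0) -stretchB; exact: stretchV_le.
have D : nm (r - h z0) * nm (r - h z0) <= nm (v - H z0).
  by rewrite -r2 /sqr_stretch subr_sqr nmM ler_wpM2l ?nm_ge0.
have := nm_ge0 (h' r - z0); have := nm_ge0 (r - h z0); have := distortion_gt0.
move=> N0 d0 d1; apply: le_trans (_ : (N * nm (r - h z0)) ^+ 2 <= _).
  by rewrite ler_pXn2r ?nnegrE // mulr_ge0 // ltW.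
by rewrite exprMn ler_wpM2l ?sqr_ge0 // expr2.
Qed.

Lemma sqr_stretch_add_lift z0 v :
  exists z, f z = v /\ nm (z - z0) ^+ 2 <= N ^+ 2 * nm (v - f z0).
Proof.
have [z [Hz zz0]] := sqr_stretch_lift z0 (v - c).
exists z; split; first by rewrite /sqr_stretch_add Hz subrK.
by rewrite (_ : v - f z0 = v - c - H z0) // /sqr_stretch_add; ring.
Qed.

Lemma lift_open (F : R[i] -> R[i]) (C : R) :
  0 < C -> (forall z0 v, exists z, F z = v /\ nm (z - z0) ^+ 2 <= C ^+ 2 * nm (v - F z0)) ->
  forall z0 (e : R), 0 < e -> exists2 d : R, 0 < d &
    forall v, nm (v - F z0) < d -> exists2 z, nm (z - z0) < e & F z = v.
Proof.
move=> C0 L z0 e e0; exists ((e / C) ^+ 2); first by rewrite exprn_gt0 // divr_gt0.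
move=> v hv; have [z [Fz zz]] := L z0 v; exists z => //.
rewrite -(ltr_pXn2r (n := 2)) // ?nnegrE ?nm_ge0 ?ltW //.
apply: (le_lt_trans zz); rewrite expr_div_n ltr_pdivlMr ?exprn_gt0 // in hv.
by rewrite mulrC.
Qed.

Definition sqr_stretch_open := lift_open distortion_gt0 sqr_stretch_lift.
Definition sqr_stretch_add_open := lift_open distortion_gt0 sqr_stretch_add_lift.

Lemma sqr_stretch_ge z : nm z ^+ 2 <= N ^+ 2 * nm (H z).
Proof.
rewrite /sqr_stretch nmX -exprMn ler_pXn2r ?nnegrE ?nm_ge0 ?mulr_ge0 ?nm_ge0 ?(ltW distortion_gt0) //.
exact: stretch_ge.
Qed.

Lemma sqr_stretch_le z : nm (H z) <= N ^+ 2 * nm z ^+ 2.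
Proof.
rewrite /sqr_stretch nmX -exprMn ler_pXn2r ?nnegrE ?nm_ge0 ?mulr_ge0 ?nm_ge0 ?(ltW distortion_gt0) //.
exact: stretch_le.
Qed.

Lemma sqr_stretch_add_ge z : nm z ^+ 2 <= N ^+ 2 * (nm (f z) + nm c).
Proof.
apply: (le_trans (sqr_stretch_ge z)); rewrite ler_wpM2l ?sqr_ge0 //.
by have := nmBB (f z) c; rewrite {2}/sqr_stretch_add addrK; have := nmD (f z) (- c);
  rewrite /sqr_stretch_add addrK nmN.
Qed.

Lemma sqr_stretch_add_le z : nm (f z) <= N ^+ 2 * nm z ^+ 2 + nm c.
Proof. by apply: (le_trans (nmD _ _)); rewrite lerD2r; exact: sqr_stretch_le. Qed.
End Fixed.
End Stretch.

(** * Inverse coordinates *)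

Section InverseCoordinate.
Variable R : realType.
Implicit Types (z w u v : R[i]).

Lemma cts_atV z : z != 0 -> cts_at (fun w : R[i] => w^-1) z.
Proof.
move=> z0 e e0; have nz : 0 < nm z by rewrite nm_gt0.
exists (Num.min (nm z / 2) (e * (nm z ^+ 2 / 2))).
  by rewrite lt_min; apply/andP; split; [lra|rewrite mulr_gt0 // divr_gt0 // exprn_gt0].
move=> w; rewrite lt_min => /andP[h1 h2].
have nw : nm z / 2 < nm w by have := nmBB z w; have := nmBB z (z - w); rewrite nmB in h1;
  rewrite (_ : z - (z - w) = w); [lra|ring].
have w0 : w != 0 by rewrite -nm_gt0; lra.
rewrite (_ : _ - _ = - ((w - z) / (w * z))); last by field; rewrite w0 z0.
rewrite nmN nmM nmV nmM ltr_pdivrMr; last by rewrite mulr_gt0 //; lra.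
apply: (lt_trans h2); rewrite ltr_pM2l // expr2; nra.
Qed.

Variables (K theta : R) (hK : 0 < K) (c : R[i]).
Local Notation h := (stretch K theta).
Local Notation h' := (stretch K^-1 theta).
Local Notation N := (distortion K theta).
Local Notation H := (sqr_stretch K theta).
Local Notation f := (sqr_stretch_add K theta c).

(** A homeomorphism of W onto V conjugating [H] to [f], with W forward invariant. The fourth clause
    expresses at once that Phi is open and that its inverse is continuous. *)
Definition inv_coord (W V : set R[i]) (Phi : R[i] -> R[i]) : Prop :=
  [/\ forall w, W w -> cts_at Phi w,
      (forall w, W w -> V (Phi w)) /\ (forall z, V z -> exists2 w, W w & Phi w = z),
      forall w w', W w -> W w' -> Phi w = Phi w' -> w = w',
      forall w, W w -> forall e : R, 0 < e -> exists2 d : R, 0 < d &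
        forall z, nm (z - Phi w) < d -> exists w', [/\ W w', nm (w' - w) < e & Phi w' = z] &
      forall w, W w -> W (H w) /\ f (Phi w) = Phi (H w)].

Variables (M : R) (V0 : set R[i]) (Phi0 : R[i] -> R[i]).
Hypotheses (M0 : 0 <= M) (MN : 2 * N ^+ 2 <= M) (Mc : 1 + nm c <= M).

Definition square_level n : set R[i] := [set w | outer_square M (iter n H w)].
Definition preimage_level n : set R[i] := [set z | V0 (iter n f z)].
Local Notation Wn := square_level.
Local Notation Vn := preimage_level.

Hypotheses (base : inv_coord (Wn 0) (Vn 0) Phi0)
  (near0 : forall w, Wn 0 w -> nm (Phi0 w - w) <= 1).

(** From |w|^2 <= N^2 |H w| and |w| > M >= 2 N^2; the doubled modulus exceeds 2 M, which forces the
    outer square. *)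
Lemma outer_square_H w : outer_square M w -> outer_square M (H w) /\ 2 * nm w <= nm (H w).
Proof.
move=> /outer_square_nm Mw; have := sqr_stretch_ge theta hK w.
have N1 := distortion_ge1 K theta; have N2 : 0 < N ^+ 2 by rewrite exprn_gt0 //; lra.
move=> h1; have h2 : 2 * nm w <= nm (H w).
  rewrite -(ler_pM2l N2); apply: le_trans h1.
  rewrite [X in _ <= X]expr2 mulrA; apply: ler_wpM2r; first exact: nm_ge0.
  by rewrite mulrC; apply: le_trans MN (ltW Mw).
by split=> //; apply: nm_outer_square; lra.
Qed.

Lemma square_level_mono n m : (n <= m)%N -> Wn n `<=` Wn m.
Proof.
move=> nm w; rewrite -(subnK nm); elim: (m - n)%N => [//|k IH] /IH.
by rewrite addSn /square_level /= => /outer_square_H[].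
Qed.

Lemma square_levelS n w : Wn n.+1 w <-> Wn n (H w).
Proof. by rewrite /square_level /= -iterSr. Qed.

Lemma preimage_levelS n z : Vn n.+1 z <-> Vn n (f z).
Proof. by rewrite /preimage_level /= -iterSr. Qed.

Lemma iter_cts (F : R[i] -> R[i]) : (forall z, cts_at F z) ->
  forall n z, cts_at (iter n F) z.
Proof.
move=> cF; elim=> [|n IH] z; first exact: cts_at_id.
exact: cts_at_comp (IH z) (cF _).
Qed.

Lemma open_preim (F : R[i] -> R[i]) (A : set R[i]) : (forall z, cts_at F z) -> open A ->
  open [set z | A (F z)].
Proof.
move=> cF oA; apply/open_nmP => z AFz; have [d d0 dA] := (open_nmP A).1 oA _ AFz.
by have [d' d'0 dF] := cF z d d0; exists d' => // w /dF /dA.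
Qed.

Lemma square_level_open n : open (Wn n).
Proof.
apply: open_preim; last exact: outer_square_open.
by apply: iter_cts; exact: sqr_stretch_cts.
Qed.

Lemma iter_sqr_stretchZ n (t : R) w : 1 <= t ->
  exists2 t' : R, 1 <= t' & iter n H (t%:C * w) = t'%:C * iter n H w.
Proof.
move=> t1; elim: n => [|n [t' t'1 E]]; first by exists t.
exists (t' ^+ 2); first by rewrite exprn_ege1.
by rewrite iterS E sqr_stretchZ.
Qed.

Lemma outer_square_ray : ray_closed (outer_square M).
Proof.
move=> u t; case: u => x y; rewrite /outer_square /= => Q t1.
rewrite !mul0r subr0 addr0 !normrM (ger0_norm (_ : 0 <= t)); last lra.
by case: Q => hQ; [left|right]; have := normr_ge0 x; have := normr_ge0 y; nra.
Qed.

Lemma square_level_ray n : ray_closed (Wn n).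
Proof.
move=> u t Wu t1; rewrite /square_level /=.
have [t' t'1 ->] := iter_sqr_stretchZ n u t1.
exact: outer_square_ray.
Qed.

Lemma square_level0 n : ~ Wn n 0.
Proof.
rewrite /square_level /= (_ : iter n H 0 = 0).
  by move=> /outer_square_nm; rewrite nm0 ltNge M0.
by elim: n => //= n ->; exact: sqr_stretch0.
Qed.

Lemma square_levelN n w : Wn n.+1 w -> Wn n.+1 (- w).
Proof. by rewrite !square_levelS sqr_stretchN. Qed.

(** * Enlarging the domain of the inverse by one level *)

Section Step.
Variables (n : nat) (Phi : R[i] -> R[i]).
Hypotheses (inv : inv_coord (Wn n) (Vn n) Phi) (ext : forall w, Wn 0 w -> Phi w = Phi0 w)
  (nc : ~ Vn n c).

Let ratio u := (Phi u - c) / u.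

Lemma inv_coord_neq w : Wn n w -> Phi w - c != 0.
Proof.
have [_ [inV _] _ _ _] := inv => /inV VPhi; rewrite subr_eq0; apply/eqP => E.
by apply: nc; rewrite -E.
Qed.

Lemma ratio_root : exists s, (forall u, Wn n u -> cts_at s u /\ s u ^+ 2 = ratio u) /\
    forall u, Wn n u -> exists2 T : R, 1 <= T &
      forall t, T <= t -> 0 < complex.Re (s (t%:C * u)).
Proof.
have [cPhi _ _ _ _] := inv.
have W0 u : Wn n u -> u != 0 by move=> Wu; apply/eqP => u0; apply: (@square_level0 n); rewrite -u0.
apply: (@ray_sqrt _ _ _ (2 * M)).
- exact: square_level_open.
- exact: square_level_ray.
- exact: square_level0.
- move=> u Wu; apply: cts_atM; last by apply: cts_atV; exact: W0.
  by apply: cts_atD; [exact: cPhi|exact: cts_at_cst].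
- by move=> u Wu; apply: mulf_neq0; [exact: inv_coord_neq|rewrite invr_eq0; exact: W0].
(* Beyond 2 M the point lies in the outer square, where [Phi] is within 1 of the identity, so |ratio
   - 1| <= (1 + |c|) / |u| < 1. *)
- move=> u Wu Mu; have W0u : Wn 0 u by exact: nm_outer_square.
  have u0 := W0 _ Wu.
  have -> : ratio u - 1 = (Phi0 u - u - c) / u by rewrite /ratio ext //; field.
  have nu : 0 < nm u by rewrite nm_gt0 W0.
  rewrite nmM nmV ltr_pdivrMr // mul1r; apply: (le_lt_trans (nmD _ _)); rewrite nmN.
  have := (M0, Mc) => -[? ?]; have := near0 W0u => ?; lra.
Qed.

Lemma inv_coord_step : exists Phi', inv_coord (Wn n.+1) (Vn n.+1) Phi' /\
  forall w, Wn n w -> Phi' w = Phi w.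
Proof.
have [s [sP sfar]] := ratio_root.
have [cPhi [inV surj] inj opn conj] := inv.
have N1 := distortion_ge1 K theta.
have WS w : Wn n w -> Wn n.+1 w by apply: square_level_mono.
pose Phi' w := h' (h w * s (H w)).
have hPhi' w : h (Phi' w) = h w * s (H w) by rewrite /Phi' stretchVK.
have E1 w : Wn n.+1 w -> f (Phi' w) = Phi (H w).
  move=> /square_levelS WH; have [_ sH] := sP _ WH.
  have H0 : H w != 0 by apply/eqP => E; apply: (@square_level0 n); rewrite -E.
  by rewrite /sqr_stretch_add /sqr_stretch hPhi' exprMn sH -/(H w) /ratio mulrC divfK // subrK.
have odd w : Phi' (- w) = - Phi' w.
  by rewrite /Phi' sqr_stretchN stretchN mulNr stretchN.
have cPhi' w : Wn n.+1 w -> cts_at Phi' w.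
  move=> /square_levelS WH; apply: cts_at_comp; last exact: stretch_cts.
  apply: cts_atM; first exact: stretch_cts.
  by apply: cts_at_comp (sP _ WH).1; exact: sqr_stretch_cts.
(* A zero would give Phi (H w) = f 0 = c, but level n misses c. *)
have Phi'0 w : Wn n.+1 w -> Phi' w != 0.
  move=> Ww; apply/eqP => E; have := E1 w Ww; rewrite E sqr_stretch_add0 => E'.
  move/square_levelS in Ww; have := inv_coord_neq Ww.
  by rewrite -E' subrr eqxx.
have agree w : Wn n w -> Phi' w = Phi w.
  move=> Ww; apply: (can_inj (stretchK theta (stretch_factor_neq0 hK))).
  (* Both functions are square roots of Phi (H u) - c, so they need to be compared at one remote
     point of each ray only. *)
  apply: (@ray_eq _ (Wn n) (h \o Phi') (h \o Phi)) Ww; first exact: square_level_ray.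
    move=> u Wu; have [WHu fu] := conj u Wu.
    have sq : h (Phi u) ^+ 2 = Phi (H u) - c by rewrite -fu /sqr_stretch_add addrK.
    split; [exact: cts_at_comp (cPhi' u (WS u Wu)) (@stretch_cts _ _ _ _)
      |exact: cts_at_comp (cPhi u Wu) (@stretch_cts _ _ _ _)| |].
      by rewrite -sqrf_eq0 /= sq inv_coord_neq.
    by rewrite /= sq -(E1 u (WS u Wu)) /sqr_stretch_add addrK.
  move=> u Wu; have u0 : 0 < nm u.
    by rewrite nm_gt0; apply/eqP => E; apply: (@square_level0 n); rewrite -E.
  have [WHu _] := conj u Wu; have [T T1 hT] := sfar _ WHu.
  (* T <= t^2 is needed because [H] multiplies the ray parameter by t^2. The second summand gives |t
     u| > 2 M + N^2, so that t u is in the outer square and |h (t u)| > N. *)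
  pose t := T + (2 * M + N ^+ 2) / nm u.
  have q0 : 0 <= (2 * M + N ^+ 2) / nm u.
    by rewrite divr_ge0 ?(ltW u0) // addr_ge0 ?sqr_ge0 // mulr_ge0.
  have t1 : 1 <= t by rewrite /t; lra.
  have tT : T <= t ^+ 2 by rewrite expr2 /t in t1 *; nra.
  have tu : 2 * M + N ^+ 2 < nm (t%:C * u).
    by rewrite nmZ /t ?mulrDl ?divfK ?gt_eqF //; [nra|rewrite -/t; lra].
  exists t => //=; set v := t%:C * u in tu *.
  have Wv : Wn n v by apply: square_level_ray.
  have W0v : Wn 0 v by apply: nm_outer_square; have := sqr_ge0 N; lra.
  have hv : nm v <= N * nm (h v) by exact: stretch_ge.
  have hvN : N < nm (h v).
    have mm := M0; have NN : 0 < N by lra.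
    by rewrite -(ltr_pM2l NN) -expr2; apply: lt_le_trans hv; lra.
  have hv0 : h v != 0 by rewrite -nm_gt0; lra.
  have [_ sHv] := sP _ (conj v Wv).1.
  have -> : h (Phi' v) = h v * s (H v) by [].
  have -> : h (Phi v) = h v * (h (Phi v) / h v) by rewrite mulrC divfK.
  congr (_ * _); apply: Re_root_eq.
  - rewrite sHv /ratio expr_div_n; congr (_ / _).
    by rewrite -(conj v Wv).2 /sqr_stretch_add addrK.
  - by rewrite /v sqr_stretchZ; apply: hT.
  - have : nm (h (Phi v) / h v - 1) < 1.
      rewrite (_ : _ - 1 = h (Phi v - v) / h v); last by rewrite stretchB; field.
      rewrite nmM nmV ltr_pdivrMr ?nm_gt0 // mul1r; apply: le_lt_trans hvN.
      apply: (le_trans (stretch_le _ _ _)); rewrite -[X in _ <= X]mulr1.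
      by apply: ler_wpM2l; [lra|rewrite ext //; exact: near0].
    move=> /(le_lt_trans (Re_le_nm _)); rewrite raddfB /= ltr_norml => /andP[? _].
    lra.
exists Phi'; split=> //; split.
- exact: cPhi'.
- split=> [w Ww|z /preimage_levelS Vz].
    by apply/preimage_levelS; rewrite E1 //; apply: inV; exact/square_levelS.
  (* A preimage w of u under [H] gives f z = f (Phi' w), hence z = Phi' w or z = - Phi' w = Phi' (-
     w). *)
  have [u Wu Phiu] := surj _ Vz.
  have [w [Hw _]] := sqr_stretch_lift theta hK 0 u.
  have Ww : Wn n.+1 w by apply/square_levelS; rewrite Hw.
  have E : f z = f (Phi' w) by rewrite E1 // Hw Phiu.
  have [->|->] := sqr_stretch_add_inj hK E; first by exists w.
  by exists (- w); [exact: square_levelN|rewrite odd].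
- move=> w w' Ww Ww' E.
  have : Phi (H w) = Phi (H w') by rewrite -!E1 // E.
  move/(inj _ _ (iffLR (square_levelS _ _) Ww) (iffLR (square_levelS _ _) Ww')).
  move/(sqr_stretch_inj hK) => [//|wE]; exfalso.
  move: E; rewrite wE odd => /eqP; rewrite eq_sym -subr_eq0 opprK.
  rewrite (_ : _ + _ = 2%:R * Phi' w') ?mulf_eq0 ?pnatr_eq0 ?(negbTE (Phi'0 _ Ww')) //.
  by ring.
- move=> w0 Ww0 e e0; set z0 := Phi' w0.
  have nz : 0 < nm z0 by rewrite nm_gt0 Phi'0.
  have nz2 : 0 < nm z0 / 2 by lra.
  have [d1 d10 D1] := cPhi' w0 Ww0 _ nz2.
  have e'0 : 0 < Num.min e d1 by rewrite lt_min e0.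
  have [d2 d20 D2] := @sqr_stretch_open R K theta hK w0 _ e'0.
  have WH := iffLR (square_levelS _ _) Ww0.
  have [d3 d30 D3] := opn _ WH _ d20.
  have [d4 d40 D4] := @sqr_stretch_add_cts _ K theta c z0 _ d30.
  exists (Num.min d4 (nm z0 / 2)); first by rewrite lt_min d40.
  move=> z; rewrite lt_min => /andP[/D4 h1 h2].
  rewrite E1 // in h1; have [u [Wu /D2[w ww0 Hw] Phiu]] := D3 _ h1.
  rewrite lt_min in ww0; have /andP[we /D1 wd] := ww0.
  have Ww : Wn n.+1 w by apply/square_levelS; rewrite Hw.
  exists w; split=> //.
  have E : f z = f (Phi' w) by rewrite E1 // Hw Phiu.
  (* z and Phi' w both lie within |z0| / 2 of z0, so they cannot be opposite. *)
  have [//|zE] := sqr_stretch_add_inj hK E; exfalso.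
  have := nmD (- (z - z0)) (- (Phi' w - z0)); rewrite !nmN.
  rewrite zE (_ : _ + _ = 2%:C * z0); last by rewrite rmorph_nat; ring.
  by rewrite zE in h2; rewrite nmZ //; lra.
- move=> w Ww; have WH := iffLR (square_levelS _ _) Ww.
  by split; [exact: WS|rewrite E1 // agree].
Qed.
End Step.

Lemma inv_coord_level n : (forall m, (m < n)%N -> ~ Vn m c) ->
  exists Phi, inv_coord (Wn n) (Vn n) Phi /\ forall w, Wn 0 w -> Phi w = Phi0 w.
Proof.
elim: n => [|n IH] nc; first by exists Phi0.
have [Phi [inv ext]] := IH (fun m mn => nc m (ltnW mn)).
have [Phi' [inv' ext']] := inv_coord_step inv ext (nc n (ltnSn n)).
by exists Phi'; split=> // w Ww; rewrite ext' ?ext //; apply: square_level_mono Ww.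
Qed.

Lemma inv_coord_union : (forall m, ~ Vn m c) ->
  exists Phi, inv_coord (\bigcup_n Wn n) (\bigcup_n Vn n) Phi /\
    forall w, Wn 0 w -> Phi w = Phi0 w.
Proof.
move=> nc.
pose P n Phi := inv_coord (Wn n) (Vn n) Phi /\ forall w, Wn 0 w -> Phi w = Phi0 w.
(* Choice runs over all pairs of a level and a map, with default [id] off [P], so that the sequence
   is defined by plain recursion and its properties are proved afterwards. *)
have /choice[S SP] : forall x : nat * (R[i] -> R[i]), exists Phi',
    P x.1 x.2 -> P x.1.+1 Phi' /\ forall w, Wn x.1 w -> Phi' w = x.2 w.
  move=> [n Phi]; have [[inv ext]|nP] := pselect (P n Phi); last by exists id.
  have [Phi' [inv' ext']] := inv_coord_step inv ext (nc n).
  exists Phi' => _; split=> //; split=> // w Ww.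
  by rewrite ext' ?ext //; apply: square_level_mono Ww.
pose F := fix F n := if n is n'.+1 then S (n', F n') else Phi0.
have FP n : P n (F n) by elim: n => [|n IH]; [split|exact: (SP (n, F n) IH).1].
have Fstep n w : Wn n w -> F n.+1 w = F n w by exact: (SP (n, F n) (FP n)).2.
have Fmono n m w : (n <= m)%N -> Wn n w -> F m w = F n w.
  move=> nm Ww; rewrite -(subnK nm); elim: (m - n)%N => [//|k IH].
  by rewrite addSn Fstep //; apply: square_level_mono Ww; rewrite leq_addl.
have Fsame n m w : Wn n w -> Wn m w -> F n w = F m w.
  by have [nm|/ltnW nm] := leqP n m => Wn_ Wm; [rewrite (Fmono n m)|rewrite (Fmono m n)].
have /choice[idx idxP] : forall w, exists n, (\bigcup_n Wn n) w -> Wn n w.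
  by move=> w; have [[n _ Ww]|?] := pselect ((\bigcup_n Wn n) w); [exists n|exists 0%N].
pose Phi w := F (idx w) w.
have PhiE n w : Wn n w -> Phi w = F n w.
  by move=> Ww; apply: Fsame => //; apply: idxP; exists n.
exists Phi; split; last by move=> w /PhiE ->.
split.
- move=> w [n _ Ww]; have [[cF _ _ _ _] _] := FP n.
  have [d d0 dW] := (open_nmP _).1 (@square_level_open n) w Ww.
  by apply: (cts_at_near d0 _ (cF w Ww)) => x /dW /PhiE.
- split=> [w [n _ Ww]|z [n _ Vz]].
    by rewrite (PhiE _ _ Ww); have [[_ [inV _] _ _ _] _] := FP n; exists n => //; exact: inV.
  have [[_ [_ sj] _ _ _] _] := FP n; have [w Ww Fw] := sj z Vz.
  by exists w; [exists n|rewrite (PhiE _ _ Ww)].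
- move=> w w' [n _ Ww] [m _ Ww'].
  have Wx : Wn (maxn n m) w by apply: square_level_mono Ww; exact: leq_maxl.
  have Wx' : Wn (maxn n m) w' by apply: square_level_mono Ww'; exact: leq_maxr.
  by rewrite (PhiE _ _ Wx) (PhiE _ _ Wx'); have [[_ _ ij _ _] _] := FP (maxn n m); exact: ij.
- move=> w [n _ Ww] e e0; rewrite (PhiE _ _ Ww); have [[_ _ _ op _] _] := FP n.
  have [d d0 D] := op w Ww e e0; exists d => // z /D[w' [Ww' h1 h2]].
  by exists w'; split=> //; [exists n|rewrite (PhiE _ _ Ww')].
- move=> w [n _ Ww]; have [[_ _ _ _ cj] _] := FP n; have [WH fw] := cj w Ww.
  by split; [exists n|rewrite (PhiE _ _ Ww) (PhiE _ _ WH)].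
Qed.
End InverseCoordinate.

(** * Second-order estimates near infinity *)

Section SmoothnessNearInfinity.
Variable R : realType.
Implicit Types (z w u v : R[i]).

(** The real inequality behind [step_increment]: P, n and X are the moduli of h z, h zeta and f z,
    xi that of the increment of f, ax and rho measure the linear part and the remainder of the
    increment dE of F - id, and D is the increment of the error e. The three summands contribute 1,
    4 and 9 times n^2; A and C disappear because P exceeds 6 A + 9 C. *)
Lemma second_order_core (A C P n X xi ax rho dE D : R) :
  0 <= A -> 0 <= C -> 0 <= n -> n <= P / 4 -> 4 + 6 * A + 9 * C <= P ->
  P * P / 2 <= X -> 0 <= xi -> xi <= 3 * (P * n) -> 0 <= ax -> ax * X <= A ->
  0 <= rho -> rho * (X * X) <= C * (xi * xi) -> dE <= ax * xi + rho -> 0 <= D ->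
  D * P <= dE + 2 * n ->
  (ax * (n * n) + rho + D * (2 * n + D)) * P <= 14 * (n * n).
Proof.
move=> A0 C0 n0 nP PAC XP xi0 xiP ax0 axX rho0 rhoX dEle D0 DP.
have P4 : 4 <= P by lra.
have s1 : ax * (P * P) <= 2 * A by nra.
have PP : 0 < P * P by nra.
have s2 : rho * (P * P) <= 36 * C * (n * n).
  have h1 : rho * ((P * P / 2) * (P * P / 2)) <= rho * (X * X).
    by apply: ler_wpM2l => //; apply: ler_pM => //; lra.
  have h2 : C * (xi * xi) <= C * ((3 * (P * n)) * (3 * (P * n))).
    by apply: ler_wpM2l => //; apply: ler_pM.
  have h3 : (rho * (P * P)) * (P * P) <= (36 * C * (n * n)) * (P * P) by lra.
  by rewrite ler_pM2r in h3.
have nn : n * n <= n * (P / 4) by apply: ler_wpM2l.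
have s3 : rho * P <= 9 * C * n.
  have h : (rho * P) * P <= (9 * C * n) * P.
    have : C * (n * n) <= C * (n * (P / 4)) by apply: ler_wpM2l.
    by lra.
  by rewrite ler_pM2r in h; lra.
have s4 : dE <= n.
  have h : dE * P <= n * P.
    have h1 : dE * P <= (ax * xi + rho) * P by apply: ler_wpM2r => //; lra.
    have h2 : ax * xi * P <= 3 * n * (ax * (P * P)).
      have : ax * P * xi <= ax * P * (3 * (P * n)) by apply: ler_wpM2l => //; apply: mulr_ge0; lra.
      by lra.
    have h3 : n * (ax * (P * P)) <= n * (2 * A) by apply: ler_wpM2l.
    have h4 : n * (4 + 6 * A + 9 * C) <= n * P by apply: ler_wpM2l.
    by lra.
  by rewrite ler_pM2r in h; lra.
have s5 : D * P <= 3 * n by lra.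
have Dn : D <= n by nra.
have s6 : D * (2 * n + D) * P <= 9 * (n * n).
  have : D * P * (2 * n + D) <= 3 * n * (3 * n) by apply: ler_pM; nra.
  by lra.
have s7 : ax * (n * n) * P <= n * n.
  have h : ax * (n * n) * P * P <= n * n * P.
    have : n * n * (ax * (P * P)) <= n * n * (2 * A) by apply: ler_wpM2l => //; nra.
    have : n * n * (2 * A) <= n * n * P by apply: ler_wpM2l => //; nra.
    by lra.
  by rewrite ler_pM2r in h; lra.
have s8 : rho * P <= 4 * (n * n).
  have h : rho * P * P <= 4 * (n * n) * P.
    have : n * n * (9 * C) <= n * n * P by apply: ler_wpM2l => //; nra.
    by lra.
  by rewrite ler_pM2r in h; lra.
by lra.
Qed.

(* Since |f x| is of the order of |x|^2, the weights 1/|x| and 1/|x|^2 on the first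
   and second differences of F - id absorb the distortion constants when this bound
   is passed from F to the branch of h^-1 (sqrt (F o f)). *)
Definition c11 (r A C : R) (F : R[i] -> R[i]) := forall x, r < nm x ->
  nm (F x - x) <= 1 /\ exists a b, nm a + nm b <= A / nm x /\
    forall xi, r < nm (x + xi) ->
      nm (F (x + xi) - (x + xi) - (F x - x) - (a * xi + b * xi^*%C))
        <= C * (nm xi / nm x) ^+ 2.

Variables (K theta : R) (hK : 0 < K) (c : R[i]).
Local Notation h := (stretch K theta).
Local Notation h' := (stretch K^-1 theta).
Local Notation N := (distortion K theta).
Local Notation f := (sqr_stretch_add K theta c).

(** The coefficients are at most 4 / |h z| in [step_increment]; conjugation by the stretch costs
    N^2, and |z| <= N |h z| one more N. *)
Definition lin_bound : R := 4 * N ^+ 3.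
(** In [c11_step] small increments need 14 N^5 and large ones 16 N^5 + 32 N^4. *)
Definition quad_bound : R := 30 * N ^+ 5 + 32 * N ^+ 4.
(** A lower bound for |h z|: 6 A + 9 C feeds [second_order_core], N (|c| + 1) makes the error of the
    root at most 1 / N, and 2 |c| yields |f z| >= |h z|^2 / 2. In [far_radius] the term 2 N^2 makes
    |f z| at least |z|. *)
Definition far_modulus : R :=
  5 + 6 * lin_bound + 9 * quad_bound + N * (nm c + 1) + 2 * nm c.
Definition far_radius : R := N * far_modulus + 2 * N ^+ 2.

Lemma lin_bound_ge0 : 0 <= lin_bound.
Proof. by rewrite /lin_bound mulr_ge0 // exprn_ge0 // ltW // distortion_gt0. Qed.
Lemma quad_bound_ge0 : 0 <= quad_bound.
Proof. by rewrite /quad_bound addr_ge0 // mulr_ge0 // exprn_ge0 // ltW // distortion_gt0. Qed.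

Lemma far_radius_ge : far_radius >= 5 /\ far_radius >= N * (nm c + 1).
Proof.
have N1 := distortion_ge1 K theta; have c0 := nm_ge0 c.
have A0 := lin_bound_ge0; have C0 := quad_bound_ge0.
have NP : far_modulus <= N * far_modulus.
  rewrite ler_peMl // /far_modulus; nra.
have N2 : 0 <= N ^+ 2 by exact: sqr_ge0.
by rewrite /far_radius /far_modulus in NP *; split; nra.
Qed.

Lemma far_modulus_le (r : R) z : far_radius <= r -> r < nm z ->
  far_modulus < nm (h z) /\ nm (h z) * nm (h z) / 2 <= nm (f z) /\ r < nm (f z).
Proof.
move=> rr rz; have N1 := distortion_ge1 K theta; have c0 := nm_ge0 c.
have A0 := lin_bound_ge0; have C0 := quad_bound_ge0.
have Pz : nm z <= N * nm (h z) by exact: stretch_ge.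
have FM : 5 + 2 * nm c <= far_modulus by rewrite /far_modulus; nra.
have P0 : far_modulus < nm (h z).
  have N2 : 0 <= N ^+ 2 by exact: sqr_ge0.
  rewrite -(ltr_pM2l (_ : 0 < N)); last lra.
  by apply: lt_le_trans Pz; rewrite /far_radius in rr; lra.
split=> //.
have X : nm (h z) * nm (h z) / 2 <= nm (f z).
  have := nmBD (h z ^+ 2) c; rewrite nmX expr2 -[h z ^+ 2 + c]/(f z) => X.
  by nra.
split=> //; apply: (lt_le_trans rz); apply: le_trans X.
have zz : nm z * nm z <= (N * nm (h z)) * (N * nm (h z)) by apply: ler_pM => //; exact: nm_ge0.
have z2 : 2 * (N * N) * nm z <= nm z * nm z.
  apply: ler_wpM2r; first exact: nm_ge0.
  have NP : 0 <= N * far_modulus by apply: mulr_ge0; lra.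
  by move: rr; rewrite /far_radius -expr2; lra.
have NN : 0 < N * N by nra.
rewrite -(ler_pM2l NN); lra.
Qed.

(** A real linear map is measured by the sum of the moduli of its two coefficients; composing with h
    and with h^-1 costs a factor N each. *)
Lemma lin_conj_stretch l m z :
  exists a b, nm a + nm b <= N ^+ 2 * (nm l + nm m) /\
    forall zeta, h' (l * h zeta + m * (h zeta)^*%C) = a * zeta + b * zeta^*%C.
Proof.
pose s := stretch_coef1 K; pose t := stretch_coef2 K theta.
pose s' := stretch_coef1 K^-1; pose t' := stretch_coef2 K^-1 theta.
have sc : s^*%C = s by exact: conjc_real.
pose P := l * s + m * t^*%C; pose Q := l * t + m * s.
exists (s' * P + t' * Q^*%C), (s' * Q + t' * P^*%C); split; last first.
  move=> zeta; rewrite 2!stretchE -/s -/t -/s' -/t' /P /Q.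
  by rewrite !(conjD, conjM) !conjcK !sc; ring.
have hP : nm P <= nm l * nm s + nm m * nm t by rewrite -(nm_conj t) -!nmM; exact: nmD.
have hQ : nm Q <= nm l * nm t + nm m * nm s by rewrite -!nmM; exact: nmD.
have h1 : nm (s' * P + t' * Q^*%C) <= nm s' * nm P + nm t' * nm Q.
  by rewrite -(nm_conj Q) -!nmM; exact: nmD.
have h2 : nm (s' * Q + t' * P^*%C) <= nm s' * nm Q + nm t' * nm P.
  by rewrite -(nm_conj P) -!nmM; exact: nmD.
have NE : nm s + nm t <= N by exact: stretch_coef_le.
have NE' : nm s' + nm t' <= N by rewrite -distortionV; exact: stretch_coef_le.
have := (nm_ge0 s, nm_ge0 t, nm_ge0 s', nm_ge0 t') => -[[[s0 t0] s'0] t'0].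
have := (nm_ge0 P, nm_ge0 Q, nm_ge0 l, nm_ge0 m) => -[[[p0 q0] l0] m0].
have PQ : nm P + nm Q <= N * (nm l + nm m).
  apply: le_trans (_ : (nm s + nm t) * (nm l + nm m) <= _); first by lra.
  by apply: ler_wpM2r => //; lra.
apply: le_trans (_ : (nm s' + nm t') * (nm P + nm Q) <= _); first by lra.
by rewrite expr2 -mulrA; apply: ler_pM => //; lra.
Qed.
End SmoothnessNearInfinity.

(** * Passing the second-order bound from one branch to the next *)

Section SmoothnessStep.
Variable R : realType.
Implicit Types (z w u v : R[i]).
Variables (K theta : R) (hK : 0 < K) (c : R[i]).
Local Notation h := (stretch K theta).
Local Notation h' := (stretch K^-1 theta).
Local Notation N := (distortion K theta).
Local Notation f := (sqr_stretch_add K theta c).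
Local Notation A := (lin_bound K theta).
Local Notation C := (quad_bound K theta).

Section Step.
Variables (r : R) (F F' : R[i] -> R[i]).
Hypotheses (rr : far_radius K theta c <= r) (F_c11 : c11 r A C F)
  (root : forall z, r < nm z -> h (F' z) ^+ 2 = F (f z) /\
                    nm (h (F' z) - h z) <= nm (h (F' z) + h z)).

Let e z := h (F' z) - h z.

(** The squares of h (F' z) and h z differ by F (f z) - f z + c, of modulus at most 1 + |c|.
    Dividing by |h z| >= N (1 + |c|) bounds e z by 1 / N, and applying h^-1 costs this factor N. *)
Lemma step_error z : r < nm z ->
  [/\ nm (e z) <= 1, nm (F' z - z) <= 1, h (F' z) = h z + e z
    & nm (h z) - 1 <= nm (h (F' z))].
Proof.
move=> rz; have [P0 [XP fz]] := far_modulus_le hK rr rz.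
have N1 := distortion_ge1 K theta; have c0 := nm_ge0 c.
have A0 := lin_bound_ge0 K theta; have C0 := quad_bound_ge0 K theta.
have P1 : N * (nm c + 1) + 5 <= nm (h z) by rewrite /far_modulus in P0; lra.
have [sq le] := root rz.
have E : h (F' z) ^+ 2 - (h z) ^+ 2 = (F (f z) - f z) + c.
  by rewrite sq /sqr_stretch_add /sqr_stretch; ring.
have nE : nm (h (F' z) ^+ 2 - (h z) ^+ 2) <= 1 + nm c.
  by rewrite E; apply: (le_trans (nmD _ _)); rewrite lerD2r; have [] := F_c11 fz.
have Pgt : 0 < nm (h z) by nra.
have hz0 : h z != 0 by rewrite -nm_gt0.
have re := root_close (erefl (h (F' z) ^+ 2)) (erefl (h z ^+ 2)) hz0 le.
have Ne : N * nm (e z) <= 1.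
  rewrite ler_pdivlMr // in re.
  rewrite -(ler_pM2r Pgt) mul1r; apply: le_trans (_ : N * (1 + nm c) <= _); last by lra.
  by rewrite -mulrA; apply: ler_wpM2l; [lra|exact: le_trans re nE].
have e1 : nm (e z) <= 1 by have := nm_ge0 (e z); nra.
have hE : h (F' z) = h z + e z by rewrite /e; ring.
split=> //.
  apply: le_trans Ne; rewrite /e -stretchB; exact: stretch_ge.
by rewrite hE; have := nmBD (h z) (e z); lra.
Qed.

(* With eta = h zeta, D = e (z + zeta) - e z and dE the increment of F - id between
   f z and f (z + zeta), subtracting the squared equations gives
   D (2 h z + 2 eta + e z + e (z + zeta)) = dE - 2 (e z) eta, whose linear part in
   eta is read off at the denominator 2 h (F' z). *)
Lemma step_increment z : r < nm z ->
  exists a b, nm a + nm b <= 4 / nm (h z) /\ forall zeta, r < nm (z + zeta) ->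
    nm (h zeta) <= nm (h z) / 4 ->
    nm (e (z + zeta) - e z - (a * h zeta + b * (h zeta)^*%C))
      <= 14 * (nm (h zeta) / nm (h z)) ^+ 2.
Proof.
move=> rz; have [P0 [XP fz]] := far_modulus_le hK rr rz.
have N1 := distortion_ge1 K theta; have c0 := nm_ge0 c.
have A0 := lin_bound_ge0 K theta; have C0 := quad_bound_ge0 K theta.
have [e1 _ hE pge] := step_error rz.
set P := nm (h z) in XP P0 pge *; set p := h (F' z) in hE pge.
have P1 : 5 + 6 * A + 9 * C <= P by rewrite /far_modulus in P0; nra.
have Pgt : 0 < P by lra.
have [_ [al [be [ab_le Hxi]]]] := F_c11 fz.
set X := nm (f z) in XP fz ab_le Hxi.
have Xgt : 0 < X by nra.
have ax0 : 0 <= nm al + nm be by rewrite addr_ge0 ?nm_ge0.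
have axX : (nm al + nm be) * X <= A by rewrite -ler_pdivlMr.
have pgt : 0 < nm p by lra.
have p0 : p != 0 by rewrite -nm_gt0.
have axP : (nm al + nm be) * P <= 1.
  have h1 : (nm al + nm be) * (P * P) <= 2 * A by nra.
  have h2 : (nm al + nm be) * P * P <= 1 * P by lra.
  by rewrite ler_pM2r in h2.
pose l := (al * h z - e z) / p; pose m := be * (h z)^*%C / p.
exists l, m; split.
  have l1 : nm l <= (nm al * P + 1) / nm p.
    rewrite /l nmM nmV ler_pM2r ?invr_gt0 //; apply: (le_trans (nmD _ _)).
    by rewrite nmN nmM lerD2l.
  have m1 : nm m = nm be * P / nm p by rewrite /m !nmM nmV nm_conj.
  have : nm l + nm m <= (nm al * P + 1) / nm p + nm be * P / nm p by rewrite m1 lerD2r.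
  move=> h1; apply: (le_trans h1); rewrite -mulrDl ler_pdivrMr // mulrAC ler_pdivlMr //.
  by have := ax0; nra.
move=> zt rzt nP4; set eta := h zt in nP4 *; set n := nm eta in nP4 *.
have n0 : 0 <= n by exact: nm_ge0.
have [e1' _ hE' _] := step_error rzt.
have [sq _] := root rz; have [sq' _] := root rzt.
pose xi := 2%:R * h z * eta + eta ^+ 2.
have fxi : f (z + zt) = f z + xi.
  by rewrite /sqr_stretch_add /sqr_stretch stretchD -/eta /xi; ring.
have [_ [_ fzt]] := far_modulus_le hK rr rzt.
pose D := e (z + zt) - e z.
pose dE := F (f (z + zt)) - f (z + zt) - (F (f z) - f z).
pose rho := dE - (al * xi + be * xi^*%C).
have Hrho : nm rho <= C * (nm xi / X) ^+ 2.
  by rewrite /rho /dE fxi; apply: Hxi; rewrite -fxi.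
have id1 : D * (2%:R * h z + 2%:R * eta + e z + e (z + zt)) = dE - 2%:R * e z * eta.
  by rewrite /D /dE -sq -sq' hE' -/p hE fxi stretchD -/eta /xi; ring.
(* As e (z + zt) = e z + D, the factor of D in [id1] is 2 p + 2 eta + D; l and m are chosen to
   cancel the terms linear in eta and its conjugate, so only second-order ones remain. *)
have id2 : 2%:R * p * (D - (l * eta + m * eta^*%C)) =
    al * eta ^+ 2 + be * (eta ^+ 2)^*%C + rho - D * (2%:R * eta + D).
  rewrite mulrBr.
  have -> : 2%:R * p * (l * eta + m * eta^*%C) =
      2%:R * (al * h z - e z) * eta + 2%:R * be * (h z)^*%C * eta^*%C.
    by rewrite /l /m; field.
  have -> : 2%:R * p * D = D * (2%:R * h z + 2%:R * eta + e z + e (z + zt)) - D * (2%:R * eta + D).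
    by rewrite hE /D; ring.
  have xiC : xi^*%C = 2%:R * (h z)^*%C * eta^*%C + eta^*%C * eta^*%C.
    rewrite /xi conjD !conjM; congr (_ * _ * _ + _).
    exact: conjc_nat.
  have eta2C : (eta ^+ 2)^*%C = eta^*%C * eta^*%C by rewrite expr2 conjM.
  by rewrite id1 /rho xiC eta2C /xi; ring.
have n2 (x : R[i]) : nm (2%:R * x) = 2 * nm x.
  by rewrite -(rmorph_nat (real_complex R)) nmZ.
have nxi : nm xi <= 3 * (P * n).
  apply: (le_trans (nmD _ _)); rewrite nmX -mulrA n2 nmM -/P -/n expr2.
  have : n * n <= n * (P / 4) by apply: ler_wpM2l.
  by nra.
have nrho0 := nm_ge0 rho; have nxi0 := nm_ge0 xi; have nD0 := nm_ge0 D.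
have rhoX : nm rho * (X * X) <= C * (nm xi * nm xi).
  have XX : 0 < X * X by apply: mulr_gt0.
  rewrite -ler_pdivlMr //; apply: (le_trans Hrho).
  by rewrite expr_div_n -!expr2 mulrA.
have ndE : nm dE <= (nm al + nm be) * nm xi + nm rho.
  have -> : dE = al * xi + be * xi^*%C + rho by rewrite /rho; ring.
  apply: (le_trans (nmD _ _)); rewrite lerD2r; apply: (le_trans (nmD _ _)).
  by rewrite !nmM nm_conj mulrDl.
have DP : nm D * P <= nm dE + 2 * n.
  apply: le_trans (_ : nm (dE - 2%:R * e z * eta) <= _); last first.
    apply: (le_trans (nmD _ _)); rewrite nmN -mulrA n2 nmM -/n lerD2l.
    by have := ler_wpM2r n0 e1; lra.
  rewrite -id1 nmM; apply: ler_wpM2l => //.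
  have -> : 2%:R * h z + 2%:R * eta + e z + e (z + zt) =
    2%:R * h z + (2%:R * eta + e z + e (z + zt)) by ring.
  apply: le_trans (nmBD _ _); rewrite n2 -/P.
  have : nm (2%:R * eta + e z + e (z + zt)) <= 2 * n + 1 + 1.
    apply: (le_trans (nmD _ _)); apply: lerD => //.
    by apply: (le_trans (nmD _ _)); apply: lerD => //; rewrite n2.
  by lra.
have P1' : 4 + 6 * A + 9 * C <= P by lra.
have core := second_order_core A0 C0 n0 nP4 P1' XP nxi0 nxi ax0 axX nrho0 rhoX ndE nD0 DP.
have fin : nm (2%:R * p * (D - (l * eta + m * eta^*%C))) * P <= 14 * (n * n).
  apply: le_trans core; apply: ler_wpM2r; first by lra.
  rewrite id2; apply: (le_trans (nmD _ _)); rewrite nmN.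
  apply: lerD.
    apply: (le_trans (nmD _ _)); rewrite lerD2r; apply: (le_trans (nmD _ _)).
    by rewrite !nmM nm_conj !nmX -/n mulrDl expr2.
  rewrite nmM; apply: ler_wpM2l => //; apply: (le_trans (nmD _ _)).
  by rewrite n2.
rewrite -mulrA n2 nmM in fin; rewrite expr_div_n mulrA ler_pdivlMr ?exprn_gt0 //.
rewrite -/D; set Y := nm (D - _) in fin *; have Y0 : 0 <= Y by exact: nm_ge0.
rewrite !expr2; apply: le_trans fin.
have : Y * P * P <= Y * P * (2 * nm p) by apply: ler_wpM2l; [exact: mulr_ge0 (ltW Pgt)|lra].
by lra.
Qed.

(** The bounds of [step_increment] no longer contain A and C, so F' satisfies the estimate with the
    same constants; this is what makes it uniform over all branches. *)
Lemma c11_step : c11 r A C F'.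
Proof.
move=> z rz; have N1 := distortion_ge1 K theta.
have A0 := lin_bound_ge0 K theta; have C0 := quad_bound_ge0 K theta.
have [e1 F1 hE _] := step_error rz; split=> //.
have z5 : 5 < nm z by have [? _] := far_radius_ge K theta c; have rr' := rr; lra.
have [l [m [lm H]]] := step_increment rz.
have [a [b [ab E]]] := lin_conj_stretch K theta l m z.
have hz : nm z <= N * nm (h z) by exact: stretch_ge.
have zgt : 0 < nm z by lra.
have hzgt : 0 < nm (h z) by nra.
have abA : nm a + nm b <= A / nm z.
  apply: (le_trans ab); rewrite ler_pdivlMr //.
  apply: le_trans (_ : N ^+ 2 * (4 / nm (h z)) * nm z <= _).
    by apply: ler_wpM2r; [lra|apply: ler_wpM2l; [exact: sqr_ge0|]].
  rewrite mulrA mulrAC ler_pdivrMr // /lin_bound exprS.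
  have : N ^+ 2 * nm z <= N ^+ 2 * (N * nm (h z)) by apply: ler_wpM2l; [exact: sqr_ge0|].
  by lra.
exists a, b; split=> // zt rzt.
have [_ F1' _ _] := step_error rzt.
have q0 : 0 <= nm zt / nm z by rewrite divr_ge0 ?nm_ge0.
have zq : nm zt = nm zt / nm z * nm z by rewrite divfK // gt_eqF.
set q := nm zt / nm z in q0 zq *.
have N4 : 1 <= N ^+ 4 by exact: exprn_ege1.
have N2 : 1 <= N ^+ 2 by exact: exprn_ege1.
(* [step_increment] covers small increments only. For large ones q is bounded below, so the crude
   bound 2 + A q is already of order q^2. *)
have [small|/ltW large] := leP (nm (h zt)) (nm (h z) / 4).
  have := H zt rzt small.
  set d := e (z + zt) - e z - _ => Hd.
  have -> : F' (z + zt) - (z + zt) - (F' z - z) - (a * zt + b * zt^*%C) = h' d.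
    have he w : h' (e w) = F' w - w by rewrite /e -stretchB (stretchK theta (stretch_factor_neq0 hK)).
    by rewrite /d (stretchB _ _ (_ - _)) (stretchB _ _ (e _)) !he E.
  apply: (le_trans (stretchV_le _ _ _)).
  have hq : nm (h zt) / nm (h z) <= N * N * q.
    rewrite ler_pdivrMr //; apply: (le_trans (stretch_le _ _ _)); rewrite zq.
    have : N * q * nm z <= N * q * (N * nm (h z)) by apply: ler_wpM2l => //; apply: mulr_ge0; lra.
    by lra.
  have hq0 : 0 <= nm (h zt) / nm (h z) by rewrite divr_ge0 ?nm_ge0.
  apply: le_trans (_ : N * (14 * (N * N * q) ^+ 2) <= _).
    apply: ler_wpM2l; first lra; apply: (le_trans Hd); apply: ler_wpM2l; first lra.
    by rewrite ler_pXn2r ?nnegrE //; apply: le_trans hq.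
  rewrite /quad_bound (_ : N * _ = 14 * N ^+ 5 * q ^+ 2); last by ring.
  have N5 : 1 <= N ^+ 5 by exact: exprn_ege1.
  by apply: ler_wpM2r; [exact: sqr_ge0|lra].
have qge : 1 <= 4 * N ^+ 2 * q.
  rewrite -(ler_pM2r zgt) -[_ * q * _]mulrA -zq mul1r.
  have := stretch_le K theta zt => h1; rewrite expr2.
  have h2 : N * (nm (h z) / 4) <= N * (N * nm zt) by apply: ler_wpM2l; lra.
  by lra.
have tri : nm (F' (z + zt) - (z + zt) - (F' z - z) - (a * zt + b * zt^*%C)) <= 2 + A * q.
  apply: (le_trans (nmD _ _)); rewrite nmN; apply: lerD.
    by apply: (le_trans (nmD _ _)); rewrite nmN; lra.
  apply: (le_trans (nmD _ _)); rewrite !nmM nm_conj -mulrDl.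
  apply: le_trans (ler_wpM2r (nm_ge0 zt) abA) _.
  by rewrite /q -mulrA [_^-1 * _]mulrC.
apply: (le_trans tri).
have q2 : q <= 4 * N ^+ 2 * (q * q) by have := ler_wpM2r q0 qge; lra.
have q4 : 1 <= 16 * N ^+ 4 * (q * q).
  have -> : 16 * N ^+ 4 * (q * q) = (4 * N ^+ 2 * q) * (4 * N ^+ 2 * q) by ring.
  by rewrite -[X in X <= _]mulr1; apply: ler_pM.
have Aq : A * q <= A * (4 * N ^+ 2 * (q * q)) by apply: ler_wpM2l.
have -> : C * q ^+ 2 = 30 * N ^+ 5 * (q * q) + 32 * N ^+ 4 * (q * q) by rewrite /quad_bound; ring.
have E5 : A * (4 * N ^+ 2 * (q * q)) = 16 * N ^+ 5 * (q * q) by rewrite /lin_bound; ring.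
have N50 : 0 <= N ^+ 5 * (q * q) by apply: mulr_ge0; [apply: exprn_ge0; lra|exact: mulr_ge0].
by lra.
Qed.
End Step.
End SmoothnessStep.

(** * Limits and consequences of the second-order bound *)

Section NearInfinity.
Variable R : realType.
Implicit Types (z w u v : R[i]) (F G : R[i] -> R[i]).

(** The functions Re F and |Re F| have equal squares, so [sign_segment] applies to them. *)
Lemma Re_gt0_segment F p q :
  (forall t : R, 0 <= t <= 1 -> let z := p + t%:C * (q - p) in
     cts_at F z /\ complex.Re (F z) != 0) ->
  0 < complex.Re (F p) -> 0 < complex.Re (F q).
Proof.
move=> cF Fp.
have E : (complex.Re (F q))%:C = (`|complex.Re (F q)|)%:C :> R[i].
  apply: (@sign_segment _ (fun z => (complex.Re (F z))%:C) (fun z => (`|complex.Re (F z)|)%:C) p q).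
    move=> t tI z; have [cFz nFz] := cF t tI; split.
    - move=> e /cFz[d d0 dF]; exists d => // w /dF; apply: le_lt_trans.
      by rewrite -rmorphB nm_real -raddfB; exact: Re_le_nm.
    - move=> e /cFz[d d0 dF]; exists d => // w /dF; apply: le_lt_trans.
      rewrite -rmorphB nm_real.
      by apply: le_trans (Re_le_nm _); rewrite raddfB; exact: ler_dist_dist.
    - by rewrite -nm_gt0 nm_real normr_gt0 normr_eq0.
    - by rewrite -!rmorphXn real_normK ?num_real.
  by rewrite ger0_norm // ltW.
have [_ n1] := cF 1 (introT andP (conj ler01 (lexx _))).
rewrite mul1r addrC subrK in n1.
by rewrite (complexI E) normr_gt0.
Qed.

Lemma Re_gt0_near1 u : nm (u - 1) < 1 -> 0 < complex.Re u.
Proof.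
move=> /(le_lt_trans (Re_le_nm _)); rewrite raddfB /= ltr_norml => /andP[? _]; lra.
Qed.

Lemma Re_ge0_closer u : 0 <= complex.Re u -> nm (u - 1) <= nm (u + 1).
Proof.
move=> u0; rewrite -(ler_pXn2r (n := 2)) ?nnegrE ?nm_ge0 // !nm_sqr.
by case: u u0 => x y /= x0; rewrite !(subr0, addr0); nra.
Qed.

(** The coefficients along the sequence need not converge, but they are bounded by A / |z|; a
    cluster point of them serves the limit. *)
Lemma c11_limit (r A C : R) (Fs : nat -> R[i] -> R[i]) F : 0 <= A -> 1 <= r ->
  (forall n, c11 r A C (Fs n)) ->
  (forall z, r < nm z -> forall e : R, 0 < e ->
     exists n0, forall n, (n0 <= n)%N -> nm (Fs n z - F z) < e) ->
  c11 r A C F.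
Proof.
move=> A0 r1 cFs lim z rz; split.
  rewrite leNgt; apply/negP => h; have e0 : 0 < nm (F z - z) - 1 by rewrite subr_gt0.
  have [n0 /(_ n0 (leqnn _)) Hn] := lim z rz _ e0.
  have [Fn _] := cFs n0 z rz.
  have := nmD (Fs n0 z - z) (- (Fs n0 z - F z)); rewrite nmN.
  by rewrite (_ : _ + _ = F z - z); [lra|ring].
have nz : 1 < nm z by lra.
have /choice[ab abP] : forall n, exists p : R[i] * R[i], nm p.1 + nm p.2 <= A / nm z /\
    forall xi, r < nm (z + xi) ->
      nm (Fs n (z + xi) - (z + xi) - (Fs n z - z) - (p.1 * xi + p.2 * xi^*%C))
        <= C * (nm xi / nm z) ^+ 2.
  by move=> n; have [_ [a [b H]]] := cFs n z rz; exists (a, b).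
pose B : set R[i] := [set w | nm w <= A / nm z].
have cB : compact B.
  apply: (@closed_bounded_compact _ _ (A / nm z)) => // ; apply/closed_nmP => w /negP.
  rewrite -ltNge => h; exists (nm w - A / nm z); first by rewrite subr_gt0.
  move=> x xw; rewrite /B /= => h'; have := nmBB w x; rewrite nmB; lra.
have AB n : (B `*` B) (ab n).
  have [h _] := abP n; have := nm_ge0 (ab n).1; have := nm_ge0 (ab n).2.
  by split; rewrite /B /=; lra.
have FK : (ab @ \oo) (B `*` B) by exists 0%N => // n _; exact: AB.
have [[a b] [_ clu]] := compact_setX cB cB (fmap_proper_filter ab _) FK.
have approx (e : R) n0 : 0 < e -> exists2 n, (n0 <= n)%N &
    nm ((ab n).1 - a) < e /\ nm ((ab n).2 - b) < e.
  move=> e0.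
  have h1 : (ab @ \oo) [set p | exists2 n, (n0 <= n)%N & p = ab n].
    by exists n0 => // n /= n0n; exists n.
  have h2 : nbhs (a, b) [set p : R[i] * R[i] | nm (p.1 - a) < e /\ nm (p.2 - b) < e].
    exists ([set w | nm (w - a) < e], [set w | nm (w - b) < e]); last by move=> p [].
    by split; apply/nbhs_nmP; exists e.
  by have [_ [[n n0n ->] h]] := clu _ _ h1 h2; exists n.
exists a, b; split.
  rewrite leNgt; apply/negP => h.
  pose e := (nm a + nm b - A / nm z) / 2; have e0 : 0 < e by rewrite /e; lra.
  have [n _ [h1 h2]] := approx e 0%N e0; have [h3 _] := abP n.
  have := nmBB a (a - (ab n).1); have := nmBB b (b - (ab n).2).
  rewrite (_ : b - (b - _) = (ab n).2); last by ring.
  rewrite (_ : a - (a - _) = (ab n).1); last by ring.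
  by rewrite nmB; rewrite nmB in h2; rewrite [nm (a - _)]nmB; rewrite nmB in h2; rewrite /e in h1 h2; lra.
move=> xi rxi; rewrite leNgt; apply/negP; set T := F _ - _ - _ - _ => h.
have N0 := nm_ge0 xi.
pose gap := nm T - C * (nm xi / nm z) ^+ 2.
have gap0 : 0 < gap by rewrite /gap subr_gt0.
(* The four errors then add up to at most 2 e (1 + |xi|) = gap / 2. *)
pose e := gap / (4 * (1 + nm xi)).
have e0 : 0 < e by rewrite /e divr_gt0 // mulr_gt0 //; lra.
have eE : e * (1 + nm xi) = gap / 4 by rewrite /e; field; lra.
have [n1 H1] := lim _ rz _ e0; have [n2 H2] := lim _ rxi _ e0.
have [n nn [ha hb]] := approx e (maxn n1 n2) e0.
have {}H1 := H1 n (leq_trans (leq_maxl _ _) nn).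
have {}H2 := H2 n (leq_trans (leq_maxr _ _) nn).
have [_ /(_ xi rxi)] := abP n; set Tn := Fs _ _ - _ - _ - _ => HT.
have TE : T = Tn - (Fs n (z + xi) - F (z + xi)) + (Fs n z - F z)
    + (((ab n).1 - a) * xi + ((ab n).2 - b) * xi^*%C) by rewrite /T /Tn; ring.
have : nm T <= nm Tn + nm (Fs n (z + xi) - F (z + xi)) + nm (Fs n z - F z)
    + (nm ((ab n).1 - a) * nm xi + nm ((ab n).2 - b) * nm xi).
  rewrite TE; apply: (le_trans (nmD _ _)); apply: lerD.
    apply: (le_trans (nmD _ _)); rewrite lerD2r; apply: (le_trans (nmD _ _)).
    by rewrite nmN.
  by apply: (le_trans (nmD _ _)); rewrite !nmM nm_conj.
have := ler_wpM2r N0 (ltW ha); have := ler_wpM2r N0 (ltW hb).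
by rewrite /gap in eE gap0; nra.
Qed.

(** Comparing the expansions at z and at a nearby x bounds the change of the coefficients linearly
    in |x - z|, so the expansion at x may be rewritten with the coefficients at z. The Jacobian is
    positive because |a| + |b| <= A / |z| < 1. *)
Lemma c11_orient_diff (r A C : R) F : 0 <= A -> 0 <= C -> 1 <= r -> A <= r ->
  c11 r A C F -> forall z, r < nm z -> orient_diff F z.
Proof.
move=> A0 C0 r1 Ar cF z rz.
have /choice[ab abP] : forall x, exists p : R[i] * R[i], r < nm x ->
    nm p.1 + nm p.2 <= A / nm x /\ forall xi, r < nm (x + xi) ->
      nm (F (x + xi) - (x + xi) - (F x - x) - (p.1 * xi + p.2 * xi^*%C)) <= C * nm xi ^+ 2.
  move=> x; have [rx|nrx] := boolP (r < nm x); last by exists (0, 0).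
  have [_ [a [b [h H]]]] := cF x rx; exists (a, b) => _; split=> // xi /H h1.
  apply: (le_trans h1); apply: ler_wpM2l => //.
  rewrite ler_pXn2r ?nnegrE ?divr_ge0 ?nm_ge0 // ler_pdivrMr; last lra.
  by rewrite -[X in X <= _]mulr1; apply: ler_wpM2l; [exact: nm_ge0|lra].
have [ab1 Hz] := abP z rz.
set a := (ab z).1 in ab1 Hz; set b := (ab z).2 in ab1 Hz.
exists (1 + a), b; split.
  have : A / nm z < 1 by rewrite ltr_pdivrMr; lra.
  by have := nmBD 1 a; rewrite nm1; lra.
(* With |x - z| < d and |v| <= 2 d the final error is at most 8 C d |v|. *)
move=> e e0; pose d := Num.min ((nm z - r) / 3) (e / (8 * (C + 1))).
have C8 : 0 < 8 * (C + 1) by lra.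
have d0 : 0 < d by rewrite lt_min; apply/andP; split; [lra|exact: divr_gt0].
have d1 : d <= (nm z - r) / 3 by rewrite ge_min lexx.
have d2 : d * (8 * (C + 1)) <= e by rewrite -ler_pdivlMr // ge_min lexx orbT.
exists d => // y x yd xd; set v := y - x.
have near w : nm (w - z) < 3 * d -> r < nm w.
  by move=> wz; have := nmBB z (z - w); rewrite nmB in wz; rewrite (_ : z - (z - w) = w); [lra|ring].
have rx : r < nm x by apply: near; lra.
have [_ Hx] := abP x rx; set al := (ab x).1 - a; set be := (ab x).2 - b.
(* The expansion at x and the two at z contribute C, C and 4 C times |x - z|^2. *)
have tri v' : nm v' = nm (x - z) -> nm (al * v' + be * v'^*%C) <= 6 * C * nm (x - z) ^+ 2.
  move=> nv'.
  have r1' : r < nm (x + v').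
    apply: near; rewrite (_ : _ - z = v' + (x - z)); last by ring.
    by apply: (le_lt_trans (nmD _ _)); rewrite nv'; lra.
  have h1 := Hx v' r1'.
  have zx : z + (x - z) = x by ring.
  have zxv : z + (x + v' - z) = x + v' by ring.
  have h2 := Hz (x - z); rewrite zx in h2; have {}h2 := h2 rx.
  have h3 := Hz (x + v' - z); rewrite zxv in h3; have {}h3 := h3 r1'.
  have n3 : C * nm (x + v' - z) ^+ 2 <= C * (4 * nm (x - z) ^+ 2).
    apply: ler_wpM2l => //; have : nm (x + v' - z) <= 2 * nm (x - z).
      rewrite (_ : _ - z = v' + (x - z)); last by ring.
      by apply: (le_trans (nmD _ _)); rewrite nv'; lra.
    have := nm_ge0 (x + v' - z); rewrite !expr2; nra.
  rewrite nv' in h1.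
  set X1 := F (x + v') - _ - _ - _ in h1; set X2 := F x - _ - _ - _ in h2.
  set X3 := F (x + v') - _ - _ - _ in h3.
  rewrite (_ : al * v' + be * v'^*%C = X3 - X2 - X1); last first.
    by rewrite /X1 /X2 /X3 /al /be !(conjB, conjD); ring.
  apply: (le_trans (nmD _ _)); rewrite nmN; apply: (le_trans (lerD (nmD _ _) (lexx _))).
  rewrite nmN; lra.
(* Real homogeneity transfers the bound from vectors of length |x - z| to all v. *)
have lin : nm (al * v + be * v^*%C) <= 6 * C * nm (x - z) * nm v.
  have [v0|v0] := eqVneq v 0; first by rewrite v0 conjc0 !mulr0 addr0 nm0 mulr0.
  have [xz|xz] := eqVneq (x - z) 0.
    by rewrite /al /be (_ : x = z) ?subrr ?mul0r ?addr0 ?nm0 ?mulr0 ?mul0r //;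
      apply/eqP; rewrite -subr_eq0 xz.
  have nv : 0 < nm v by rewrite nm_gt0.
  have nx : 0 < nm (x - z) by rewrite nm_gt0.
  pose t := nm (x - z) / nm v; have t0 : 0 < t by exact: divr_gt0.
  have := tri (t%:C * v); rewrite nmZ ?(ltW t0) // {1}/t divfK ?gt_eqF // => /(_ erefl).
  rewrite conjM conjc_real (_ : _ + _ = t%:C * (al * v + be * v^*%C)); last by ring.
  rewrite nmZ ?(ltW t0) // => h.
  have : t * nm (al * v + be * v^*%C) <= t * (6 * C * nm (x - z) * nm v).
    apply: (le_trans h); rewrite (_ : t * _ = 6 * C * nm (x - z) * (t * nm v)); last by ring.
    by rewrite /t divfK ?gt_eqF // expr2 mulrA.
  by rewrite ler_pM2l.
have xv : x + v = y by rewrite /v; ring.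
have hv := Hx v; rewrite xv in hv; have {}hv := hv (near y ltac:(lra)).
rewrite (_ : F y - F x - _ = (F y - y - (F x - x) - ((ab x).1 * v + (ab x).2 * v^*%C))
   + (al * v + be * v^*%C)); last by rewrite /al /be /v; ring.
apply: (le_trans (nmD _ _)); apply: (le_trans (lerD hv lin)).
have nv2 : nm v <= 2 * d.
  rewrite (_ : v = (y - z) - (x - z)); last by rewrite /v; ring.
  by apply: (le_trans (nmD _ _)); rewrite nmN; lra.
have nv0 := nm_ge0 v; have nx0 := nm_ge0 (x - z).
rewrite (_ : _ + _ = (C * nm v + 6 * C * nm (x - z)) * nm v); last by ring.
apply: ler_wpM2r => //; nra.
Qed.
End NearInfinity.

(** * The coordinate near infinity *)

Section Bottcher.
Variable R : realType.
Implicit Types (z w u v : R[i]) (F G : R[i] -> R[i]).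
Variables (K theta : R) (hK : 0 < K) (c : R[i]).
Local Notation h := (stretch K theta).
Local Notation h' := (stretch K^-1 theta).
Local Notation N := (distortion K theta).
Local Notation H := (sqr_stretch K theta).
Local Notation f := (sqr_stretch_add K theta c).
Local Notation A := (lin_bound K theta).
Local Notation C := (quad_bound K theta).

Lemma stretch_image_open (U : set R[i]) : open U -> open (h @` U).
Proof.
move=> oU; apply/open_nmP => _ [u Uu <-]; have [d d0 dU] := (open_nmP U).1 oU u Uu.
have cts := @stretch_cts R theta K^-1 (h u).
have [d' d'0 D] := cts d d0; exists d' => // w /D.
rewrite (stretchK theta (stretch_factor_neq0 hK)) => /dU Uw; exists (h' w) => //.
exact: stretchVK.
Qed.

(** The normalisation of q is felt only beyond a radius that may depend on the branch. On |z| > r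
    the quotient of q (h z) by h z is never purely imaginary, so the positivity of its real part
    propagates inward along the ray. *)
Lemma bottcher_root (U : set R[i]) (r : R) (F q : R[i] -> R[i]) :
  far_radius K theta c <= r -> open U -> (forall z, r < nm z -> U z) ->
  c11 r A C F -> {within h @` U, continuous q} ->
  (forall w, (h @` U) w -> q w ^+ 2 = F (w ^+ 2 + c)) ->
  q w / w @[w --> at_infty R] --> (1 : R[i]) ->
  forall z, r < nm z -> q (h z) ^+ 2 = F (f z) /\ nm (q (h z) - h z) <= nm (q (h z) + h z).
Proof.
move=> rr oU rU cF cq q2 /cvg_at_inftyP /(_ 1 ltr01)[r' qr'] z rz.
have A0 := lin_bound_ge0 K theta; have C0 := quad_bound_ge0 K theta.
have N1 := distortion_ge1 K theta; have c0 := nm_ge0 c.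
have imU x : r < nm x -> (h @` U) (h x) by move=> /rU Ux; exists x.
have sq x : r < nm x -> q (h x) ^+ 2 = F (f x) by move=> /imU; exact: q2.
split; first exact: sq.
have big x : r < nm x -> 5 + nm c < nm (h x).
  move=> rx; have [P0 _] := far_modulus_le hK rr rx.
  by rewrite /far_modulus in P0; nra.
have hx0 x : r < nm x -> h x != 0 by move=> /big ?; rewrite -nm_gt0; lra.
pose rho x := q (h x) / h x.
have crho x : r < nm x -> cts_at rho x /\ complex.Re (rho x) != 0.
  move=> rx; split.
    apply: cts_atM.
      apply: cts_at_comp; first exact: stretch_cts.
      by apply: (within_ctsP _ (stretch_image_open oU)).1 => //; exact: imU.
    by apply: cts_at_comp; [exact: stretch_cts|apply: cts_atV; exact: hx0].
  apply: Re_root_gt0; rewrite /rho expr_div_n sq //.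
  have -> : F (f x) / h x ^+ 2 - 1 = (F (f x) - f x + c) / h x ^+ 2.
    by rewrite /sqr_stretch_add /sqr_stretch; field; exact: hx0.
  have bx := big x rx; have [_ [_ fx]] := far_modulus_le hK rr rx.
  have [E _] := cF _ fx.
  rewrite nmM nmV nmX expr2 ltr_pdivrMr; last by nra.
  by apply: (le_lt_trans (nmD _ _)); nra.
have zgt : 0 < nm z by have [? _] := far_radius_ge K theta c; lra.
have hzgt : 0 < nm (h z) by have := big z rz; lra.
pose t := 1 + `|r'| / nm (h z).
have t1 : 1 <= t by rewrite lerDl divr_ge0 // ltW.
have tz : 0 < complex.Re (rho (t%:C * z)).
  apply: Re_gt0_near1; apply: qr'; rewrite stretchZ nmZ; last lra.
  rewrite mulrDl divfK ?gt_eqF // mul1r; have := ler_norm r'; lra.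
have Rez : 0 < complex.Re (rho z).
  apply: (@Re_gt0_segment _ _ (t%:C * z)) tz => x /andP[x0 x1] /=.
  rewrite (_ : _ + _ = (t + x * (1 - t))%:C * z); last first.
    by rewrite [in RHS]rmorphD rmorphM rmorphB /=; ring.
  have s1 : 1 <= t + x * (1 - t) by nra.
  apply: crho; rewrite nmZ; last lra.
  by apply: (lt_le_trans rz); rewrite ler_peMl // ltW.
have E1 : q (h z) - h z = h z * (rho z - 1) by rewrite /rho; field; exact: hx0.
have E2 : q (h z) + h z = h z * (rho z + 1) by rewrite /rho; field; exact: hx0.
by rewrite E1 E2 !nmM; apply: ler_wpM2l; [exact: ltW|apply: Re_ge0_closer; exact: ltW].
Qed.

Lemma c11_id (r : R) : 1 <= r -> c11 r A C id.
Proof.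
move=> r1 z rz; have A0 := lin_bound_ge0 K theta; have C0 := quad_bound_ge0 K theta.
split; first by rewrite subrr nm0.
exists 0, 0; rewrite nm0 addr0; split; first by rewrite divr_ge0 ?nm_ge0.
by move=> xi _; rewrite !subrr !mul0r !(subr0, addr0) nm0 mulr_ge0 // sqr_ge0.
Qed.

Lemma bottcher_c11 (U : set R[i]) psi : bottcher_coordinate K theta c U psi ->
  exists r : R, [/\ far_radius K theta c <= r, 4 * N ^+ 2 <= r,
    forall z, r < nm z -> U z & c11 r A C psi].
Proof.
move=> [[oU _ /at_inftyP[rU hU] fU] [psik [psi0 psiS] unif] _ _ _].
pose r := Num.max (far_radius K theta c) (Num.max rU (4 * N ^+ 2)).
have r1 : far_radius K theta c <= r by rewrite le_max lexx.
have r2 : 4 * N ^+ 2 <= r by rewrite !le_max lexx !orbT.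
have r3 z : r < nm z -> U z by rewrite !gt_max => /and3P[_ /hU].
have [r5 _] := far_radius_ge K theta c.
exists r; split=> //.
have ck k : c11 r A C (psik k).
  elim: k => [|k IH].
    have r1' : 1 <= r by lra.
    move=> z rz; have [h1 [a [b [h2 h3]]]] := c11_id r1' rz.
    rewrite psi0; last exact: r3.
    split=> //; exists a, b; split=> // xi rxi.
    by rewrite psi0; [exact: h3|exact: r3].
  have [q [cq q2 qinf psiE]] := psiS k.
  apply: (c11_step hK r1 IH) => z rz; rewrite psiE; last exact: r3.
  by rewrite (stretchVK theta hK); apply: (bottcher_root r1 oU).
apply: c11_limit ck _; [exact: lin_bound_ge0|lra|].
move=> z rz e e0.
have : (psik @ \oo) [set F : R[i] -> R[i] | forall y, U y -> nm (F y - psi y) < e].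
  apply: unif; apply/uniform_nbhs.
  exists [set xy | nm (xy.2 - xy.1) < e]; split; last by move=> F /= HF y Uy; exact: HF.
  rewrite -entourage_from_ballE; exists e%:C => /=; first by rewrite ltcR.
  by move=> [x y] /=; rewrite -ball_normE /= normE nmB ltcR.
by move=> [n0 _ Hn]; exists n0 => n /Hn; apply; exact: r3.
Qed.

Section Base.
Variables (U : set R[i]) (psi : R[i] -> R[i]) (r M : R).
Hypotheses (bc : bottcher_coordinate K theta c U psi)
  (rr : far_radius K theta c <= r) (rU : forall z, r < nm z -> U z)
  (cpsi : c11 r A C psi) (rM : r + 2 <= M) (MN : 2 * N ^+ 2 <= M) (Mc : 1 + nm c <= M).

Definition far_level : set R[i] := [set z | r < nm z /\ outer_square M (psi z)].

Lemma coordinate_inj z w : U z -> U w -> psi z = psi w -> z = w.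
Proof. by case: bc => _ _ [[_ [inj _ _] _] _] _ _ Uz Uw; apply: inj; rewrite inE. Qed.

Lemma coordinate_cts z : U z -> cts_at psi z.
Proof.
case: bc => _ _ [[oU [_ cps _] _] _] _ _ Uz.
exact: ((within_ctsP _ oU).1 cps).
Qed.

Lemma far_level_open : open far_level.
Proof.
apply/open_nmP => z [rz Qz].
have [d d0 dQ] := (open_nmP _).1 (@outer_square_open R M) _ Qz.
have [d' d'0 D] := coordinate_cts (rU rz) d0.
exists (Num.min d' (nm z - r)); first by rewrite lt_min d'0 subr_gt0.
move=> w; rewrite lt_min => /andP[/D/dQ Qw wr]; split=> //.
by have := nmBB z w; rewrite nmB in wr; lra.
Qed.

Lemma base_inv_coord : exists Phi0,
  inv_coord K theta c (square_level K theta M 0) (preimage_level K theta c far_level 0) Phi0 /\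
  [/\ forall w, outer_square M w -> nm (Phi0 w - w) <= 1,
      forall w, outer_square M w -> psi (Phi0 w) = w &
      forall z, far_level z -> Phi0 (psi z) = z].
Proof.
have [[oU _ _ fU] _ [[_ [_ _ opn] _] _] cj _] := bc.
have [r5 _] := far_radius_ge K theta c.
have r0 : 0 <= r by have rr' := rr; lra.
have near1 z : r < nm z -> nm (psi z - z) <= 1 by move=> /cpsi[].
have surj := near_identity_surjective r0 rM rU coordinate_cts opn near1.
have /choice[Phi0 PhiP] : forall w, exists z, outer_square M w -> r < nm z /\ psi z = w.
  move=> w; have [/surj[z rz zw]|nQ] := pselect (outer_square M w); first by exists z.
  by exists 0.
have uniq z w : r < nm z -> psi z = w -> outer_square M w -> Phi0 w = z.
  move=> rz zw /PhiP[rP Pw]; apply: coordinate_inj; [exact: rU|exact: rU|by rewrite Pw].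
have M0 : 0 <= M by have rM' := rM; lra.
exists Phi0; split; last first.
  split=> [w /PhiP[rP Pw]|w /PhiP[]//|z [rz Qz]]; last exact: uniq.
  by rewrite -{2}Pw nmB; exact: near1.
rewrite /square_level /preimage_level /=; split.
- move=> w Qw e e0; have [rP Pw] := PhiP w Qw.
  (* The condition |z| > r identifies a preimage found in B with the value of [Phi0]. *)
  pose B : set R[i] := [set z | nm (z - Phi0 w) < e /\ r < nm z].
  have oB : open B.
    apply/open_nmP => z [h1 h2]; exists (Num.min (e - nm (z - Phi0 w)) (nm z - r)).
      by rewrite lt_min !subr_gt0 h1.
    move=> x; rewrite lt_min => /andP[x1 x2]; split; last first.
      by rewrite /=; have := nmBB z x; rewrite nmB in x2; lra.
    rewrite /= (_ : x - Phi0 w = (x - z) + (z - Phi0 w)); last by ring.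
    by apply: (le_lt_trans (nmD _ _)); lra.
  have oI : open (psi @` B) by apply: opn => // z [_]; exact: rU.
  have Iw : (psi @` B) w by exists (Phi0 w) => //; split=> //; rewrite subrr nm0.
  have [d d0 dI] := (open_nmP _).1 oI w Iw.
  have [d' d'0 dQ] := (open_nmP _).1 (@outer_square_open R M) w Qw.
  exists (Num.min d d'); first by rewrite lt_min d0.
  move=> x; rewrite lt_min => /andP[/dI[z [z1 z2] zx] /dQ Qx].
  by rewrite (uniq z x).
- split=> [w Qw|z [rz Qz]].
    by have [rP Pw] := PhiP w Qw; split=> //; rewrite Pw.
  by exists (psi z) => //; exact: uniq.
- move=> w w' Qw Qw' E; have [_ <-] := PhiP w Qw; have [_ <-] := PhiP w' Qw'.
  by rewrite E.
- move=> w Qw e e0; have [rP Pw] := PhiP w Qw.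
  have [d d0 dV] := (open_nmP _).1 far_level_open (Phi0 w) (conj rP (eq_ind_r (outer_square M) Qw Pw)).
  have [d' d'0 D] := coordinate_cts (rU rP) e0.
  exists (Num.min d d'); first by rewrite lt_min d0.
  move=> z; rewrite lt_min => /andP[/dV[rz Qz] /D]; rewrite Pw => h1.
  by exists (psi z); split=> //; exact: uniq.
- move=> w Qw; have [QH _] := outer_square_H hK MN Qw; split=> //.
  have [rP Pw] := PhiP w Qw; have [_ [_ rf]] := far_modulus_le hK rr rP.
  by apply/esym; apply: uniq => //; rewrite -cj ?Pw //; exact: rU.
Qed.
End Base.
End Bottcher.

(** * Pulling back strict differentiability *)

Section Orientation.
Variable R : realType.
Implicit Types (z w u v a b : R[i]) (F G : R[i] -> R[i]).

Lemma strictD_near_eq F G z0 a b (d : R) : 0 < d ->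
  (forall w, nm (w - z0) < d -> F w = G w) -> strictD G z0 a b -> strictD F z0 a b.
Proof.
move=> d0 FG dG e /dG[d' d'0 D]; exists (Num.min d d'); first by rewrite lt_min d0.
move=> z w; rewrite !lt_min => /andP[z1 z2] /andP[w1 w2]; rewrite !FG //; exact: D.
Qed.

Lemma orient_diff_near_eq F G z0 (d : R) : 0 < d ->
  (forall w, nm (w - z0) < d -> F w = G w) -> orient_diff G z0 -> orient_diff F z0.
Proof.
move=> d0 FG [a [b [ab dG]]]; exists a, b; split=> //.
exact: strictD_near_eq d0 FG dG.
Qed.

Lemma strictD_lip F z0 a b : strictD F z0 a b -> exists2 d : R, 0 < d &
  forall z w, nm (z - z0) < d -> nm (w - z0) < d ->
    nm (F z - F w) <= (1 + nm a + nm b) * nm (z - w).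
Proof.
move=> /(_ 1 ltr01)[d d0 D]; exists d => // z w zd wd.
have := D z w zd wd; set T := F z - F w - _ => h.
have -> : F z - F w = T + (a * (z - w) + b * (z - w)^*%C) by rewrite /T; ring.
apply: (le_trans (nmD _ _)); have := nmD (a * (z - w)) (b * (z - w)^*%C).
by rewrite !nmM nm_conj; lra.
Qed.

Lemma strictD_comp F G z0 a1 b1 a2 b2 : strictD G z0 a1 b1 -> strictD F (G z0) a2 b2 ->
  strictD (F \o G) z0 (a2 * a1 + b2 * b1^*%C) (a2 * b1 + b2 * a1^*%C).
Proof.
move=> dG dF e e0.
have [dl dl0 lip] := strictD_lip dG.
have na1 := nm_ge0 a1; have nb1 := nm_ge0 b1; have na2 := nm_ge0 a2; have nb2 := nm_ge0 b2.
pose L := 1 + nm a1 + nm b1; pose Q := 1 + nm a2 + nm b2.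
have L0 : 0 < L by rewrite /L; lra.
have Q0 : 0 < Q by rewrite /Q; lra.
have e1 : 0 < e / (2 * L) by rewrite divr_gt0 // mulr_gt0.
have e2 : 0 < e / (2 * Q) by rewrite divr_gt0 // mulr_gt0.
have [d1 d10 D1] := dF _ e1; have [d2 d20 D2] := dG _ e2.
have [d3 d30 D3] := strictD_cts dG d10.
exists (Num.min dl (Num.min d2 d3)); first by rewrite !lt_min dl0 d20.
move=> z w; rewrite !lt_min => /and3P[z1 z2 z3] /and3P[w1 w2 w3] /=.
have h1 := D1 _ _ (D3 _ z3) (D3 _ w3); have h2 := D2 _ _ z2 w2; have h3 := lip _ _ z1 w1.
set T1 := F (G z) - F (G w) - _ in h1; set T2 := G z - G w - _ in h2.
have -> : F (G z) - F (G w) - ((a2 * a1 + b2 * b1^*%C) * (z - w)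
   + (a2 * b1 + b2 * a1^*%C) * (z - w)^*%C) = T1 + (a2 * T2 + b2 * T2^*%C).
  by rewrite /T1 /T2 !(conjB, conjD, conjM) !conjcK; ring.
apply: (le_trans (nmD _ _)); apply: (le_trans (lerD (lexx _) (nmD _ _))).
rewrite !nmM nm_conj -mulrDl.
have nv := nm_ge0 (z - w); have nT2 := nm_ge0 T2.
have k1 : nm T1 <= e / 2 * nm (z - w).
  apply: (le_trans h1); apply: le_trans (_ : e / (2 * L) * (L * nm (z - w)) <= _).
    by apply: ler_wpM2l => //; exact: ltW.
  by rewrite le_eqVlt; apply/orP; left; apply/eqP; field; rewrite gt_eqF.
have k2 : (nm a2 + nm b2) * nm T2 <= e / 2 * nm (z - w).
  apply: le_trans (_ : Q * (e / (2 * Q) * nm (z - w)) <= _).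
    by apply: ler_pM => //; rewrite ?addr_ge0 // /Q; lra.
  by rewrite le_eqVlt; apply/orP; left; apply/eqP; field; rewrite gt_eqF.
lra.
Qed.

Lemma nm_lt_sqr u v : (nm u < nm v) = (nm u ^+ 2 < nm v ^+ 2).
Proof. by rewrite ltr_pXn2r // nnegrE nm_ge0. Qed.

(** Multiplicativity of the Jacobian determinant, in the form |F_z|^2 - |F_zbar|^2. *)
Lemma jacobian_comp a1 b1 a2 b2 :
  nm (a2 * a1 + b2 * b1^*%C) ^+ 2 - nm (a2 * b1 + b2 * a1^*%C) ^+ 2 =
  (nm a2 ^+ 2 - nm b2 ^+ 2) * (nm a1 ^+ 2 - nm b1 ^+ 2).
Proof.
by rewrite !nm_sqr; case: a1 b1 a2 b2 => [? ?] [? ?] [? ?] [? ?] /=; ring.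
Qed.

Lemma orient_diff_comp F G z0 : orient_diff G z0 -> orient_diff F (G z0) ->
  orient_diff (F \o G) z0.
Proof.
move=> [a1 [b1 [ab1 dG]]] [a2 [b2 [ab2 dF]]].
exists (a2 * a1 + b2 * b1^*%C), (a2 * b1 + b2 * a1^*%C); split; last exact: strictD_comp.
rewrite nm_lt_sqr -subr_gt0 jacobian_comp; move: ab1 ab2; rewrite !nm_lt_sqr => ab1 ab2.
by apply: mulr_gt0; rewrite subr_gt0.
Qed.

Lemma orient_diff_sqr (c z0 : R[i]) : z0 != 0 -> orient_diff (fun z => z ^+ 2 + c) z0.
Proof.
move=> z00; exists (2%:R * z0), 0; split.
  by rewrite nm0 nm_gt0 mulf_neq0 // pnatr_eq0.
move=> e e0; exists (e / 2); first lra.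
move=> z w zd wd.
have -> : z ^+ 2 + c - (w ^+ 2 + c) - (2%:R * z0 * (z - w) + 0 * (z - w)^*%C) =
  ((z - z0) + (w - z0)) * (z - w) by ring.
by rewrite nmM; apply: ler_wpM2r; [exact: nm_ge0|apply: (le_trans (nmD _ _)); lra].
Qed.

(** F z - F w is the increment of F^2 divided by F z + F w, which tends to q = 2 F z0 by continuity
    alone; a preliminary Lipschitz bound on F controls the error of replacing this denominator by
    q. *)
Lemma orient_diff_root F z0 : F z0 != 0 -> cts_at F z0 ->
  orient_diff (fun z => F z ^+ 2) z0 -> orient_diff F z0.
Proof.
move=> F0 cF [a [b [ab dF2]]]; pose q := 2%:R * F z0.
have q0 : q != 0 by rewrite mulf_neq0 // pnatr_eq0.
have nq : 0 < nm q by rewrite nm_gt0.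
exists (a / q), (b / q); split.
  by rewrite !nmM nmV ltr_pM2r // invr_gt0.
move=> e e0.
have [dl dl0 lip] := strictD_lip dF2.
pose L := 1 + nm a + nm b.
have L0 : 0 < L by have := nm_ge0 a; have := nm_ge0 b; rewrite /L; lra.
have k0 : 0 < Num.min (nm q / 4) (e * nm q * nm q / (8 * L)).
  rewrite lt_min; apply/andP; split; first lra.
  by rewrite divr_gt0 ?mulr_gt0.
have e2 : 0 < e * nm q / 2 by rewrite divr_gt0 // mulr_gt0.
have [d1 d10 D1] := cF _ k0; have [d2 d20 D2] := dF2 _ e2.
exists (Num.min dl (Num.min d1 d2)); first by rewrite !lt_min dl0 d10.
move=> z w; rewrite !lt_min => /and3P[z1 /D1 z2 z3] /and3P[w1 /D1 w2 w3].
have h2 := D2 _ _ z3 w3; have h3 := lip _ _ z1 w1.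
move: z2 w2; rewrite !lt_min => /andP[z2 z2'] /andP[w2 w2'].
set T := F z ^+ 2 - F w ^+ 2 - _ in h2.
pose s := F z + F w - q.
have ns : nm s <= nm (F z - F z0) + nm (F w - F z0).
  by rewrite (_ : s = (F z - F z0) + (F w - F z0)) ?nmD // /s /q; ring.
have nsum : nm q / 2 <= nm (F z + F w).
  by have := nmBD q s; rewrite (_ : q + s = F z + F w); [lra|rewrite /s; ring].
have nv := nm_ge0 (z - w); have nd := nm_ge0 (F z - F w).
have lipF : nm (F z - F w) * nm q <= 2 * L * nm (z - w).
  have : nm (F z - F w) * nm (F z + F w) <= L * nm (z - w) by rewrite -nmM -subr_sqr.
  have := ler_wpM2l nd nsum; lra.
have -> : F z - F w - (a / q * (z - w) + b / q * (z - w)^*%C) =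
   (T - s * (F z - F w)) / q.
  by rewrite /T /s; field.
rewrite nmM nmV ler_pdivrMr //; apply: (le_trans (nmD _ _)); rewrite nmN nmM.
have sL : nm s * (4 * L) <= e * nm q * nm q.
  have h4 : nm (F z - F z0) * (8 * L) <= e * nm q * nm q by rewrite -ler_pdivlMr ?mulr_gt0 // ltW.
  have h5 : nm (F w - F z0) * (8 * L) <= e * nm q * nm q by rewrite -ler_pdivlMr ?mulr_gt0 // ltW.
  have := ler_wpM2r (ltW L0) ns; lra.
have main : nm s * nm (F z - F w) <= e * nm q / 2 * nm (z - w).
  rewrite -(ler_pM2r nq).
  have s0 := nm_ge0 s.
  have h6 := ler_wpM2l s0 lipF; have h7 := ler_wpM2r nv sL; lra.
lra.
Qed.

Section Pull.
Variables (K theta : R) (hK : 0 < K) (c : R[i]).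
Local Notation h := (stretch K theta).
Local Notation h' := (stretch K^-1 theta).
Local Notation f := (sqr_stretch_add K theta c).

Lemma orient_diff_stretch (L : R) z0 : 0 < L -> orient_diff (stretch L theta) z0.
Proof.
move=> L0; exists (stretch_coef1 L), (stretch_coef2 L theta); split; last first.
  move=> e e0; exists 1 => // z w _ _.
  by rewrite -stretchB stretchE subrr nm0 mulr_ge0 ?nm_ge0 // ltW.
have cs : nm (cos (2%:R * theta) +i* sin (2%:R * theta)) = 1 :> R.
  by rewrite /= cos2Dsin2 sqrtr1.
rewrite /stretch_coef1 /stretch_coef2 nmM cs mul1r !nm_real (ger0_norm (_ : 0 <= (L + 1) / 2%:R)); last lra.
by rewrite ltr_norml; apply/andP; split; lra.
Qed.

Lemma orient_diff_f z0 : z0 != 0 -> orient_diff f z0.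
Proof.
move=> z00; apply: (@orient_diff_comp (fun z => z ^+ 2 + c) h).
  exact: orient_diff_stretch.
by apply: orient_diff_sqr; rewrite stretch_eq0.
Qed.

Lemma orient_diff_pull Psi z0 (d : R) : 0 < d -> z0 != 0 -> Psi z0 != 0 -> cts_at Psi z0 ->
  (forall z, nm (z - z0) < d -> sqr_stretch K theta (Psi z) = Psi (f z)) ->
  orient_diff Psi (f z0) -> orient_diff Psi z0.
Proof.
move=> d0 z00 P0 cP cj dP.
have o1 : orient_diff (fun z => h (Psi z) ^+ 2) z0.
  apply: (@orient_diff_near_eq _ (Psi \o f) _ d) => //.
  by apply: orient_diff_comp => //; exact: orient_diff_f.
have o2 : orient_diff (fun z => h (Psi z)) z0.
  apply: orient_diff_root => //; first by rewrite stretch_eq0.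
  by apply: cts_at_comp => //; exact: stretch_cts.
apply: (@orient_diff_near_eq _ (h' \o (fun z => h (Psi z))) _ 1) => //.
  by move=> w _ /=; rewrite (stretchK theta (stretch_factor_neq0 hK)).
apply: orient_diff_comp => //; apply: orient_diff_stretch; rewrite invr_gt0; exact: hK.
Qed.
End Pull.
End Orientation.

(** * Extension of the coordinate *)

Section Extension.
Variable R : realType.
Implicit Types (z w u v : R[i]).
Variables (K theta : R) (hK : 0 < K) (c : R[i]).
Local Notation H := (sqr_stretch K theta).
Local Notation f := (sqr_stretch_add K theta c).

Variables (U : set R[i]) (psi : R[i] -> R[i]) (r M : R).
Hypotheses (bc : bottcher_coordinate K theta c U psi)
  (rr : far_radius K theta c <= r) (rU : forall z, r < nm z -> U z)
  (cpsi : c11 r (lin_bound K theta) (quad_bound K theta) psi).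
Local Notation V0 := (far_level psi r M).

Variables (W V : set R[i]) (Phi Phi0 : R[i] -> R[i]).
Hypotheses (inv : inv_coord K theta c W V Phi) (oW : open W)
  (QW : outer_square M `<=` W) (W0 : ~ W 0) (V0n : ~ V 0) (UV : U `<=` V)
  (ext : forall w, outer_square M w -> Phi w = Phi0 w)
  (Phi0K : forall z, V0 z -> Phi0 (psi z) = z)
  (Vlev : forall z, V z -> exists n, V0 (iter n f z)).

Definition inverse_spec Psi := forall z, V z -> W (Psi z) /\ Phi (Psi z) = z.

Lemma exists_inverse : exists Psi, inverse_spec Psi.
Proof.
have [_ [_ sj] _ _ _] := inv.
have /choice[Psi PsiP] : forall z, exists w, V z -> W w /\ Phi w = z.
  move=> z; have [/sj[w Ww Pw]|nV] := pselect (V z); first by exists w.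
  by exists 0.
by exists Psi.
Qed.

Section Inverse.
Variables (Psi : R[i] -> R[i]) (PsiP : inverse_spec Psi).

Lemma inverse_Phi w : W w -> Psi (Phi w) = w.
Proof.
have [_ [inV _] ij _ _] := inv => Ww; have [W' E] := PsiP (inV w Ww).
exact: ij.
Qed.

Lemma range_open : open V.
Proof.
have [_ [inV _] _ op _] := inv; apply/open_nmP => z Vz.
have [Wz E] := PsiP Vz; have [d d0 D] := op _ Wz 1 ltr01; exists d => // x.
by rewrite -E => /D[w [Ww _ <-]]; exact: inV.
Qed.

Lemma inverse_cts z : V z -> cts_at Psi z.
Proof.
have [_ _ _ op _] := inv => Vz e e0.
have [Wz E] := PsiP Vz; have [d d0 D] := op _ Wz e e0; exists d => // x.
by rewrite -{1}E => /D[w [Ww we <-]]; rewrite inverse_Phi.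
Qed.

Lemma inverse_homeo : homeo_onto_image V Psi.
Proof.
have [cP [inV _] _ _ _] := inv; split.
- move=> x y /[!inE] Vx Vy E; have [_ <-] := PsiP Vx; have [_ <-] := PsiP Vy.
  by rewrite E.
- by apply/(within_ctsP _ range_open) => z; exact: inverse_cts.
- move=> W' oW' W'V; apply/open_nmP => _ [z W'z <-].
  have [Wz E] := PsiP (W'V _ W'z).
  have [d d0 dW] := (open_nmP _).1 oW' z W'z.
  have [d' d'0 D] := cP _ Wz _ d0; have [d1 d10 D1] := (open_nmP _).1 oW _ Wz.
  exists (Num.min d' d1); first by rewrite lt_min d'0.
  move=> w; rewrite lt_min => /andP[/D]; rewrite E => /dW W'w /D1 Ww.
  by exists (Phi w) => //; exact: inverse_Phi.
Qed.

Lemma inverse_conj z : V z -> V (f z) /\ H (Psi z) = Psi (f z).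
Proof.
have [_ [inV _] _ _ cj] := inv => Vz; have [Wz E] := PsiP Vz.
have [WH fP] := cj _ Wz; rewrite E in fP.
by rewrite fP; split; [exact: inV|rewrite inverse_Phi].
Qed.

Lemma inverse_far z : V0 z -> Psi z = psi z.
Proof.
by move=> V0z; have [_ Qz] := V0z; rewrite -{1}(Phi0K V0z) -ext // inverse_Phi //; exact: QW.
Qed.

Lemma inverse_neq0 z : V z -> Psi z != 0.
Proof. by move=> /PsiP[Wz _]; apply/eqP => E; apply: W0; rewrite -E. Qed.

(** Induction on the time n at which the orbit is in [V0], where both maps agree. One step back,
    equality of H Psi and H psi leaves a sign, fixed near z0 by the common nonzero value there. *)
Lemma near_agree z0 : U z0 -> Psi z0 = psi z0 -> forall n, V0 (iter n f z0) ->
  exists2 d : R, 0 < d & forall z, nm (z - z0) < d -> U z /\ Psi z = psi z.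
Proof.
have [[oU _ _ fU] _ _ cj _] := bc.
move=> Uz0 E0 n; elim: n z0 Uz0 E0 => [|n IH] z0 Uz0 E0.
  move=> V0z; have oV : open V0 by exact: (far_level_open bc rU).
  have [d d0 D] := (open_nmP _).1 oV _ V0z.
  by exists d => // z /D V0z'; split; [apply: rU; have [] := V0z'|exact: inverse_far].
rewrite iterSr => V0z.
have Uf : U (f z0) by apply: fU; exists z0.
have Ef : Psi (f z0) = psi (f z0).
  by have [_ <-] := inverse_conj (UV Uz0); rewrite E0 cj.
have [d d0 D] := IH _ Uf Ef V0z.
have [d1 d10 D1] := @sqr_stretch_add_cts _ K theta c z0 _ d0.
have p0 : 0 < nm (Psi z0) / 2 by have := inverse_neq0 (UV Uz0); rewrite -nm_gt0; lra.
have [d2 d20 D2] := inverse_cts (UV Uz0) p0.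
have [d3 d30 D3] := coordinate_cts bc Uz0 p0.
have [d4 d40 D4] := (open_nmP _).1 oU _ Uz0.
exists (Num.min d1 (Num.min d2 (Num.min d3 d4))); first by rewrite !lt_min d10 d20 d30.
move=> z; rewrite !lt_min => /and4P[/D1/D[Ufz Efz] z2 z3 /D4 Uz]; split=> //.
have : H (Psi z) = H (psi z) by have [_ ->] := inverse_conj (UV Uz); rewrite Efz cj.
move=> /(sqr_stretch_inj hK)[//|E]; exfalso.
have h2 := D2 z z2; have h3 := D3 z z3; rewrite -E0 in h3.
have := nmD (- (Psi z - Psi z0)) (- (psi z - Psi z0)); rewrite !nmN E.
rewrite (_ : _ + _ = 2%:C * Psi z0); last by rewrite rmorph_nat; ring.
by rewrite E in h2; rewrite nmZ //; lra.
Qed.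

Lemma inverse_agree z : U z -> Psi z = psi z.
Proof.
have [[oU cU /at_inftyP[rU' hU] fU] _ _ cj _] := bc.
pose E := U `&` [set z | Psi z = psi z].
have r1 : 1 <= r by have [? _] := far_radius_ge K theta c; have rr' := rr; lra.
suff H : U `<=` E by move=> /H[].
apply: connected_clopen => //.
- by move=> x [].
(* So remote that |psi x| > 2 M, hence x lies in [V0]. *)
- pose x : R[i] := (`|r| + `|M| * 2 + 2)%:C.
  have nx : nm x = `|r| + `|M| * 2 + 2 by rewrite nm_real ger0_norm // !addr_ge0 ?mulr_ge0.
  have rx : r < nm x by have := ler_norm r; have := normr_ge0 M; lra.
  have V0x : V0 x.
    split=> //; apply: nm_outer_square; have [h1 _] := cpsi rx.
    have := nmBB x (x - psi x); rewrite (_ : x - (x - psi x) = psi x); last by ring.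
    by rewrite nmB in h1; have := ler_norm M; have := normr_ge0 r; lra.
  by exists x; split; [exact: rU|exact: inverse_far].
- apply/open_nmP => x [Ux Ex]; have [n V0x] := Vlev (UV Ux).
  by have [d d0 D] := near_agree Ux Ex V0x; exists d => // y /D.
- apply/open_nmP => x [Ux nEx].
  have ne : 0 < nm (Psi x - psi x) / 2.
    by rewrite divr_gt0 // nm_gt0 subr_eq0; apply/eqP => e; apply: nEx.
  have [d d0 D] := inverse_cts (UV Ux) ne; have [d' d'0 D'] := coordinate_cts bc Ux ne.
  have [d1 d10 D1] := (open_nmP _).1 oU _ Ux.
  exists (Num.min d (Num.min d' d1)); first by rewrite !lt_min d0 d'0.
  move=> y; rewrite !lt_min => /and3P[/D h1 /D' h2 /D1 Uy]; split=> // -[_ /= Ey].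
  have := nmD (- (Psi y - Psi x)) (psi y - psi x); rewrite nmN Ey.
  rewrite (_ : - (psi y - Psi x) + _ = Psi x - psi x); last by ring.
  by rewrite Ey in h1; lra.
Qed.

Lemma inverse_orient z : V z -> orient_diff Psi z.
Proof.
have [r5 _] := far_radius_ge K theta c; have rr' := rr.
move=> Vz; have [n V0z] := Vlev Vz; elim: n z Vz V0z => [|n IH] z Vz.
  move=> V0z; have oV : open V0 by exact: (far_level_open bc rU).
  have [d d0 D] := (open_nmP _).1 oV _ V0z.
  apply: (orient_diff_near_eq d0); first by move=> w /D; exact: inverse_far.
  have Ar : lin_bound K theta <= r.
    have N1 := distortion_ge1 K theta; have A0 := lin_bound_ge0 K theta.
    have C0 := quad_bound_ge0 K theta; have c0 := nm_ge0 c.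
    apply: le_trans rr; rewrite /far_radius.
    have F0 : lin_bound K theta <= far_modulus K theta c by rewrite /far_modulus; nra.
    have : 0 <= distortion K theta ^+ 2 by exact: sqr_ge0.
    by nra.
  have [rz _] := V0z.
  by apply: (c11_orient_diff (lin_bound_ge0 _ _) (quad_bound_ge0 _ _) _ Ar cpsi) rz; lra.
rewrite iterSr => V0z; have [Vf _] := inverse_conj Vz.
have [d d0 D] := (open_nmP _).1 range_open _ Vz.
apply: (orient_diff_pull hK d0 _ (inverse_neq0 Vz) (inverse_cts Vz) _ (IH _ Vf V0z)).
  by apply/eqP => z0; apply: V0n; rewrite -z0.
by move=> w /D /inverse_conj[].
Qed.
End Inverse.

Lemma coordinate_extension : exists Psi, [/\ extends_coordinate K theta c U psi V Psi,
  {in V &, injective Psi}, locally_quasiconformal V Psi, open V & forall z, V z -> W (Psi z)].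
Proof.
have [Psi PsiP] := exists_inverse; exists Psi.
have oV := range_open PsiP; have hom := inverse_homeo PsiP.
have [ij cP _] := hom.
split=> //.
- split=> //; first by move=> z /[!inE] Uz; rewrite (inverse_agree PsiP Uz).
  by move=> z Vz; exact: inverse_conj.
- apply: locally_quasiconformal_of_diff => // z; exact: inverse_orient.
- by move=> z /PsiP[].
Qed.
End Extension.

(** * Escaping sets *)

Section Escape.
Variable R : realType.
Implicit Types (z w u v : R[i]).

Lemma escaping_setS (F : R[i] -> R[i]) z : escaping_set F (F z) <-> escaping_set F z.
Proof.
rewrite /escaping_set /= !cvg_inftyP; split=> H r.
  have [n0 Hn] := H r; exists n0.+1 => -[//|n] n0n; rewrite iterSr; exact: Hn.
have [n0 Hn] := H r; exists n0 => n n0n; rewrite -iterSr; apply: Hn.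
exact: leq_trans (leqnSn n).
Qed.

Lemma escaping_set_iter (F : R[i] -> R[i]) n z :
  escaping_set F (iter n F z) <-> escaping_set F z.
Proof. by elim: n z => [//|n IH] z; rewrite iterSr IH escaping_setS. Qed.

Lemma escaping_of_growth (F : R[i] -> R[i]) z :
  (forall n, nm (iter n F z) + 1 <= nm (iter n.+1 F z)) -> escaping_set F z.
Proof.
move=> G; apply/cvg_inftyP => r.
have big n : n%:R <= nm (iter n F z).
  elim: n => [|n IH]; first exact: nm_ge0.
  by rewrite -natr1; apply: le_trans (G n); rewrite lerD2r.
exists (Num.trunc r).+1 => n rn; apply: lt_le_trans (big n).
by apply: lt_le_trans (truncnS_gt r) _; rewrite ler_nat.
Qed.

Variables (K theta : R) (hK : 0 < K) (c : R[i]).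
Local Notation N := (distortion K theta).
Local Notation H := (sqr_stretch K theta).
Local Notation f := (sqr_stretch_add K theta c).

Lemma far_double (r : R) z : far_radius K theta c <= r -> 4 * N ^+ 2 <= r -> r < nm z ->
  r < nm (f z) /\ nm z + 1 <= nm (f z).
Proof.
move=> r1 r2 rz; have [_ [X fz]] := far_modulus_le hK r1 rz; split=> //.
have [r5 _] := far_radius_ge K theta c.
have Pz : nm z <= N * nm (stretch K theta z) by exact: stretch_ge.
have N1 := distortion_ge1 K theta.
have zz : nm z * nm z <= (N * nm (stretch K theta z)) * (N * nm (stretch K theta z)).
  by apply: ler_pM => //; exact: nm_ge0.
have z2 : 4 * (N * N) * nm z <= nm z * nm z.
  by apply: ler_wpM2r; [exact: nm_ge0|rewrite -expr2; lra].
have NN : 0 < N * N by nra.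
have : 2 * nm z <= nm (f z).
  by apply: le_trans X; rewrite -(ler_pM2l NN); lra.
lra.
Qed.

Lemma far_escaping (r : R) z : far_radius K theta c <= r -> 4 * N ^+ 2 <= r -> r < nm z ->
  escaping_set f z.
Proof.
move=> r1 r2 rz; apply: escaping_of_growth => n.
have fz : r < nm (iter n f z) by elim: n => //= n IH; have [] := far_double r1 r2 IH.
by have [] := far_double r1 r2 fz.
Qed.

Lemma escaping_open : open (escaping_set f).
Proof.
have [r [r1 r2]] : exists r : R, far_radius K theta c <= r /\ 4 * N ^+ 2 <= r.
  exists (Num.max (far_radius K theta c) (4 * N ^+ 2)).
  by rewrite !le_max !lexx orbT.
apply/open_nmP => z /cvg_inftyP /(_ r)[n /(_ n (leqnn n)) rn].
have cf : cts_at (iter n f) z by apply: iter_cts; exact: sqr_stretch_add_cts.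
have e0 : 0 < nm (iter n f z) - r by rewrite subr_gt0.
have [d d0 D] := cf _ e0; exists d => // w /D h.
apply/(escaping_set_iter f n); apply: (far_escaping r1 r2).
by have := nmBB (iter n f z) (iter n f w); rewrite nmB; lra.
Qed.

Lemma iter_lift n z0 (e : R) : 0 < e -> exists2 d : R, 0 < d &
  forall v, nm (v - iter n f z0) < d -> exists2 z, nm (z - z0) < e & iter n f z = v.
Proof.
elim: n z0 e => [|n IH] z0 e e0; first by exists e => // v ve; exists v.
have [d d0 D] := @sqr_stretch_add_open R K theta hK c z0 e e0.
have [d' d'0 D'] := IH (f z0) d d0; exists d' => // v; rewrite iterSr => /D'[u /D[z ze <-] <-].
by exists z => //; rewrite iterSr.
Qed.

Lemma square_level_escaping (M : R) n w : 2 * N ^+ 2 <= M -> 1 <= M ->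
  square_level K theta M n w -> escaping_set H w.
Proof.
move=> MN M1 Ww; apply/(escaping_set_iter H n); apply: escaping_of_growth => m.
have Q : outer_square M (iter m H (iter n H w)).
  by elim: m => //= m IH; have [] := outer_square_H hK MN IH.
have [_ h] := outer_square_H hK MN Q; have := outer_square_nm Q.
by rewrite /=; lra.
Qed.

Lemma square_level_connected (M : R) n : 0 <= M -> 2 * N ^+ 2 <= M ->
  connected (square_level K theta M n).
Proof.
move=> M0 MN; apply: (@connected_of_segments _ _ ((M + 1) +i* (M + 1))) => x Wx.
have QW : outer_square M `<=` square_level K theta M n.
  exact: (@square_level_mono _ _ _ hK _ MN 0%N n (leq0n n)).
have nx : 0 < nm x.
  by rewrite nm_gt0; apply/eqP => x0; apply: (@square_level0 _ K theta _ M0 n); rewrite -x0.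
pose t := 1 + (2 * M + 1) / nm x.
have q0 : 0 <= (2 * M + 1) / nm x by rewrite divr_ge0 ?(ltW nx) //; lra.
have Qt : outer_square M (t%:C * x).
  apply: nm_outer_square; rewrite nmZ; last by rewrite /t; lra.
  have -> : t * nm x = nm x + (2 * M + 1) by rewrite /t; field; rewrite gt_eqF.
  lra.
have [p h1 h2] := outer_square_segment M0 Qt.
exists (t%:C * x), p; split=> [s /andP[s0 s1]|s /h1/QW //|s /h2/QW //].
rewrite (_ : _ + _ = (1 + s * (t - 1))%:C * x); last first.
  by rewrite [in RHS]rmorphD rmorphM [in RHS]rmorphB /=; ring.
apply: square_level_ray => //; rewrite lerDl mulr_ge0 // /t; lra.
Qed.

(** The ratio lam survives |f z| >= |z|^2 / N^2 - |c| and |f y| <= N^2 |y|^2 + |c|, because lam^2 /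
    N^2 = lam (N^2 + 2) and the surplus 2 lam b^2 pays for (lam + 1) |c|. *)
Lemma growth_comparison (lam b : R) z y : lam = N ^+ 2 * (N ^+ 2 + 2) ->
  lam * b <= nm z -> nm y <= b -> 1 + nm c <= b ->
  exists b', [/\ lam * b' <= nm (f z), nm (f y) <= b' & 1 + nm c <= b'].
Proof.
move=> lamE zb yb cb; have N1 := distortion_ge1 K theta; have c0 := nm_ge0 c.
have y0 := nm_ge0 y.
have hz := sqr_stretch_add_ge theta hK c z; have hy := sqr_stretch_add_le K theta c y.
set L : R := N ^+ 2 in lamE hz hy.
have L1 : 1 <= L by exact: exprn_ege1.
have lam3 : 3 <= lam by rewrite lamE; nra.
have bb : b <= b * b by nra.
have yy : nm y * nm y <= b * b by apply: ler_pM.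
exists (L * (b * b) + nm c); split.
- have zz : (lam * b) * (lam * b) <= nm z * nm z by apply: ler_pM => //; apply: mulr_ge0; lra.
  rewrite expr2 in hz.
  have L0 : 0 < L by lra.
  have h1 : lam * (L + 2) * (b * b) <= nm (f z) + nm c.
    rewrite -(ler_pM2l L0); apply: le_trans hz; apply: le_trans zz.
    by rewrite {2}lamE -/L le_eqVlt; apply/orP; left; apply/eqP; rewrite lamE -/L; ring.
  have h2 : lam * nm c <= lam * (b * b) by apply: ler_wpM2l; lra.
  have h3 : 1 * (b * b) <= lam * (b * b) by apply: ler_wpM2r; nra.
  by lra.
- apply: (le_trans hy); rewrite lerD2r expr2; apply: ler_wpM2l => //; lra.
- have : 1 * (b * b) <= L * (b * b) by apply: ler_wpM2r; nra.
  lra.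
Qed.

Lemma growth_comparison_iter (lam b : R) z y n : lam = N ^+ 2 * (N ^+ 2 + 2) ->
  lam * b <= nm z -> nm y <= b -> 1 + nm c <= b ->
  3 * nm (iter n f y) <= nm (iter n f z).
Proof.
move=> lamE; have N1 := distortion_ge1 K theta; have c0 := nm_ge0 c.
have lam3 : 3 <= lam by rewrite lamE; have := exprn_ege1 2 N1; nra.
elim: n z y b => [|n IH] z y b zb yb cb; first by have := nm_ge0 y; nra.
have [b' [h1 h2 h3]] := growth_comparison lamE zb yb cb.
by rewrite !iterSr; exact: IH h1 h2 h3.
Qed.

Lemma no_extension (U : set R[i]) (psi : R[i] -> R[i]) :
  bottcher_coordinate K theta c U psi -> escaping_set f 0 ->
  ~ exists Psi, extends_coordinate K theta c U psi (escaping_set f) Psi.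
Proof.
move=> bc I0 [Psi [UI agree cPsi cj]].
have [r [r1 r2 rU cpsi]] := bottcher_c11 hK bc.
have [r5 _] := far_radius_ge K theta c.
have oI := escaping_open.
have cP z : escaping_set f z -> cts_at Psi z by exact: (within_ctsP _ oI).1 cPsi z.
have IN z : escaping_set f z -> escaping_set f (- z).
  by move=> /escaping_setS Iz; apply/escaping_setS; rewrite sqr_stretch_addN.
have PsiE z : r < nm z -> nm (Psi z - z) <= 1.
  by move=> rz; rewrite -agree ?inE; [have [] := cpsi z rz|exact: rU].
have far z : escaping_set f z -> exists n, r < nm (iter n f z).
  by move=> /cvg_inftyP /(_ r)[n /(_ n (leqnn n))]; exists n.
have cjn n z : escaping_set f z -> iter n H (Psi z) = Psi (iter n f z).
  elim: n z => [//|n IH] z Iz; have [If E] := cj z Iz.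
  by rewrite !iterSr E IH.
have Psi0 z : escaping_set f z -> Psi z != 0.
  move=> Iz; apply/eqP => E; have [n rn] := far z Iz.
  have := PsiE _ rn; rewrite -cjn // E (_ : iter n H 0 = 0).
    by rewrite sub0r nmN; lra.
  by elim: n {rn} => //= n ->; exact: sqr_stretch0.
have sgn z : escaping_set f z -> Psi (- z) = Psi z \/ Psi (- z) = - Psi z.
  move=> Iz; apply: (@sqr_stretch_inj _ K theta hK).
  by have [_ ->] := cj _ (IN z Iz); have [_ ->] := cj z Iz; rewrite sqr_stretch_addN.
have cPN z : escaping_set f z -> cts_at (fun w => Psi (- w)) z.
  move=> Iz; apply: (@cts_at_comp _ (fun w => - w) Psi); last exact: cP (IN z Iz).
  by move=> e e0; exists e => // w; rewrite -opprD nmN.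
pose Ev : set R[i] := [set z | escaping_set f z /\ Psi (- z) = Psi z].
have Ev_bounded z : Ev z -> nm z <= r.
  move=> [Iz E]; rewrite leNgt; apply/negP => rz.
  have rz' : r < nm (- z) by rewrite nmN.
  have h1 := PsiE z rz; have h2 := PsiE _ rz'; rewrite E opprK in h2.
  have := nmD (Psi z + z) (- (Psi z - z)); rewrite nmN.
  by rewrite (_ : _ + _ = 2%:C * z) ?nmZ //; [lra|rewrite rmorph_nat; ring].
have Ev_open : open Ev.
  apply/open_nmP => z [Iz E]; have p0 : 0 < nm (Psi z) / 2.
    by have := Psi0 z Iz; rewrite -nm_gt0; lra.
  have [d d0 D] := cP z Iz _ p0; have [d' d'0 D'] := cPN z Iz _ p0.
  have [d1 d10 D1] := (open_nmP _).1 oI z Iz.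
  exists (Num.min d (Num.min d' d1)); first by rewrite !lt_min d0 d'0.
  move=> w; rewrite !lt_min => /and3P[/D h1 /D' h2 /D1 Iw]; split=> //.
  have [//|E'] := sgn w Iw; exfalso; rewrite E E' in h2.
  have := nmD (- (Psi w - Psi z)) (- (- Psi w - Psi z)); rewrite !nmN.
  by rewrite (_ : _ + _ = 2%:C * Psi z) ?nmZ //; [lra|rewrite rmorph_nat; ring].
have Ev0 : Ev 0 by split=> //; rewrite oppr0.
have [n rn] := far 0 I0; pose m := nm (iter n f 0).
(* The lower bound m > r makes S closed in the plane: limit points still escape, and there the
   identity Psi (- z) = Psi z passes to limits. *)
pose S : set R[i] := [set z | Ev z /\ m <= nm (iter n f z)].
have cfn z : cts_at (iter n f) z by apply: iter_cts; exact: sqr_stretch_add_cts.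
have cS : compact S.
  apply: (@closed_bounded_compact _ _ r); last by move=> z [/Ev_bounded].
  apply/closed_nmP => z nSz; have [mz|zm] := leP m (nm (iter n f z)); last first.
    have e0 : 0 < m - nm (iter n f z) by rewrite subr_gt0.
    have [d d0 D] := cfn z _ e0; exists d => // w /D h [_ h'].
    by have := nmBB (iter n f w) (iter n f z); lra.
  have Iz : escaping_set f z.
    by apply/(escaping_set_iter f n); apply: (far_escaping r1 r2); rewrite /m in mz; lra.
  have nE : 0 < nm (Psi (- z) - Psi z) / 2.
    by rewrite divr_gt0 // nm_gt0 subr_eq0; apply/eqP => E; apply: nSz.
  have [d d0 D] := cP z Iz _ nE; have [d' d'0 D'] := cPN z Iz _ nE.
  exists (Num.min d d'); first by rewrite lt_min d0.
  move=> w; rewrite lt_min => /andP[/D h1 /D' h2] [[Iw E] _]; rewrite E in h2.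
  have := nmD (- (Psi w - Psi (- z))) (Psi w - Psi z); rewrite nmN.
  by rewrite (_ : _ + _ = Psi (- z) - Psi z); [lra|ring].
have S0 : S !=set0 by exists 0; split=> //; rewrite /m.
have [z /[!inE] [[Ez mz]] zmax] := compact_EVT_max S0 cS (nm_comp_continuous (fun z _ => cfn z)).
have [d d0 D] := (open_nmP _).1 Ev_open z Ez.
have [d' d'0 D'] := iter_lift n z d0.
set v := iter n f z in mz D' zmax.
have v0 : 0 < nm v by rewrite /m in mz; lra.
(* Moving v radially outward by d' / 2 stays within the image under f^n of a small disc about z,
   which yields a point of S with larger |f^n|. *)
pose t : R := d' / (2 * nm v).
have t0 : 0 < t by rewrite divr_gt0 // mulr_gt0.
have [w wz fw] : exists2 w, nm (w - z) < d & iter n f w = (1 + t)%:C * v.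
  apply: D'; rewrite (_ : _ - v = t%:C * v); last by rewrite rmorphD /=; ring.
  rewrite nmZ ?(ltW t0) // /t (_ : _ * _ = d' / 2); first lra.
  by field; rewrite gt_eqF.
have big : nm v < nm (iter n f w) by rewrite fw nmZ; [nra|lra].
have : nm (iter n f w) <= nm v.
  by apply: zmax; rewrite inE; split; [exact: D|apply: (le_trans mz); exact: ltW].
by rewrite leNgt big.
Qed.
End Escape.

(** * The two cases *)

Section Main.
Variable R : realType.
Variables (K theta : R) (hK : 0 < K) (c : R[i]).
Local Notation N := (distortion K theta).
Local Notation H := (sqr_stretch K theta).
Local Notation f := (sqr_stretch_add K theta c).

Section Levels.
Variables (U : set R[i]) (psi : R[i] -> R[i]) (r : R).
Hypotheses (bc : bottcher_coordinate K theta c U psi)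
  (r1 : far_radius K theta c <= r) (r2 : 4 * N ^+ 2 <= r) (rU : forall z, r < nm z -> U z)
  (cpsi : c11 r (lin_bound K theta) (quad_bound K theta) psi)
  (UI : U `<=` escaping_set f).

Let M : R := r + 2 * N ^+ 2 + nm c + 5.
Local Notation V0 := (far_level psi r M).
Local Notation Wn := (square_level K theta M).
Local Notation Vn := (preimage_level K theta c V0).

Lemma level_bounds : [/\ 0 <= M, r + 2 <= M, 2 * N ^+ 2 <= M & 1 + nm c <= M].
Proof.
have [r5 _] := far_radius_ge K theta c; have r1' := r1; have c0 := nm_ge0 c.
have N2 : 0 <= N ^+ 2 by exact: sqr_ge0.
by rewrite /M; split; lra.
Qed.

Lemma preimage_level_escaping n z : Vn n z -> escaping_set f z.
Proof.
move=> [rz _]; apply/(escaping_set_iter f n); exact: (far_escaping hK r1 r2 rz).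
Qed.

Lemma escaping_preimage_level z : escaping_set f z -> exists n, Vn n z.
Proof.
have [M0 rM _ _] := level_bounds.
move=> /cvg_inftyP /(_ (2 * M + 1))[n /(_ n (leqnn n)) h]; exists n.
have rn : r < nm (iter n f z) by lra.
split=> //; apply: nm_outer_square; have [h1 _] := cpsi rn.
have := nmBB (iter n f z) (iter n f z - psi (iter n f z)).
rewrite (_ : iter n f z - (iter n f z - _) = psi (iter n f z)); last by ring.
by rewrite nmB in h1; lra.
Qed.

Lemma extension_case1 : ~ escaping_set f 0 -> exists Psi : R[i] -> R[i],
  [/\ extends_coordinate K theta c U psi (escaping_set f) Psi,
      {in escaping_set f &, injective Psi},
      locally_quasiconformal (escaping_set f) Psi &
      forall z, escaping_set f z -> escaping_set H (Psi z)].
Proof.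
move=> nI0; have [M0 rM MN Mc] := level_bounds.
have [Phi0 [base [near0 _ Phi0K]]] := base_inv_coord hK bc r1 rU cpsi rM MN.
have nc m : ~ Vn m c.
  move=> /preimage_level_escaping Ic; apply: nI0; apply/escaping_setS.
  by rewrite sqr_stretch_add0.
have [Phi [inv ext]] := inv_coord_union hK M0 MN Mc base near0 nc.
have VE : \bigcup_n Vn n = escaping_set f.
  apply/seteqP; split=> [z [n _ /preimage_level_escaping]|z /escaping_preimage_level[n Vz]] //.
  by exists n.
rewrite VE in inv.
have [] := @coordinate_extension _ _ _ hK _ _ _ _ M bc r1 rU cpsi _ _ _ _ inv _ _ _ nI0 UI ext Phi0K.
- by apply: bigcup_open => n _; exact: square_level_open.
- by move=> w Qw; exists 0%N.
- by move=> [n _]; exact: square_level0.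
- by move=> z /escaping_preimage_level.
move=> Psi [extends inj qc _ PsiW]; exists Psi; split=> // z /PsiW[n _].
by apply: square_level_escaping => //; have c0 := nm_ge0 c; lra.
Qed.

Hypothesis level_bound : forall k z, U z -> 3 * nm (iter k f c) <= nm (iter k f z).

Lemma extension_case2 : escaping_set f 0 -> exists (V : set R[i]) (Psi : R[i] -> R[i]),
  [/\ [/\ open V, connected V, V c & V `<=` escaping_set f],
      extends_coordinate K theta c U psi V Psi,
      {in V &, injective Psi} &
      locally_quasiconformal V Psi].
Proof.
move=> I0; have [M0 rM MN Mc] := level_bounds; have [r5 _] := far_radius_ge K theta c.
have [Phi0 [base [near0 _ Phi0K]]] := base_inv_coord hK bc r1 rU cpsi rM MN.
have Ic : escaping_set f c.
  by move/escaping_setS: I0; rewrite sqr_stretch_add0.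
have ex : exists n, `[< Vn n c >].
  by have [n Vc] := escaping_preimage_level Ic; exists n; apply/asboolP.
have [k /asboolP Vc kmin] := ex_minnP ex.
have nc m : (m < k)%N -> ~ Vn m c.
  by move=> mk /asboolP /kmin; rewrite leqNgt mk.
have [Phi [inv ext]] := inv_coord_level hK M0 MN Mc base near0 nc.
(* Since c is in level k, |f^k c| > M - 1; hence |f^k z| > 3 (M - 1) >= 2 M + 1, which suffices for
   the outer square. *)
have UV : U `<=` Vn k.
  move=> z Uz; have h := level_bound k Uz; have [rc Qc] := Vc.
  have h1 := outer_square_nm Qc; have [h2 _] := cpsi rc.
  have h3 := nmBB (psi (iter k f c)) (psi (iter k f c) - iter k f c).
  rewrite (_ : psi (iter k f c) - (psi (iter k f c) - iter k f c) = iter k f c) in h3; last by ring.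
  have r1' := r1; have c0 := nm_ge0 c.
  have rz : r < nm (iter k f z) by lra.
  split=> //; apply: nm_outer_square; have [h4 _] := cpsi rz.
  have := nmBB (iter k f z) (iter k f z - psi (iter k f z)).
  rewrite (_ : iter k f z - (iter k f z - _) = psi (iter k f z)); last by ring.
  by rewrite nmB in h4; lra.
(* At a positive level 0 would put c in the previous one, against minimality; level 0 contains only
   points of modulus above r. *)
have V0n : ~ Vn k 0.
  case: k Vc kmin nc inv UV => [|k] Vc kmin nc inv UV.
    by move=> [h _]; have {}h : r < nm (0 : R[i]) := h; rewrite nm0 in h; have r1' := r1; lra.
  move=> /preimage_levelS; rewrite sqr_stretch_add0; exact: nc.
have [] := @coordinate_extension _ _ _ hK _ _ _ _ M bc r1 rU cpsi _ _ _ _ inv _ _ _ V0n UV ext Phi0K.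
- exact: square_level_open.
- exact: (@square_level_mono _ _ _ hK _ MN 0%N k (leq0n k)).
- exact: square_level0.
- by move=> z Vz; exists k.
move=> Psi [extends inj qc oV _]; exists (Vn k), Psi; split=> //; split=> //; last first.
  by move=> z; exact: preimage_level_escaping.
have [cP [inV sj] _ _ _] := inv.
rewrite (_ : Vn k = Phi @` Wn k); last first.
  by apply/seteqP; split=> [z /sj[w Ww <-]|_ [w Ww <-]]; [exists w|exact: inV].
apply: connected_continuous_connected; first exact: square_level_connected.
by apply/(within_ctsP _ (@square_level_open _ K theta M k)).
Qed.
End Levels.
End Main.

Unset Implicit Arguments.

Theorem theorem2p4 (R : realType) (K theta : R) (hK : 0 < K) (c : R[i]) :
  let H := sqr_stretch K theta in
  let f := sqr_stretch_add K theta c in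
  exists r0 : R, forall (U : set R[i]) (psi : R[i] -> R[i]),
    U `<=` [set z | r0%:C < `|z|] ->
    bottcher_coordinate K theta c U psi ->
    (~ escaping_set f 0 ->
       exists Psi : R[i] -> R[i],
         [/\ extends_coordinate K theta c U psi (escaping_set f) Psi,
             {in escaping_set f &, injective Psi},
             locally_quasiconformal (escaping_set f) Psi &
             forall z, escaping_set f z -> escaping_set H (Psi z)]) /\
    (escaping_set f 0 ->
       (~ exists Psi : R[i] -> R[i],
            extends_coordinate K theta c U psi (escaping_set f) Psi) /\
       (exists (V : set R[i]) (Psi : R[i] -> R[i]),
          [/\ [/\ open V, connected V, V c & V `<=` escaping_set f],
              extends_coordinate K theta c U psi V Psi,
              {in V &, injective Psi} &
              locally_quasiconformal V Psi])).
Proof.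
move=> H f; set N := distortion K theta.
pose lam : R := N ^+ 2 * (N ^+ 2 + 2).
(* The first two terms make U escape; the third starts the comparison of U with c at b = 1 + |c|. *)
pose r0 := Num.max (far_radius K theta c) (Num.max (4 * N ^+ 2) (lam * (1 + nm c))).
exists r0 => U psi Ur0 bc.
have e1 : far_radius K theta c <= r0 by rewrite le_max lexx.
have e2 : 4 * N ^+ 2 <= r0 by rewrite !le_max lexx orbT.
have e3 : lam * (1 + nm c) <= r0 by rewrite !le_max lexx !orbT.
have Ur z : U z -> r0 < nm z by move=> /Ur0; rewrite /= normE ltcR.
have UI : U `<=` escaping_set f by move=> z /Ur; exact: far_escaping.
have [r [r1 r2 rU cpsi]] := bottcher_c11 hK bc.
split=> [|I0]; first exact: (extension_case1 hK bc r1 r2 rU cpsi UI).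
split; first exact: no_extension.
apply: (extension_case2 hK bc r1 r2 rU cpsi) => // k z /Ur rz.
apply: (growth_comparison_iter hK k (erefl lam) (b := 1 + nm c)) => //.
  by apply: (le_trans e3); exact: ltW.
by rewrite lerDr.
Qed.
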